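(* Let $G$ be a finitely generated, contracting, self-replicating, self-similar branch group (in $\mathrm{Aut}(\mathsf X^* )$ for a finite alphabet $\mathsf X$). Then $G$ has Property FW if and only if $G$ is just-infinite and its limit $G$-space $\mathcal X_G$ has no local cut point.
   Context: Self-similar groups. $\mathsf X^*$ is the rooted tree of finite words over $\mathsf X$, with boundary $\mathsf X^\omega$. For $g\in\mathrm{Aut}(\mathsf X^* )$ and $v\in\mathsf X^*$ the section $g|_v$ is defined by $g(vw)=g(v)\,g|_v(w)$ for all $w$. $G\le\mathrm{Aut}(\mathsf X^* )$ is self-similar if $g|_v\in G$ for all $g\in G$, $v\in \mathsf X^*$. It is self-replicating if it acts transitively on $\mathsf X$ and, for $x\in \mathsf X$, the map $G_x\to G$, $g\mapsto g|_x$ from the stabilizer of $x$ is onto. It is contracting if there is a finite set $\mathcal N\subset G$ such that for every $g\in G$ there is $m$ with $g|_v\in\mathcal N$ for all $|v|\ge m$; the smallest such $\mathcal N$ is the nucleus. Branch. For a vertex $v$, $\mathrm{RiSt}(v)$ is the subgroup of elements of $G$ fixing every vertex outside the subtree $v\mathsf X^*$, and $\mathrm{RiSt}(n)=\langle\mathrm{RiSt}(v):|v|=n\rangle$. $G$ is branch if it is transitive on every level $\mathsf X^n$ and $\mathrm{RiSt}(n)$ has finite index in $G$ for all $n$. $G$ is just-infinite if every quotient by a nontrivial normal subgroup is finite. Limit $G$-space. Let $\mathsf X^{-\omega}$ be the space of left-infinite sequences $\ldots x_2x_1$ (product topology), $G$ discrete. In $\mathsf X^{-\omega}\times G$ declare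 $\ldots x_2x_1\cdot g\sim \ldots y_2y_1\cdot h$ if there are $s_n\in\mathcal N$, $n\ge0$, with $s_n(x_n)=y_n$ and $s_n|_{x_n}=s_{n-1}$ for all $n\ge1$, and $s_0g=h$. $\mathcal X_G$ is the quotient space. It is connected and locally path-connected in the self-replicating finitely generated case. Local cut point: a point $\zeta$ of a locally connected space having a connected neighbourhood $U$ such that $U\setminus\{\zeta\}$ has at least two connected components. Property FW. For an action of $G$ on a set $Y$, a subset $A\subset Y$ is commensurated if $gA\triangle A$ is finite for all $g\in G$, and transfixed if it has finite symmetric difference with a $G$-invariant subset. $G$ has Property FW if every commensurated subset of every $G$-set is transfixed. *)

(* Defs.v *)
From HB Require Import structures.
From Stdlib Require Import Relation_Operators.
From mathcomp Require Import all_boot generic_quotient.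
From mathcomp Require Import boolp classical_sets functions cardinality.
From mathcomp Require Import topology.

Set Implicit Arguments.
Unset Strict Implicit.
Unset Printing Implicit Defensive.

Local Open Scope classical_set_scope.
Local Open Scope group_scope.

Section Groups.
Variable T : groupType.

Definition subgroup (H : set T) : Prop :=
  [/\ H 1, forall x y, H x -> H y -> H (x * y) & forall x, H x -> H x^-1].

Definition generated (A : set T) : set T := smallest subgroup A.

Definition finitely_generated : Prop :=
  exists A : set T, finite_set A /\ generated A = [set: T].

Definition left_coset (H : set T) (x : T) : set T := [set x * h | h in H].

Definition finite_index (H : set T) : Prop := finite_set (range (left_coset H)).

Definition normal_subgroup (H : set T) : Prop :=
  subgroup H /\ forall x h, H h -> H (h ^ x).

(* The trivial group and finite groups are not excluded. *)
Definition just_infinite : Prop :=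
  forall H : set T, normal_subgroup H -> H <> [set 1] -> finite_index H.

Definition is_left_action (Y : Type) (act : T -> Y -> Y) : Prop :=
  (forall y, act 1 y = y) /\
  (forall g h y, act (g * h) y = act g (act h y)).

Definition commensurated (Y : Type) (act : T -> Y -> Y) (A : set Y) : Prop :=
  forall g, finite_set ((act g @` A) `+` A).

Definition transfixed (Y : Type) (act : T -> Y -> Y) (A : set Y) : Prop :=
  exists B : set Y, (forall g, act g @` B = B) /\ finite_set (A `+` B).

Definition property_FW : Prop :=
  forall (Y : Type) (act : T -> Y -> Y), is_left_action act ->
  forall A : set Y, commensurated act A -> transfixed act A.

End Groups.

Section TreeAutomorphisms.
Variable X : finType.
Implicit Types (f : seq X -> seq X) (u v w : seq X).

Definition child v w : Prop := exists x, w = rcons v x.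

Definition is_tree_aut f : Prop :=
  [/\ bijective f, f [::] = [::] & forall v w, child v w <-> child (f v) (f w)].

Lemma is_tree_aut_id : is_tree_aut id.
Proof. by split=> //; exists id. Qed.

Lemma is_tree_aut_comp f f' :
  is_tree_aut f -> is_tree_aut f' -> is_tree_aut (f \o f').
Proof.
move=> [bf f0 fc] [bf' f0' fc']; split; first exact: bij_comp.
- by rewrite /= f0' f0.
- by move=> v w; rewrite fc' fc.
Qed.

Lemma is_tree_aut_inv f f' :
  cancel f f' -> cancel f' f -> is_tree_aut f -> is_tree_aut f'.
Proof.
move=> fK f'K [_ f0 fc]; split; first by exists f.
- by rewrite -f0 fK.
- by move=> v w; rewrite (fc (f' v)) !f'K.
Qed.

Lemma tree_aut_size f v : is_tree_aut f -> size (f v) = size v.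
Proof.
move=> [_ f0 fc]; elim/last_ind: v => [|v x IH]; first by rewrite f0.
have [y ->] : child (f v) (f (rcons v x)) by apply: (fc _ _).1; exists x.
by rewrite !size_rcons IH.
Qed.

Definition section_fun f v : seq X -> seq X :=
  fun w => drop (size v) (f (v ++ w)).

Lemma section_funE f v w :
  is_tree_aut f -> f (v ++ w) = f v ++ section_fun f v w.
Proof.
move=> fa; have [_ _ fc] := fa.
have [u fE] : exists u, f (v ++ w) = f v ++ u.
  elim/last_ind: w => [|w x [u IH]]; first by exists [::]; rewrite !cats0.
  have [y] : child (f (v ++ w)) (f (rcons (v ++ w) x)) by apply: (fc _ _).1; exists x.
  by rewrite IH rcons_cat rcons_cat => ->; exists (rcons u y).
by rewrite /section_fun fE drop_size_cat // tree_aut_size.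
Qed.

Lemma is_tree_aut_section f v : is_tree_aut f -> is_tree_aut (section_fun f v).
Proof.
move=> fa; have [[f' fK f'K] f0 fc] := fa.
have fa' := is_tree_aut_inv fK f'K fa.
have sz := tree_aut_size v fa.
split.
- exists (section_fun f' (f v)) => w.
    by rewrite /section_fun -section_funE // fK sz drop_size_cat.
  have e : v ++ section_fun f' (f v) w = f' (f v ++ w).
    by rewrite section_funE // fK.
  by rewrite {1}/section_fun e f'K -sz drop_size_cat.
- by rewrite /section_fun cats0 -sz drop_size.
- have childE u a b : child (u ++ a) (u ++ b) <-> child a b.
    split=> -[x e]; exists x; last by rewrite e rcons_cat.
    by move/eqP: e; rewrite rcons_cat eqseq_cat // eqxx => /eqP.
  move=> a b; rewrite -(childE v) fc !section_funE //; exact: childE.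
Qed.

Record tree_aut : Type := TreeAut {
  tree_aut_fun :> seq X -> seq X;
  tree_autP : is_tree_aut tree_aut_fun }.

Lemma tree_aut_eq (g h : tree_aut) : (forall v, g v = h v) -> g = h.
Proof.
case: g h => [g ga] [h ha] /= /funext gh; case: h / gh in ha *.
by congr TreeAut; exact: Prop_irrelevance.
Qed.

HB.instance Definition _ := gen_eqMixin tree_aut.
HB.instance Definition _ := gen_choiceMixin tree_aut.

Definition aut_one : tree_aut := TreeAut is_tree_aut_id.

Definition aut_mul (g h : tree_aut) : tree_aut :=
  TreeAut (is_tree_aut_comp (tree_autP g) (tree_autP h)).

Lemma tree_aut_has_inv (g : tree_aut) : exists h : tree_aut,
  cancel g h /\ cancel h g.
Proof.
have [[f' fK f'K] _ _] := tree_autP g.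
by exists (TreeAut (is_tree_aut_inv fK f'K (tree_autP g))).
Qed.

Definition aut_inv (g : tree_aut) : tree_aut := projT1 (cid (tree_aut_has_inv g)).

Lemma aut_mulA : associative aut_mul.
Proof. by move=> g h k; apply: tree_aut_eq. Qed.

Lemma aut_mul1 : left_id aut_one aut_mul.
Proof. by move=> g; apply: tree_aut_eq. Qed.

Lemma aut_mulr1 : right_id aut_one aut_mul.
Proof. by move=> g; apply: tree_aut_eq. Qed.

Lemma aut_mulV : left_inverse aut_one aut_inv aut_mul.
Proof.
by move=> g; apply: tree_aut_eq => v; rewrite /aut_inv /=; case: cid => h [/= ->].
Qed.

Lemma aut_mulVr : right_inverse aut_one aut_inv aut_mul.
Proof.
by move=> g; apply: tree_aut_eq => v; rewrite /aut_inv /=; case: cid => h [/= _ ->].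
Qed.

(* The product g * h is the composition v |-> g (h v), so that the group acts
   on the tree from the left. *)
HB.instance Definition _ :=
  isGroup.Build tree_aut aut_mulA aut_mul1 aut_mulr1 aut_mulV aut_mulVr.

Definition section (g : tree_aut) v : tree_aut :=
  TreeAut (is_tree_aut_section v (tree_autP g)).

Lemma sectionE (g : tree_aut) v w : g (v ++ w) = g v ++ section g v w.
Proof. exact: section_funE (tree_autP g). Qed.

End TreeAutomorphisms.

Section Subgroup.
Variables (X : finType) (G : groupClosed (tree_aut X)).

Record group_of : Type := GroupOf {
  aut_of :> tree_aut X;
  aut_ofP : aut_of \in G }.

HB.instance Definition _ := [isSub for aut_of].
HB.instance Definition _ := [Choice of group_of by <:].

Lemma group_of_closed : group_closed (mem G).
Proof. by split=> [|g h gG hG]; [exact: gpred1 | exact: gpredF]. Qed.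

HB.instance Definition _ :=
  SubChoice_isSubGroup.Build (tree_aut X) (mem G) group_of group_of_closed.

End Subgroup.

Section SelfSimilar.
Variables (X : finType) (G : groupClosed (tree_aut X)).

Definition self_similar : Prop :=
  forall (g : tree_aut X) (v : seq X), g \in G -> section g v \in G.

Definition self_replicating : Prop :=
  (forall x y : X, exists2 g : tree_aut X, g \in G & g [:: x] = [:: y]) /\
  (forall (x : X) (h : tree_aut X), h \in G ->
     exists g : tree_aut X, [/\ g \in G, g [:: x] = [:: x] & section g [:: x] = h]).

Definition absorbing (N : set (tree_aut X)) : Prop :=
  [/\ finite_set N, (forall g, N g -> g \in G) &
      forall g, g \in G -> exists m : nat,
        forall v : seq X, (m <= size v)%N -> N (section g v)].

Definition contracting : Prop := exists N, absorbing N.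

(* The intersection of all absorbing sets; it is itself absorbing, hence the
   smallest absorbing set, as soon as G is contracting. *)
Definition nucleus : set (tree_aut X) := smallest absorbing set0.

Definition rist (v : seq X) : set (group_of G) :=
  [set g : group_of G | forall w : seq X, ~~ prefix v w -> g w = w].

Definition level_rist (n : nat) : set (group_of G) :=
  generated (\bigcup_(v in [set v : seq X | size v = n]) rist v).

Definition level_transitive : Prop :=
  forall u v : seq X, size u = size v ->
    exists2 g : tree_aut X, g \in G & g u = v.

Definition branch : Prop :=
  level_transitive /\ forall n, finite_index (level_rist n).

(* The left-infinite sequence ... x_2 x_1 is encoded by x : nat -> X with
   x n = x_(n+1); no index is shifted in the sequence s_0, s_1, ... *)
Definition left_infinite : topologicalType :=
  {ptws nat -> discrete_topology X}.

Definition pre_limit_space : topologicalType :=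
  (left_infinite * discrete_topology (group_of G))%type.

Definition asymptotic (p q : pre_limit_space) : Prop :=
  exists s : nat -> tree_aut X,
    [/\ forall n, nucleus (s n),
        forall n, s n.+1 [:: p.1 n] = [:: q.1 n] /\
                  section (s n.+1) [:: p.1 n] = s n &
        s 0%N * aut_of p.2 = aut_of q.2].

(* When G is contracting and self-similar, asymptotic is already an equivalence
   relation; the closure is taken only so that the quotient is defined
   without those hypotheses. *)
Definition limit_rel : rel pre_limit_space :=
  fun p q => `[< clos_refl_sym_trans _ asymptotic p q >].

Lemma limit_rel_refl : reflexive limit_rel.
Proof. by move=> p; apply/asboolP; exact: rst_refl. Qed.

Lemma limit_rel_sym : symmetric limit_rel.
Proof. by move=> p q; apply: asbool_equiv_eq; split; exact: rst_sym. Qed.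

Lemma limit_rel_trans : transitive limit_rel.
Proof.
by move=> q p r /asboolP pq /asboolP qr; apply/asboolP; exact: rst_trans pq qr.
Qed.

Canonical limit_equiv :=
  EquivRel limit_rel limit_rel_refl limit_rel_sym limit_rel_trans.

Definition limit_space : topologicalType :=
  quotient_topology {eq_quot limit_rel}%qT.

End SelfSimilar.

Definition local_cut_point (T : topologicalType) (z : T) : Prop :=
  exists U : set T, [/\ nbhs z U, connected U &
    exists a b : T, [/\ (U `\ z) a, (U `\ z) b &
      connected_component (U `\ z) a <> connected_component (U `\ z) b]].

(* Main.v *)
(** Tiles of level [n] of the limit [G]-space are indexed by [X^n * G], on which
    [G] acts from the left; by self-replication this action is transitive, two
    tiles meet exactly when an element of the nucleus moves one to the other,
    and the stabilizer of a tile over [v] fixes [v] and has trivial section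
    there.

    Zooming in at a local cut point gives, for larger and larger [n], 2-colorings of
    the level-[n] tiles whose only color changes are near the point; an
    ultralimit of these pointed [G]-sets carries a commensurated set that is
    not transfixed.  A proper infinite quotient of [G] would be finitely
    generated and virtually abelian, hence without Property FW.

    Conversely let [A] be a commensurated, not transfixed subset of a transitive
    [G]-set, with [G] branch and just-infinite.  For every [n] each point has a unique
    vertex [v] of level [n] whose rigid stabilizer has an orbit cut by [A]
    through that point; the elements acting trivially below [v] commute with
    this rigid stabilizer and move the point in a finite orbit only, since
    otherwise a translate nested in [A] would give a nonzero homomorphism to
    the integers from a subgroup of finite index.  Passing to the quotient by these
    finite orbits does not increase the number of vertices over which
    the color changes, so that one gets colorings of the level-[n] tiles with
    a uniformly bounded set of exceptional vertices.  The color classes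
    converge to two closed sets covering the limit space and meeting in a
    discrete set; as the limit space is connected, a point of this set is a local cut
    point. *)

Require Import Defs.
From HB Require Import structures.
From Stdlib Require Import Relation_Operators.
From mathcomp Require Import all_boot generic_quotient.
From mathcomp Require Import boolp classical_sets functions cardinality.
From mathcomp Require Import filter topology zify.

Set Implicit Arguments.
Unset Strict Implicit.
Unset Printing Implicit Defensive.

Local Open Scope classical_set_scope.
Local Open Scope group_scope.

(** * Groups and finite index *)

(** The limit space is handled through one combinatorial relation, adjacency of level-n tiles by a
    nucleus element: at all levels it is equality of points, at one level it gives basic
    neighbourhoods, and connectedness becomes the existence of chains at every level. It is
    transitive only up to a loss of boundedly many levels, the source of the many constants [k].
    Tiles are not assumed connected: a chain joining two points of a tile may leave it, and
    contraction bounds how far. Two obstacles shape the converse. The bound on exceptional vertices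
    must not depend on the level; it comes from the points of [A] that the nucleus moves out of [A],
    listed before any level is chosen. And one color could shrink to isolated points in the limit;
    so among the infinite and coinfinite cuts one with minimal boundary is taken, whose color
    components are never finite. The homomorphism to the integers counts the points entering minus
    those leaving [A] inside a cut orbit. It vanishes because the elements killed along with all
    their conjugates form a normal subgroup, nontrivial since finite-index subgroups of a branch
    group are not abelian. *)

Lemma finite_set_seq (T : choiceType) (A : set T) :
  finite_set A -> exists s : seq T, forall x, A x <-> x \in s.
Proof. by case/finite_seqP=> s ->; exists s. Qed.

Lemma finite_set_bigcup_seq (I : eqType) (T : Type) (s : seq I) (F : I -> set T) :
  (forall i, i \in s -> finite_set (F i)) ->
  finite_set [set x | exists2 i, i \in s & F i x].
Proof.
elim: s => [|i s IH] h.
  by apply: sub_finite_set (finite_set0 T) => x [].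
have h1 : finite_set (F i) by apply: h; rewrite inE eqxx.
have h2 : finite_set [set x | exists2 i, i \in s & F i x].
  by apply: IH => j js; apply: h; rewrite inE js orbT.
have h3 : finite_set (F i `|` [set x | exists2 i, i \in s & F i x]).
  by rewrite finite_setU.
apply: sub_finite_set h3 => x [j].
by rewrite inE => /orP[/eqP -> Fx|js Fx]; [left|right; exists j].
Qed.

Lemma finite_set_bigcup (I T : Type) (D : set I) (F : I -> set T) :
  finite_set D -> (forall i, D i -> finite_set (F i)) ->
  finite_set [set x | exists2 i, D i & F i x].
Proof.
move=> fD fF; pose I' := {classic I}.
have [s sP] := @finite_set_seq I' D fD.
apply: sub_finite_set (@finite_set_bigcup_seq I' T s F _); last first.
  by move=> i /sP /fF.
by move=> x [i /sP Di Fx]; exists i.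
Qed.

Lemma finite_set_inj (T U : Type) (f : T -> U) (A : set T) (B : set U) :
  finite_set B -> (forall x, A x -> B (f x)) ->
  (forall x y, A x -> A y -> f x = f y -> x = y) -> finite_set A.
Proof.
move=> fB AB inj.
have : finite_set (f @` A) by apply: sub_finite_set fB => _ [x /AB ? <-].
case: (pselect (A !=set0)) => [[a0 Aa0]|A0]; last first.
  by move=> _; apply: sub_finite_set (finite_set0 T) => x Ax; case: A0; exists x.
move=> fA.
pose g u : T := xget (a0 : {classic T}) [set x : {classic T} | A x /\ f x = u].
apply: sub_finite_set (finite_image g fA) => x Ax.
exists (f x); first by exists x.
rewrite /g; case: xgetP => [y -> [Ay yx]|/(_ x)[]]; last by split.
exact: inj.
Qed.

Section Subgroups.
Variable T : groupType.
Implicit Types (H K : set T) (g x y : T).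

Lemma subgroup1 H : subgroup H -> H 1. Proof. by case. Qed.

Lemma subgroupM H x y : subgroup H -> H x -> H y -> H (x * y).
Proof. by case=> _ h _; apply: h. Qed.

Lemma subgroupV H x : subgroup H -> H x -> H x^-1.
Proof. by case=> _ _; apply. Qed.

Lemma subgroupX H x n : subgroup H -> H x -> H (x ^+ n).
Proof.
move=> sH Hx; elim: n => [|n IH]; first exact: subgroup1.
by rewrite expgS; apply: subgroupM.
Qed.

Lemma generated_subgroup (A : set T) : subgroup (generated A).
Proof.
split=> [|x y gx gy|x gx] B [sB AB]; first exact: subgroup1.
- by apply: subgroupM => //; [apply: gx|apply: gy].
- by apply: subgroupV => //; apply: gx.
Qed.

Lemma sub_generated (A : set T) x : A x -> generated A x.
Proof. by move=> Ax B [_ AB]; apply: AB. Qed.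

Lemma generated_ind (A : set T) (P : T -> Prop) : subgroup P ->
  (forall x, A x -> P x) -> forall x, generated A x -> P x.
Proof. by move=> sP AP x; apply. Qed.

Lemma finite_indexP H : subgroup H ->
  finite_index H <-> exists s : seq T, forall g, exists2 t, t \in s & H (t^-1 * g).
Proof.
move=> sH; split.
- move=> /finite_set_seq [l lP].
  have : forall B, B \in l -> exists t, B = left_coset H t.
    by move=> B /lP [t _ <-]; exists t.
  move=> hl; pose f B := xget 1 [set t | B = left_coset H t].
  exists (map f l) => g.
  have gl : left_coset H g \in l by apply/lP; exists g.
  exists (f (left_coset H g)); first exact: map_f.
  rewrite /f; case: xgetP => [t _ /= e|/(_ g)[]//].
  have : left_coset H g g by exists 1; [exact: subgroup1|rewrite mulg1].
  by rewrite e => -[h Hh <-]; rewrite mulKg.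
- move=> [s sP]; apply: sub_finite_set (finite_image (left_coset H) (finite_seq s)).
  move=> _ [g _ <-]; have [t ts Htg] := sP g; exists t => //.
  apply/seteqP; split=> y [h Hh <-] /=.
    exists ((t^-1 * g)^-1 * h); last by rewrite invgM invgK !mulgA mulgV mul1g.
    by apply: subgroupM => //; apply: subgroupV.
  exists ((t^-1 * g) * h); last by rewrite !mulgA mulgV mul1g.
  exact: subgroupM.
Qed.

Lemma finite_index_fun (U : Type) (f : T -> U) (B : set U) H : subgroup H ->
  finite_set B -> (forall g, B (f g)) ->
  (forall g h, f g = f h -> H (g^-1 * h)) -> finite_index H.
Proof.
move=> sH fB Bf fH; apply/finite_indexP => //.
have fR : finite_set (range (f : T -> {classic U})).
  by apply: sub_finite_set fB => _ [g _ <-].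
have [l lP] := finite_set_seq fR.
pose k u := xget 1 [set g | f g = u].
exists (map k l) => g; exists (k (f g)).
  by apply: (@map_f {classic U}); apply/lP; exists g.
apply: fH; rewrite /k; case: xgetP => [t _ //|/(_ g)[]//].
Qed.

Lemma finite_index_trans H K : subgroup H -> subgroup K -> finite_index H ->
  (exists s : seq T, forall h, H h -> exists2 t, t \in s & K (t^-1 * h)) ->
  finite_index K.
Proof.
move=> sH sK /(finite_indexP sH)[l lP] [s sP]; apply/finite_indexP => //.
exists [seq a * b | a <- l, b <- s] => g.
have [a al ag] := lP g; have [b bs bg] := sP _ ag.
exists (a * b); first by apply/allpairsP; exists (a, b).
by rewrite invgM -mulgA.
Qed.

Lemma finite_index_sub H K : subgroup H -> subgroup K -> H `<=` K ->
  finite_index H -> finite_index K.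
Proof.
move=> sH sK HK /(finite_indexP sH)[l lP]; apply/finite_indexP => //.
by exists l => g; have [t tl tg] := lP g; exists t => //; apply: HK.
Qed.

Lemma finite_index_pow H x : subgroup H -> finite_index H ->
  exists2 n, (0 < n)%N & H (x ^+ n).
Proof.
move=> sH /(finite_indexP sH)[l lP].
have /choice[f fP] : forall i, exists t, t \in l /\ H (t^-1 * x ^+ i).
  by move=> i; have [t] := lP (x ^+ i); exists t.
have : ~ uniq (map f (iota 0 (size l).+1)).
  move=> u; have := uniq_leq_size u (_ : {subset _ <= l}).
  rewrite size_map size_iota ltnn => h; suff: false by [].
  by apply: h => _ /mapP[i _ ->]; case: (fP i).
move/negP/(uniqPn 1) => [i [j [ij]]]; rewrite size_map size_iota => jl.
rewrite !(nth_map 0) ?size_iota ?(ltn_trans ij) // !nth_iota ?(ltn_trans ij) // !add0n.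
move=> fij; exists (j - i)%N; first by rewrite subn_gt0.
have [_ hi] := fP i; have [_ hj] := fP j.
have := subgroupM sH (subgroupV sH hi) hj.
by rewrite fij invgM invgK mulgA mulgK -{1}(subnKC (ltnW ij)) expgnDr mulKg.
Qed.

End Subgroups.

(** * Finite generation of finite-index subgroups *)

Section FiniteGeneration.
Variable T : groupType.
Implicit Types (H K : set T) (g x y : T).

(** Schreier's lemma: a generator sends a representative from [l] to another one up to an element of
    [E], so a word is rewritten letter by letter. The representatives lying in [H] join [S] because
    [l] need not contain 1. *)
Lemma finite_index_fg H : finitely_generated T -> subgroup H -> finite_index H ->
  exists2 S : set T, finite_set S & generated S = H.
Proof.
move=> [A [fA genA]] sH fH; have /(finite_indexP sH)[l lP] := fH.
have /choice[r rP] : forall g, exists t, t \in l /\ H (t^-1 * g).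
  by move=> g; have [t] := lP g; exists t.
pose A' := A `|` [set x^-1 | x in A].
have fA' : finite_set A' by rewrite finite_setU; split=> //; exact: finite_image.
pose E := [set (r (s * t))^-1 * (s * t) | s in A' & t in [set` l]].
have fE : finite_set E by apply: finite_image2 => //; exact: finite_seq.
pose S := E `|` ([set` l] `&` H).
have SH : S `<=` H.
  move=> x [[s _ [t _ <-]]|[_ //]]; exact: (rP _).2.
exists S.
  by rewrite finite_setU; split=> //; apply: finite_setIl; exact: finite_seq.
apply/seteqP; split=> [x gx|x Hx]; first exact: gx.
pose P g := forall t, t \in l ->
  exists t' e, [/\ t' \in l, generated E e & g * t = t' * e].
have PM g h : P g -> P h -> P (g * h).
  move=> Pg Ph t /Ph [t' [e [t'l ge he]]]; have [t'' [e' [? ge' he']]] := Pg _ t'l.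
  exists t'', (e' * e); split=> //; last by rewrite -mulgA he mulgA he' mulgA.
  exact: subgroupM (generated_subgroup _) ge' ge.
have PA s : A' s -> P s.
  move=> As t tl; exists (r (s * t)), ((r (s * t))^-1 * (s * t)); split.
  - exact: (rP _).1.
  - by apply: sub_generated; exists s => //; exists t.
  - by rewrite mulVKg.
have Px : P x.
  have : generated A x by rewrite genA.
  case/(@generated_ind _ A (fun g => P g /\ P g^-1)) => //.
  - split.
    + split; rewrite ?invg1 => t tl; exists t, 1; split; rewrite ?mul1g ?mulg1 //;
        by apply: subgroup1; apply: generated_subgroup.
    + move=> y z [Py Py'] [Pz Pz']; split; first exact: PM.
      by rewrite invgM; apply: PM.
    + by move=> y [Py Py']; rewrite invgK.
  - move=> y Ay; split; apply: PA; [by left|by right; exists y].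
have [t0 t0l t0H] := lP 1.
have {}t0H : H t0 by rewrite -[t0]invgK; apply: subgroupV => //; rewrite mulg1 in t0H.
have [t' [e [t'l ge he]]] := Px _ t0l.
have He : H e by apply: ge; split=> // y Ey; apply: SH; left.
have gS := generated_subgroup S.
have -> : x = t' * e * t0^-1 by rewrite -he mulgK.
apply: (subgroupM gS); first apply: (subgroupM gS).
- apply: sub_generated; right; split=> //.
  have -> : t' = x * t0 * e^-1 by rewrite he mulgK.
  by apply: subgroupM => //; [apply: subgroupM|apply: subgroupV].
- by apply: (generated_ind gS _ ge) => y Ey; apply: sub_generated; left.
- by apply: (subgroupV gS); apply: sub_generated; right.
Qed.

End FiniteGeneration.

(** * Commensurated sets tested on generators *)

Section Commensurated.
Variables (T : groupType) (Y : Type) (act : T -> Y -> Y).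
Hypothesis actP : is_left_action act.

Lemma act1 y : act 1 y = y. Proof. exact: actP.1. Qed.
Lemma actM g h y : act (g * h) y = act g (act h y). Proof. exact: actP.2. Qed.
Lemma actK g y : act g^-1 (act g y) = y.
Proof. by rewrite -actM mulVg act1. Qed.
Lemma actVK g y : act g (act g^-1 y) = y.
Proof. by rewrite -actM mulgV act1. Qed.
Lemma act_inj g : injective (act g).
Proof. exact: can_inj (actK g). Qed.

Lemma mem_act_image g (A : set Y) y : (act g @` A) y <-> A (act g^-1 y).
Proof.
split=> [[z Az <-]|h]; first by rewrite actK.
by exists (act g^-1 y) => //; rewrite actVK.
Qed.

Lemma commensuratedP (A : set Y) : commensurated act A <->
  forall g, finite_set [set y | A y /\ ~ A (act g y)].
Proof.
split=> [cA g|h g].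
  apply: sub_finite_set (cA g^-1) => y [Ay nA]; right; split=> //.
  by move/mem_act_image; rewrite invgK.
have -> : (act g @` A) `+` A =
   (act g @` [set y | A y /\ ~ A (act g y)]) `|` [set y | A y /\ ~ A (act g^-1 y)].
  apply/seteqP; split=> y.
    move=> [[[z Az <-] nA]|[Ay nA]]; [left; exists z => //|right; split=> //].
    by move=> Az; apply: nA; apply/mem_act_image.
  move=> [[z [Az nA] <-]|[Ay nA]]; [left; split=> //; by exists z|right].
  by split=> // /mem_act_image.
by rewrite finite_setU; split=> //; apply: finite_image.
Qed.

(** Under a product, a point of [A] that ends outside either leaves [A] at the first factor or is
    carried to a point leaving at the second; both kinds are finite in number. *)
Lemma commensurated_generated (A : set Y) (S : set T) :
  (forall s, S s -> finite_set [set y | A y /\ ~ A (act s y)] /\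
     finite_set [set y | A y /\ ~ A (act s^-1 y)]) ->
  forall g, generated S g -> finite_set [set y | A y /\ ~ A (act g y)].
Proof.
move=> hS g gg.
have := gg (fun g => finite_set [set y | A y /\ ~ A (act g y)] /\
     finite_set [set y | A y /\ ~ A (act g^-1 y)]).
suff h : forall g h, finite_set [set y | A y /\ ~ A (act g y)] ->
    finite_set [set y | A y /\ ~ A (act h y)] ->
    finite_set [set y | A y /\ ~ A (act (g * h) y)].
  case=> //; split=> //; split.
  - rewrite invg1; suff h1 : finite_set [set y | A y /\ ~ A (act 1 y)] by [].
    by apply: sub_finite_set (finite_set0 Y) => y; rewrite /= act1 => -[].
  - by move=> x y [a b] [c d]; split; rewrite ?invgM; apply: h.
  - by move=> x [a b]; rewrite invgK.
move=> {hS gg}x y fx fy.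
have fz : finite_set [set z | A (act y z) /\ ~ A (act x (act y z))].
  by apply: (finite_set_inj fx (f := act y)) => [z|z z' _ _ /act_inj].
have : finite_set ([set z | A z /\ ~ A (act y z)] `|`
   [set z | A (act y z) /\ ~ A (act x (act y z))]) by rewrite finite_setU.
apply: sub_finite_set => z [Az]; rewrite actM => nA.
by case: (pselect (A (act y z))) => ?; [right|left].
Qed.

End Commensurated.

(** * A criterion on cosets for the failure of Property FW *)

Section CosetCriterion.
Variable T : groupType.
Variables (H A S : set T).
Hypotheses (sH : subgroup H) (AH : forall a h, A a -> H h -> A (a * h)).
Hypothesis genS : generated S = [set: T].
Hypothesis edges : forall s, S s \/ S s^-1 -> exists l : seq T,
  forall a, A a -> ~ A (s * a) -> exists2 t, t \in l & H (t^-1 * a).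
Hypothesis Ainf : forall l : seq T, exists2 a, A a & forall t, t \in l -> ~ H (t^-1 * a).
Hypothesis Acoinf : forall l : seq T,
  exists2 a, ~ A a & forall t, t \in l -> ~ H (t^-1 * a).

(** The group acts by translation on all its subsets, and the left coset of [a] is the point
    [tr a H]; this replaces a quotient type. *)
Let tr (g : T) (B : set T) : set T := [set x | B (g^-1 * x)].

Let tr_action : is_left_action tr.
Proof.
split=> [B|g h B]; rewrite /tr.
  by apply/seteqP; split=> x /=; rewrite invg1 mul1g.
by apply/seteqP; split=> x /=; rewrite invgM mulgA.
Qed.

Let tr_eq a b : tr a H = tr b H <-> H (b^-1 * a).
Proof.
split=> [e|Hab].
  have : tr a H a by rewrite /tr /= mulVg; exact: subgroup1.
  by rewrite e.
apply/seteqP; split=> x; rewrite /tr /= => h.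
  have -> : b^-1 * x = (b^-1 * a) * (a^-1 * x) by rewrite mulgA mulgK.
  exact: subgroupM.
have -> : a^-1 * x = (b^-1 * a)^-1 * (b^-1 * x) by rewrite invgM invgK mulgA mulgK.
by apply: subgroupM => //; apply: subgroupV.
Qed.

Let AA : set (set T) := [set B | exists2 a, A a & B = tr a H].

Let AA_tr a : AA (tr a H) <-> A a.
Proof.
split=> [[b Ab /tr_eq h]|Aa]; last by exists a.
by rewrite -(mulVKg b a); apply: AH.
Qed.

(** The cosets form one orbit, so an invariant set contains all of them or none; by [Acoinf] and
    [Ainf] it then differs from [AA] in infinitely many cosets. *)
Lemma not_FW_of_cosets : ~ property_FW T.
Proof.
move=> /(_ _ tr tr_action AA).
have trM g a : tr g (tr a H) = tr (g * a) H by rewrite (actM tr_action).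
have edge s : S s \/ S s^-1 -> finite_set [set y | AA y /\ ~ AA (tr s y)].
  move=> /edges [l lP].
  apply: sub_finite_set (finite_image (fun t => tr t H) (finite_seq l)).
  move=> _ [[a Aa ->]]; rewrite trM AA_tr => nA.
  by have [t tl ht] := lP _ Aa nA; exists t => //; apply/esym/tr_eq.
case.
  apply/(commensuratedP tr_action) => g.
  apply: (@commensurated_generated _ _ _ tr_action _ S); last by rewrite genS.
  by move=> s Ss; split; apply: edge; [left|right; rewrite invgK].
move=> B [Binv]; rewrite finite_setU => -[f1 f2].
have Btr g C : B (tr g C) <-> B C.
  rewrite -{1}(Binv g) mem_act_image // -[tr g^-1 _](actM tr_action).
  by rewrite mulVg (act1 tr_action).
have fin (F : set (set T)) : finite_set F ->
    exists l : seq T, forall a, F (tr a H) -> exists2 t, t \in l & H (t^-1 * a).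
  move=> /(@finite_set_seq {classic set T})[l lP].
  exists [seq xget 1 [set t : T | tr t H = C] | C : {classic set T} <- l] => a Fa.
  exists (xget 1 [set t : T | tr t H = tr a H]).
    by apply: (@map_f {classic set T}); apply/lP.
  by case: xgetP => [t _ /= /esym/tr_eq //|/(_ a)[]].
case: (pselect (B (tr 1 H))) => B1.
  have [l lP] := fin _ f2; have [a nA na] := Acoinf l.
  case: (lP a) => [|t /na //]; split; last by rewrite AA_tr.
  by rewrite -(mulg1 a) -trM Btr.
have [l lP] := fin _ f1; have [a Aa na] := Ainf l.
case: (lP a) => [|t /na //]; split; first by rewrite AA_tr.
by rewrite -(mulg1 a) -trM Btr.
Qed.

End CosetCriterion.

(** * Sections, nucleus and word length *)

Section TreeAction.
Variables (X : finType) (G : groupClosed (tree_aut X)).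
Local Notation T := (group_of G).
Implicit Types (g h k s : T) (u v w : seq X).

Lemma group_of_actM g h v : (g * h) v = g (h v). Proof. by []. Qed.

Lemma group_of_valM g h : aut_of (g * h) = aut_of g * aut_of h.
Proof. by []. Qed.

Lemma group_of_actK g v : g^-1 (g v) = v.
Proof. by rewrite -group_of_actM mulVg. Qed.

Lemma group_of_actVK g v : g (g^-1 v) = v.
Proof. by rewrite -group_of_actM mulgV. Qed.

Lemma group_of_ext g h : (forall v, g v = h v) -> g = h.
Proof. by move=> e; apply: val_inj; apply: tree_aut_eq. Qed.

Lemma size_act g v : size (g v) = size v.
Proof. exact: tree_aut_size (tree_autP _). Qed.

Lemma group_of_act_inj g : injective (g : seq X -> seq X).
Proof. exact: can_inj (group_of_actK g). Qed.

Lemma prefix_act g v w : prefix (g v) (g w) = prefix v w.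
Proof.
have h k a b : prefix a b -> prefix (k a) (k b).
  by move=> /prefixP[c ->]; rewrite (sectionE (aut_of k)); apply: prefix_prefix.
by apply/idP/idP; [move=> /(h g^-1); rewrite !group_of_actK|apply: h].
Qed.

Hypothesis Gself : self_similar G.

Fact section_in_group (g : T) v : {h : T | aut_of h = section g v}.
Proof. by exists (GroupOf (Gself v (aut_ofP g))). Qed.

Definition sec (g : T) (v : seq X) : T := sval (section_in_group g v).

Lemma val_sec g v : aut_of (sec g v) = section g v.
Proof. exact: svalP (section_in_group g v). Qed.

Lemma act_cat g v w : g (v ++ w) = g v ++ sec g v w.
Proof. by rewrite val_sec; apply: sectionE. Qed.

Lemma secP g v h : (forall w, g (v ++ w) = g v ++ h w) -> sec g v = h.
Proof.
move=> e; apply: group_of_ext => w; have := act_cat g v w.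
by rewrite e => /eqP; rewrite eqseq_cat // eqxx => /eqP.
Qed.

Lemma secM g h v : sec (g * h) v = sec g (h v) * sec h v.
Proof.
by apply: secP => w; rewrite !group_of_actM !act_cat.
Qed.

Lemma sec1 v : sec 1 v = 1. Proof. exact: secP. Qed.

Lemma sec_nil g : sec g [::] = g.
Proof.
apply: secP => w /=; suff -> : g [::] = [::] by [].
by apply/nilP; rewrite /nilp size_act.
Qed.

Lemma sec_cat g v w : sec g (v ++ w) = sec (sec g v) w.
Proof. by apply: secP => x; rewrite -catA !act_cat catA. Qed.

Lemma secV g v : sec g^-1 v = (sec g (g^-1 v))^-1.
Proof.
apply: (mulgI (sec g (g^-1 v))); rewrite mulgV -secM mulgV; exact: sec1.
Qed.

Lemma secVact g v : sec g^-1 (g v) = (sec g v)^-1.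
Proof. by rewrite secV group_of_actK. Qed.

(* The left action of the group on [X^n * G], the level-n tiles. *)
Definition tact (g : T) (t : seq X * T) : seq X * T :=
  (g t.1, sec g t.1 * t.2).

Lemma tact1 t : tact 1 t = t.
Proof. by case: t => u h; rewrite /tact sec1 mul1g. Qed.

Lemma tactM g h t : tact (g * h) t = tact g (tact h t).
Proof. by rewrite /tact /= secM mulgA. Qed.

Lemma tactK g t : tact g^-1 (tact g t) = t.
Proof. by rewrite -tactM mulVg tact1. Qed.

End TreeAction.

Arguments sec : simpl never.

(** * The nucleus and the length it defines *)

Section Nucleus.
Variables (X : finType) (G : groupClosed (tree_aut X)).
Local Notation T := (group_of G).
Implicit Types (g h k s : T) (u v w : seq X).
Hypotheses (Gself : self_similar G) (Gcontr : contracting G).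
Variable x0 : X.
Local Notation sec := (sec Gself).
Local Notation tact := (tact Gself).

Definition nuc (s : T) : Prop := nucleus G (aut_of s).

(** The sections of one element met at arbitrarily deep levels: an explicit description of the
    nucleus, from which closure under inverses and sections can be read off. *)
Let recurrent (s : tree_aut X) := exists2 g : tree_aut X, g \in G &
  forall m, exists2 v, (m <= size v)%N & section g v = s.

Let recurrent_absorbing : absorbing G recurrent.
Proof.
have [N [fN NG Nabs]] := Gcontr.
split.
- apply: sub_finite_set fN => s [g gG gs]; have [m mN] := Nabs g gG.
  by have [v /mN vN <-] := gs m.
- move=> s [g gG gs]; have [v _ <-] := gs 0; exact: Gself.
- move=> g gG; have [m mN] := Nabs g gG.
  have [l lP] := finite_set_seq fN.
  (* Each nonrecurrent element of the finite set [N] stops occurring as a section of [g] below some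
     level; [M] serves for all of them. *)
  have : exists M : nat, forall s : tree_aut X, s \in l -> ~ recurrent s ->
      forall v, (M <= size v)%N -> section g v <> s.
    elim: l {lP} => [|s l [M IH]]; first by exists 0.
    case: (pselect (recurrent s)) => hs.
      by exists M => s'; rewrite inE => /orP[/eqP -> //|]; apply: IH.
    have : exists M', forall v, (M' <= size v)%N -> section g v <> s.
      apply: contrapT => /forallNP h; apply: hs; exists g => // i.
      by have /existsNP[v /not_implyP[mv /contrapT e]] := h i; exists v.
    move=> [M' hM']; exists (maxn M M') => s'.
    rewrite inE => /orP[/eqP -> _|/IH h /h hv] v; rewrite geq_max => /andP[a b].
      exact: hM'.
    exact: hv.
  move=> [M hM]; exists (maxn m M) => v; rewrite geq_max => /andP[mv Mv].
  apply: contrapT => nr; apply: (hM (section g v)) => //; last exact: Mv.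
  by apply/lP; apply: mN.
Qed.

Lemma nucleus_recurrent (s : tree_aut X) : nucleus G s <-> recurrent s.
Proof.
split=> [|[g gG gs] B [[_ _ Babs] _]].
  by move=> h; apply: h; split; [exact: recurrent_absorbing|].
by have [m mB] := Babs g gG; have [v mv <-] := gs m; apply: mB.
Qed.

Lemma nucP s : nuc s <-> exists g, forall m, exists2 v, (m <= size v)%N & sec g v = s.
Proof.
rewrite /nuc nucleus_recurrent; split=> [[g gG gs]|[g gs]].
  exists (GroupOf gG) => m; have [v mv e] := gs m; exists v => //.
  by apply: val_inj; rewrite /= val_sec.
exists (aut_of g); first exact: aut_ofP.
by move=> m; have [v mv <-] := gs m; exists v; rewrite ?val_sec.
Qed.

Lemma nuc_fin : finite_set nuc.
Proof.
have [f _ _] := recurrent_absorbing.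
apply: (finite_set_inj f (f := @aut_of X G)) => [s ns|s t _ _]; first exact: (nucleus_recurrent _).1.
exact: val_inj.
Qed.

Lemma nuc_abs g : exists m, forall v, (m <= size v)%N -> nuc (sec g v).
Proof.
have [_ _ h] := recurrent_absorbing; have [m mP] := h _ (aut_ofP g).
by exists m => v /mP r; apply: (nucleus_recurrent _).2; rewrite val_sec.
Qed.

Lemma nucleus_group (s : tree_aut X) : nucleus G s -> s \in G.
Proof. by move=> h; have [_ r _] := recurrent_absorbing; apply: r; apply: (nucleus_recurrent _).1. Qed.

Lemma nuc1 : nuc 1.
Proof.
apply/nucP; exists 1 => m; exists (nseq m x0); first by rewrite size_nseq.
exact: sec1.
Qed.

Lemma nucV s : nuc s -> nuc s^-1.
Proof.
move=> /nucP[g gs]; apply/nucP; exists g^-1 => m; have [v mv <-] := gs m.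
by exists (g v); rewrite ?size_act // secVact.
Qed.

Lemma nuc_sec s v : nuc s -> nuc (sec s v).
Proof.
move=> /nucP[g gs]; apply/nucP; exists g => m; have [u mu <-] := gs m.
by exists (u ++ v); rewrite ?sec_cat // size_cat (leq_trans mu) // leq_addr.
Qed.

(** At an occurrence of [s] deep enough, the section one letter earlier is already nuclear. This is
    what extends an adjacency of tiles to the left, in [adjacent_tiles]. *)
Lemma nuc_pred s : nuc s -> exists s' x, nuc s' /\ sec s' [:: x] = s.
Proof.
move=> /nucP[g gs]; have [m mP] := nuc_abs g; have [v] := gs m.+1.
case/lastP: v => // v x; rewrite size_rcons ltnS => /mP h e.
by exists (sec g v), x; split=> //; rewrite -e -cats1 sec_cat.
Qed.

(** The ball of radius [i] of the word metric of the nucleus; since 1 is nuclear, products of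
    exactly [i] factors include all shorter ones. *)
Fixpoint pw (i : nat) (g : T) : Prop :=
  if i is j.+1 then exists s h, [/\ nuc s, pw j h & g = s * h] else g = 1.

Lemma pw_nuc s : nuc s -> pw 1 s.
Proof. by move=> ns; exists s, 1; split=> //; rewrite mulg1. Qed.

Lemma pw1 i : pw i 1.
Proof.
elim: i => // i IH; exists 1, 1; split=> //; last by rewrite mul1g.
exact: nuc1.
Qed.

Lemma pwM i j g h : pw i g -> pw j h -> pw (i + j) (g * h).
Proof.
elim: i g => [|i IH] g; first by move=> /= -> ; rewrite mul1g.
by move=> [s [k [ns pk ->]]] pj; exists s, (k * h); split=> //;
  [exact: IH|rewrite mulgA].
Qed.

Lemma pw_le i j g : (i <= j)%N -> pw i g -> pw j g.
Proof. by move=> /subnKC <- pg; rewrite -(mulg1 g); apply: pwM => //; exact: pw1. Qed.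

Lemma pwV i g : pw i g -> pw i g^-1.
Proof.
elim: i g => [|i IH] g; first by move=> /= ->; rewrite invg1.
move=> [s [k [ns pk ->]]]; rewrite invgM -addn1; apply: pwM; first exact: IH.
by apply: pw_nuc; apply: nucV.
Qed.

Lemma pw_sec i g v : pw i g -> pw i (sec g v).
Proof.
elim: i g v => [|i IH] g v; first by move=> /= ->; rewrite sec1.
move=> [s [k [ns pk ->]]]; rewrite secM; exists (sec s (k v)), (sec k v).
by split=> //; [apply: nuc_sec|apply: IH].
Qed.

Lemma pw_fin i : finite_set (pw i).
Proof.
elim: i => [|i IH]; first by apply: sub_finite_set (finite_set1 1) => g /= ->.
apply: sub_finite_set (finite_image2 mul nuc_fin IH) => g [s [h [ns ph ->]]].
by exists s => //; exists h.
Qed.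

Lemma abs_seq (F : set T) : finite_set F ->
  exists m, forall g v, F g -> (m <= size v)%N -> nuc (sec g v).
Proof.
move=> /finite_set_seq[l lP].
suff [m mP] : exists m, forall g v, g \in l -> (m <= size v)%N -> nuc (sec g v).
  by exists m => g v /lP; apply: mP.
elim: l {lP} => [|g l [m IH]]; first by exists 0.
have [m' mP] := nuc_abs g; exists (maxn m m') => g' v.
rewrite inE geq_max => /orP[/eqP ->|gl] /andP[a b]; first exact: mP.
exact: IH.
Qed.

Lemma pw_abs i : exists m, forall g v, pw i g -> (m <= size v)%N -> nuc (sec g v).
Proof. exact: abs_seq (pw_fin i). Qed.

(** The factors are grouped in pairs, and [m] is a depth at which products of two have nuclear
    sections. The depth [m.+1] is positive because the recursion in [drift_bounded] descends by
    it. *)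
Lemma pw_half : exists2 k, (0 < k)%N &
  forall i g v, pw i.*2 g -> size v = k -> pw i (sec g v).
Proof.
have [m mP] := pw_abs 2; exists m.+1 => // i.
elim: i => [|i IH] g v; first by rewrite double0 => /= -> _; rewrite sec1.
rewrite doubleS -[i.*2.+2]/(2 + i.*2)%N => pg sv.
have : exists a b, [/\ pw 2 a, pw i.*2 b & g = a * b].
  case: pg => s [h [ns [s' [h' [ns' ph' ->]]] ->]].
  exists (s * s'), h'; split=> //; last by rewrite mulgA.
  exact: (pwM (pw_nuc ns) (pw_nuc ns')).
move=> [a [b [pa pb ->]]]; rewrite secM.
exists (sec a (b v)), (sec b v); split=> //; last exact: IH.
by apply: mP => //; rewrite size_act sv.
Qed.

End Nucleus.

(** * Self-replication: transitivity on tiles, generation by the nucleus *)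

Section Replicating.
Variables (X : finType) (G : groupClosed (tree_aut X)).
Local Notation T := (group_of G).
Implicit Types (g h k s : T) (u v w : seq X).
Hypotheses (Gself : self_similar G) (Gcontr : contracting G).
Hypotheses (Grepl : self_replicating G).
Variable x0 : X.
Local Notation sec := (sec Gself).
Local Notation tact := (tact Gself).
Local Notation nuc := (@nuc X G).
Local Notation pw := (@pw X G).

(** By induction on the word: [a] moves the first letter, and [b], fixing that letter, corrects the
    section to the element [g'] found for the remaining letters. *)
Lemma tile_transitive u v h h' : size u = size v ->
  exists g, tact g (u, h) = (v, h').
Proof.
suff H : size u = size v -> exists g, g u = v /\ sec g u = h' * h^-1.
  by move=> /H [g [gu gs]]; exists g; rewrite /tact /= gu gs mulgVK.
move: (h' * h^-1) => k {h h'}.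
elim: u v k => [|x u IH] [|y v] k //=; first by exists k; rewrite sec_nil; split=> //;
  apply/nilP; rewrite /nilp size_act.
move=> [/IH] /(_ k) [g' [gu gs]].
have [a aG ax] := Grepl.1 x y; pose a' : T := GroupOf aG.
have [b [bG bx bs]] := Grepl.2 x _ (aut_ofP ((sec a' [:: x])^-1 * g')).
pose b' : T := GroupOf bG.
have sb : sec b' [:: x] = (sec a' [:: x])^-1 * g' by apply: val_inj; rewrite /= val_sec.
have abx : (a' * b') [:: x] = [:: y] by rewrite group_of_actM (bx : b' _ = _).
have sab : sec (a' * b') [:: x] = g'.
  by rewrite secM (bx : b' _ = _) sb mulVKg.
exists (a' * b'); rewrite -cat1s (act_cat Gself) abx sab gu; split=> //.
by rewrite sec_cat sab gs.
Qed.

Hypothesis Gfg : finitely_generated T.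

(** By self-replication [g] is a section of some [h] at a word of length [m], where all generators
    have nuclear sections; a product of generators equal to [h] turns into a product of nucleus
    elements equal to [g]. *)
Lemma pw_gen g : exists i, pw i g.
Proof.
have [S [fS genS]] := Gfg.
have [m mP] := abs_seq Gself Gcontr fS.
pose v := nseq m x0.
have [h] := tile_transitive 1 g (erefl (size v)).
rewrite /tact /= mulg1 => -[hv <-].
suff H : forall h, forall u, size u = m -> exists i, pw i (sec h u).
  by apply: H; rewrite size_nseq.
move=> {hv}h'; have : generated S h' by rewrite genS.
apply: (@generated_ind _ S (fun h => forall u, size u = m -> exists i, pw i (sec h u))).
  split=> [u _|a b Ha Hb u su|a Ha u su].
  - by exists 0; rewrite sec1.
  - have [i pi] := Ha (b u) (etrans (size_act _ _) su); have [j pj] := Hb u su.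
    by exists (i + j)%N; rewrite secM; apply: pwM.
  - have [i pi] := Ha (a^-1 u) (etrans (size_act _ _) su).
    by exists i; rewrite secV; apply: pwV.
by move=> s Ss u su; exists 1%N; apply: pw_nuc; apply: mP; rewrite ?su.
Qed.

Lemma pw_gen_seq (l : seq T) : exists i, forall g, g \in l -> pw i g.
Proof.
elim: l => [|g l [i IH]]; first by exists 0.
have [j pj] := pw_gen g; exists (maxn i j) => g'.
rewrite inE => /orP[/eqP ->|/IH pg].
  exact: (pw_le Gself Gcontr x0 (leq_maxr i j) pj).
exact: (pw_le Gself Gcontr x0 (leq_maxl i j) pg).
Qed.

(** A uniform length for walking between the pieces of one tile; the trivial section keeps the walk
    ending in that tile and not in a translate. *)
Lemma pw_letters : exists l, forall x y : X, exists2 k, pw l k &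
  tact k ([:: x], 1) = ([:: y], 1).
Proof.
have /choice[f fP] : forall p : X * X, exists g, tact g ([:: p.1], 1) = ([:: p.2], 1).
  by move=> [x y]; apply: tile_transitive.
have [l lP] := pw_gen_seq (map f (enum {: X * X})).
exists l => x y; exists (f (x, y)); last exact: fP.
by apply: lP; apply: map_f; rewrite mem_enum.
Qed.

Lemma nuc_generated : generated nuc = [set: T].
Proof.
apply/seteqP; split=> // g _; have [i] := pw_gen g.
have gN := generated_subgroup nuc.
elim: i g => [|i IH] g; first by move=> /= ->; apply: subgroup1 gN.
move=> [s [h [ns /IH ph ->]]]; apply: (subgroupM gN) => //.
exact: sub_generated.
Qed.

End Replicating.

(** * Limits along an ultrafilter *)

Lemma free_ultrafilter_exists : exists F : set_system nat, UltraFilter F /\ \oo `<=` F.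
Proof. exact: ultraFilterLemma. Qed.

(* Compactness arguments take limits along this nonprincipal ultrafilter. *)
Definition om : set_system nat := projT1 (cid free_ultrafilter_exists).

Instance om_ultra : UltraFilter om.
Proof. by rewrite /om; case: cid => F []. Qed.

Lemma om_imp (P Q : nat -> Prop) : om P -> (forall n, P n -> Q n) -> om Q.
Proof. by move=> oP PQ; apply: filterS oP. Qed.

Lemma om_and (P Q : nat -> Prop) : om P -> om Q -> om (fun n => P n /\ Q n).
Proof. exact: filterI. Qed.

Lemma om_ge N : om (fun n => (N <= n)%N).
Proof.
by rewrite /om; case: cid => F [/= _ h]; apply: h; exists N => // n.
Qed.

Lemma om_ev N (P : nat -> Prop) : (forall n, (N <= n)%N -> P n) -> om P.
Proof. by move=> h; apply: (om_imp (om_ge N)). Qed.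

Lemma om_all (P : nat -> Prop) : (forall n, P n) -> om P.
Proof. by move=> h; apply: (@om_ev 0). Qed.

Lemma om_ex (P : nat -> Prop) : om P -> exists n, P n.
Proof. exact: filter_ex. Qed.

Lemma om_em (P : nat -> Prop) : om P \/ om (fun n => ~ P n).
Proof. exact: in_ultra_setVsetC. Qed.

Lemma om_not (P : nat -> Prop) : ~ om P -> om (fun n => ~ P n).
Proof. by case: (om_em P). Qed.

Lemma om_or (P Q : nat -> Prop) : om (fun n => P n \/ Q n) -> om P \/ om Q.
Proof.
move=> oPQ; case: (om_em P) => [|nP]; first by left.
by right; apply: (om_imp (om_and oPQ nP)) => n [[]].
Qed.

(** The pigeonhole behind every limit: a choice among finitely many values is constant on a large
    set of indices. *)
Lemma om_mem (K : eqType) (f : nat -> K -> Prop) (l : seq K) :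
  om (fun n => exists2 a, a \in l & f n a) -> exists2 a, a \in l & om (fun n => f n a).
Proof.
elim: l => [|a l IH] h; first by have [n []] := om_ex h.
have : om (fun n => f n a \/ exists2 b, b \in l & f n b).
  apply: (om_imp h) => n [b]; rewrite inE => /orP[/eqP ->|bl]; first by left.
  by right; exists b.
case/om_or => [fa|/IH[b bl fb]]; first by exists a; rewrite ?inE ?eqxx.
by exists b; rewrite ?inE ?bl ?orbT.
Qed.

Lemma om_bounded (P : nat -> nat -> Prop) M : (forall i, om (P i)) ->
  om (fun n => forall i, (i < M)%N -> P i n).
Proof.
move=> h; elim: M => [|M IH]; first exact: om_all.
apply: (om_imp (om_and IH (h M))) => n [h1 h2] i.
by rewrite ltnS leq_eqVlt => /orP[/eqP ->|/h1].
Qed.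

(** * Tiles and the topology of the limit space *)

Section Tiles.
Variables (X : finType) (G : groupClosed (tree_aut X)).
Local Notation T := (group_of G).
Implicit Types (g h k s : T) (u v w : seq X).
Hypotheses (Gself : self_similar G) (Gcontr : contracting G).
Variable x0 : X.
Local Notation sec := (sec Gself).
Local Notation tact := (tact Gself).
Local Notation nuc := (@nuc X G).
Local Notation pw := (@pw X G).
Local Notation pt := (pre_limit_space G).
Implicit Types (p q r : pt).

(* [word x n] is the paper's suffix x_n ... x_1. *)
Fixpoint word (x : nat -> X) (n : nat) : seq X :=
  if n is m.+1 then x m :: word x m else [::].

Lemma size_word x n : size (word x n) = n.
Proof. by elim: n => //= n ->. Qed.

Lemma eq_word (x y : nat -> X) n :
  (forall i, (i < n)%N -> x i = y i) -> word x n = word y n.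
Proof.
elim: n => //= n IH h; rewrite h ?IH // => i ni; exact/h/ltnW.
Qed.

Lemma word_inj (x y : nat -> X) n :
  word x n = word y n -> forall i, (i < n)%N -> x i = y i.
Proof.
elim: n => //= n IH [e /IH h] i; rewrite ltnS leq_eqVlt => /orP[/eqP -> //|].
exact: h.
Qed.

Lemma word_add x j n : word x (j + n) = take j (word x (j + n)) ++ word x n.
Proof.
elim: j => [|j IH]; first by rewrite take0.
by rewrite addSn /= -IH.
Qed.

Lemma size_take_word x j n : size (take j (word x (j + n))) = j.
Proof. by rewrite size_take size_word; case: ltnP => // h; apply/eqP; rewrite eqn_leq h leq_addr. Qed.

Definition tile (n : nat) (p : pt) : seq X * T := (word p.1 n, p.2 : T).

Lemma tile_le m n p q : (m <= n)%N -> tile n p = tile n q -> tile m p = tile m q.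
Proof.
move=> mn [/word_inj e e2]; congr pair => //; apply: eq_word => i im.
by apply: e; apply: leq_trans mn.
Qed.

Lemma tact_drop j n p q g : tact g (tile (j + n) p) = tile (j + n) q ->
  tact (sec g (take j (word p.1 (j + n)))) (tile n p) = tile n q.
Proof.
rewrite /tact /tile /=; set w := take j _ => -[].
rewrite [word p.1 _]word_add -/w (word_add q.1) (act_cat Gself) sec_cat => /eqP.
rewrite eqseq_cat ?size_act ?size_take_word // => /andP[_ /eqP ->] ->.
by [].
Qed.

(** Adjacency weakens as the level drops ([tnear_le]) and is equality in the limit space when it
    holds at all levels ([pr_eq]). *)
Definition tnear (n : nat) p q : Prop := exists2 s, nuc s & tact s (tile n p) = tile n q.

Lemma tnear_tile n p q : tile n p = tile n q -> tnear n p q.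
Proof. by move=> e; exists 1; [exact: (nuc1 Gself Gcontr x0)|rewrite tact1]. Qed.

Lemma tnear_refl n p : tnear n p p. Proof. exact: tnear_tile. Qed.

Lemma tnear_sym n p q : tnear n p q -> tnear n q p.
Proof.
move=> [s ns e]; exists s^-1; first exact: (nucV Gself Gcontr).
by rewrite -e tactK.
Qed.

Lemma tnear_le m n p q : (m <= n)%N -> tnear n p q -> tnear m p q.
Proof.
move=> /subnK <- [s ns e]; exists (sec s (take (n - m) (word p.1 (n - m + m)))).
  exact: (nuc_sec Gself Gcontr).
exact: tact_drop.
Qed.

Lemma tnear_eql n p q p' : tile n p = tile n p' -> tnear n p q -> tnear n p' q.
Proof. by move=> e [s ns es]; exists s; rewrite // -e. Qed.

Lemma tnear_eqr n p q q' : tile n q = tile n q' -> tnear n p q -> tnear n p q'.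
Proof. by move=> e [s ns es]; exists s; rewrite // -e. Qed.

(** Passing from level [m] to level [n] replaces [g] by a section at a word of length [m - n],
    nuclear as soon as this is at least [k]. *)
Lemma tnear_pw i : exists k : nat, forall n m p q g, (n + k <= m)%N -> pw i g ->
  tact g (tile m p) = tile m q -> tnear n p q.
Proof.
have [k kP] := pw_abs Gself Gcontr i; exists k => n m p q g nk pg.
have nm : (n <= m)%N := leq_trans (leq_addr _ _) nk.
rewrite -(subnK nm) => /tact_drop e; eexists; last exact: e.
by apply: kP => //; rewrite size_take_word leq_subRL.
Qed.

Lemma tnear_trans_ex : exists k : nat, forall n p q r,
  tnear (n + k) p q -> tnear (n + k) q r -> tnear n p r.
Proof.
have [k kP] := tnear_pw 2; exists k => n p q r [s ns es] [t nt et].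
apply: (kP n (n + k) p r (t * s) (leqnn _)).
  exact: (pwM (pw_nuc nt) (pw_nuc ns)).
by rewrite tactM es et.
Qed.

(** Index 0 holds the last letter, hence the reversal; [x0] fills everything to the left of [u]. *)
Definition mkpt u h : pt := (fun i => nth x0 (rev u) i, h).

Lemma tile_mkpt u h : tile (size u) (mkpt u h) = (u, h).
Proof.
congr pair => /=; elim: u => //= x u IH.
congr cons; first by rewrite nth_rev // subnn.
rewrite -[RHS]IH; apply: eq_word => i iu.
by rewrite rev_cons nth_rcons size_rev iu.
Qed.

Lemma tile_surj n (t : seq X * T) : size t.1 = n -> exists p, tile n p = t.
Proof. by case: t => u h /= <-; exists (mkpt u h); apply: tile_mkpt. Qed.

(** Adjacent tiles share a point of the limit space: iterating [nuc_pred] from [s] gives nucleus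
    elements [S i] and letters prolonging both words to the left, so that adjacency persists at all
    levels. *)
Lemma adjacent_tiles s n p : nuc s -> exists p' q', [/\ tile n p' = tile n p,
  tile n q' = tact s (tile n p) & forall m, tnear m p' q'].
Proof.
move=> ns.
have /choice[F FP] : forall t, exists tx : T * X, nuc t -> nuc tx.1 /\ sec tx.1 [:: tx.2] = t.
  move=> t; case: (pselect (nuc t)) => [/(nuc_pred Gself Gcontr)[s' [x h]]|nt].
    by exists (s', x).
  by exists (t, x0).
pose S i := iter i (fun t => (F t).1) s.
have nS i : nuc (S i) by elim: i => //= i IH; case: (FP _ IH).
have secS i : sec (S i.+1) [:: (F (S i)).2] = S i by case: (FP _ (nS i)).
pose x (i : nat) : X := if (i < n)%N then p.1 i else (F (S (i - n)%N)).2.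
pose y (i : nat) : X := if (i < n)%N then nth x0 (rev (s (word p.1 n))) i
  else head x0 (S (i - n).+1 [:: (F (S (i - n)%N)).2]).
have wx : word x n = word p.1 n by apply: eq_word => i ni; rewrite /x ni.
have wy : word y n = s (word p.1 n).
  rewrite -[RHS](congr1 fst (tile_mkpt _ 1)) /= size_act size_word.
  by apply: eq_word => i ni; rewrite /y ni.
pose p' : pt := (x, p.2); pose q' : pt := (y, sec s (word p.1 n) * (p.2 : T)).
have main i : S i (word x (i + n)) = word y (i + n) /\
    sec (S i) (word x (i + n)) = sec s (word p.1 n).
  elim: i => [|i [IH1 IH2]]; first by rewrite add0n wx wy.
  have xi : x (i + n)%N = (F (S i)).2 by rewrite /x ltnNge leq_addl addnK.
  have yi : [:: y (i + n)%N] = S i.+1 [:: (F (S i)).2].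
    rewrite /y ltnNge leq_addl addnK /=.
    have := size_act (S i.+1) [:: (F (S i)).2].
    by case: (S i.+1 _) => [//|a [|b l]].
  rewrite addSn /= -cat1s -[RHS in _ = RHS /\ _]cat1s -[y _ :: _]cat1s.
  by rewrite (act_cat Gself) xi sec_cat secS IH1 IH2 yi cats0.
exists p', q'; split.
- by rewrite /tile /= wx.
- by rewrite /tile /tact /= wy.
- move=> m; apply: (@tnear_le _ (m + n)); first exact: leq_addr.
  by exists (S m) => //; have [a b] := main m; rewrite /tact /tile /= a b.
Qed.

(** Compactness of the set of points with group coordinate in [F]: the letters and the group
    coordinate stabilize one at a time along [om]. *)
Lemma lim_point (f : nat -> pt) (F : set T) : finite_set F -> om (fun n => F (f n).2) ->
  exists q, F q.2 /\ forall m, om (fun n => tile m (f n) = tile m q).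
Proof.
move=> /finite_set_seq[l lP] fF.
have [h hl hP] : exists2 h : T, h \in l & om (fun n => (f n).2 = h).
  apply: (@om_mem _ (fun n h => (f n).2 = h)); apply: (om_imp fF) => n Fn.
  by exists (f n).2 => //; apply/lP.
have /choice[x xP] : forall i, exists x, om (fun n => (f n).1 i = x).
  move=> i; have [//|x _ xP] := @om_mem _ (fun n x => (f n).1 i = x) (enum X).
    by apply: om_all => n; exists ((f n).1 i) => //; rewrite mem_enum.
  by exists x.
exists (x, h); split; first exact/lP.
move=> m; apply: (om_imp (om_and hP (om_bounded m xP))) => n [e1 e2].
by rewrite /tile /= e1; congr pair; apply: eq_word => i; apply: e2.
Qed.

Lemma tnear_fin n p : finite_set [set h | exists q, tnear n p q /\ (q.2 : T) = h].
Proof.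
apply: sub_finite_set (finite_image (fun s => sec s (word p.1 n) * (p.2 : T)) (nuc_fin Gself Gcontr)).
by move=> h [q [[s ns [_ e]] <-]]; exists s.
Qed.

Lemma lim_near (f : nat -> pt) p : om (fun n => tnear 0 p (f n)) ->
  exists q, forall m, om (fun n => tile m (f n) = tile m q).
Proof.
move=> h; have [|q [_ qP]] := @lim_point f _ (tnear_fin 0 p); last by exists q.
by apply: (om_imp h) => n fn; exists (f n).
Qed.

(** The levels lost by transitivity do not matter when all levels are available. Conversely, nucleus
    elements relating deep tiles have sections at each level [i]; their limits [t i] along [om] are
    compatible and form an asymptotic sequence. *)
Lemma lim_relP p q : limit_rel p q <-> forall n, tnear n p q.
Proof.
have [k kP] := tnear_trans_ex.
split=> [/asboolP|h].
  elim=> {p q} [p q [s [ns es e0]] n|p n|p q _ IH n|p q r _ IH1 _ IH2 n].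
  - have sG : aut_of (GroupOf (nucleus_group Gself Gcontr (ns n))) = s n by [].
    exists (GroupOf (nucleus_group Gself Gcontr (ns n))); first exact: ns.
    rewrite /tact /tile /=.
    suff [e1 e2] : s n (word p.1 n) = word q.1 n /\ section (s n) (word p.1 n) = s 0.
      congr pair => //; apply: val_inj; rewrite -[RHS]e0 -e2.
      by rewrite [LHS]group_of_valM val_sec.
    elim: n {sG} => [|n [IH1 IH2]] /=.
      split; first by apply: size0nil; rewrite tree_aut_size //; apply: tree_autP.
      apply: tree_aut_eq => w; have := sectionE (s 0) [::] w.
      suff -> : s 0 [::] = [::] by [].
      by apply: size0nil; rewrite tree_aut_size //; apply: tree_autP.
    have [ea eb] := es n.
    have e w : s n.+1 ((p.1 n :: word p.1 n) ++ w) =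
        (q.1 n :: word q.1 n) ++ section (s n) (word p.1 n) w.
      have := sectionE (s n.+1) [:: p.1 n] (word p.1 n ++ w).
      by rewrite ea eb (sectionE (s n) (word p.1 n) w) IH1.
    have e' := e [::]; split.
      have := tree_autP (section (s n) (word p.1 n)) => -[_ h0 _].
      by move: e'; rewrite !cats0 h0 cats0.
    apply: tree_aut_eq => w; rewrite -IH2.
    have := sectionE (s n.+1) (p.1 n :: word p.1 n) w.
    rewrite e => /eqP; rewrite eqseq_cat; first by case/andP => _ /eqP <-.
    by rewrite (tree_aut_size _ (tree_autP _)) /= !size_word.
  - exact: tnear_refl.
  - exact: tnear_sym.
  - exact: kP (IH1 _) (IH2 _).
apply/asboolP; apply: rst_step.
have /choice[s sP] : forall n, exists s, nuc s /\ tact s (tile n p) = tile n q.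
  by move=> n; have [s] := h n; exists s.
have [l lP] := finite_set_seq (nuc_fin Gself Gcontr).
pose u i n := take (n - i) (word p.1 n).
have uP i n : (i <= n)%N -> tact (sec (s n) (u i n)) (tile i p) = tile i q.
  move=> le; rewrite /u; have := (sP n).2.
  by move: (n - i)%N (subnK le) => j <-; apply: tact_drop.
have /choice[t tP] : forall i, exists t, nuc t /\ om (fun n => sec (s n) (u i n) = t).
  move=> i; have [|t tl tP] := @om_mem _ (fun n t => sec (s n) (u i n) = t) l.
    apply: om_all => n; exists (sec (s n) (u i n)) => //; apply/lP.
    by apply: (nuc_sec Gself Gcontr); case: (sP n).
  by exists t; split=> //; apply/lP.
have tE i : tact (t i) (tile i p) = tile i q.
  have [n [<- le]] := om_ex (om_and (tP i).2 (om_ge i)).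
  exact: uP.
exists (fun i => aut_of (t i)); split.
- by move=> n; case: (tP n).
- move=> i.
  have [n [[e1 e2] le]] := om_ex (om_and (om_and (tP i).2 (tP i.+1).2) (om_ge i.+1)).
  have [_ [sa sb]] := sP n.
  have e3 : u i n = u i.+1 n ++ [:: p.1 i].
    rewrite /u -{1}(subnSK le) -(subnK le); move: (n - i.+1)%N => j.
    elim: j => [|j IH]; first by rewrite addnK /= take0.
    by move: IH; rewrite !addnK addSn /= => ->.
  split; last first.
    by rewrite -val_sec -e2 -e1 e3 sec_cat.
  have [e4 _] := tE i.+1; move: e4; rewrite /= -[p.1 i :: _]cat1s (act_cat Gself).
  have := size_act (t i.+1) [:: p.1 i]; rewrite /=.
  by case: (t i.+1 [:: p.1 i]) => [//|a [|//]] _ [->].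
- by have [_] := tE 0; rewrite /= sec_nil => <-.
Qed.

End Tiles.

(** * Neighbourhoods in the limit space *)

Section LimitTopology.
Variables (X : finType) (G : groupClosed (tree_aut X)).
Local Notation T := (group_of G).
Hypotheses (Gself : self_similar G) (Gcontr : contracting G).
Variable x0 : X.
Local Notation pt := (pre_limit_space G).
Local Notation tnear := (tnear Gself).
Implicit Types (p q r : pt) (O : set (limit_space G)).

Definition pr (p : pt) : limit_space G := (\pi_({eq_quot (@limit_rel X G)}) p)%qT.

Lemma pr_eq p q : pr p = pr q <-> forall n, tnear n p q.
Proof.
rewrite -(lim_relP Gself Gcontr x0); split=> [/eqmodP //|h]; exact/eqmodP.
Qed.

Lemma pr_surj z : exists p, pr p = z.
Proof. by exists (repr z); rewrite /pr reprK. Qed.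

Lemma tile_open n t : open [set p : pt | tile n p = t].
Proof.
case: t => u h.
have o2 : open [set p : pt | p.2 = h].
  apply: (@open_comp _ _ (fun p : pt => p.2) [set h : discrete_topology T]).
    by move=> p _; exact: cvg_snd.
  exact: discrete_open.
have o1 i x : open [set p : pt | p.1 i = x].
  have : open [set f : left_infinite X | f i = x].
    apply: (@open_comp _ _ (fun f : left_infinite X => f i)
      [set x : discrete_topology X]); last exact: discrete_open.
    by move=> f _; apply: (@proj_continuous nat (fun _ => discrete_topology X) i).
  move=> h1; apply: (@open_comp _ _ (fun p : pt => p.1) _ _ h1).
  by move=> p _; exact: cvg_fst.
elim: n u => [|n IH] [|x u].
- have -> : [set p : pt | tile 0 p = ([::], h)] = [set p : pt | p.2 = h] => //.
  by apply/seteqP; split=> p /= => [[->]|e]; rewrite /tile //= e.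
- rewrite (_ : mkset _ = set0); first exact: open0.
  by apply/seteqP; split=> p.
- rewrite (_ : mkset _ = set0); first exact: open0.
  by apply/seteqP; split=> p.
- rewrite (_ : mkset _ = [set p : pt | p.1 n = x] `&` [set p : pt | tile n p = (u, h)]).
    exact: openI.
  apply/seteqP; split=> p; rewrite /tile /=; first by case=> -> -> ->.
  by case=> -> [-> ->].
Qed.

(** Points sharing ever longer tiles with [p] converge to [p] in the product topology, so they
    cannot all avoid [W]. *)
Lemma open_tile (W : set pt) p : open W -> W p ->
  exists m, forall q, tile m q = tile m p -> W q.
Proof.
move=> oW Wp; apply: contrapT => /forallNP h.
have /choice[f fP] : forall m, exists q, tile m q = tile m p /\ ~ W q.
  by move=> m; have /existsNP[q /not_implyP] := h m; exists q.
have f1 : (fun m => (f m).1) @ \oo --> p.1.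
  apply/pointwise_cvgP => i; apply/discrete_cvg.
  exists i.+1 => // m im; rewrite /=.
  by have [[/word_inj e _] _] := fP m; apply: e.
have f2 : (fun m => (f m).2) @ \oo --> p.2.
  by apply/discrete_cvg; exists 0 => // m _; have [[_ e] _] := fP m.
have : \forall m \near \oo, W (f m).
  have cf : f @ \oo --> p.
    have -> : f = (fun m => ((f m).1, (f m).2)) by apply/funext => m; case: (f m).
    have h12 := cvg_pair f1 f2.
    by move: p h12 {oW Wp h fP f1 f2} => [p1 p2]; apply.
  by apply: cf; apply: open_nbhs_nbhs.
by case=> M _ /(_ M (leqnn M)); case: (fP M).
Qed.

Lemma tnear_pr n : exists k, forall p q q', tnear (n + k) p q -> pr q = pr q' -> tnear n p q'.
Proof.
have [k kP] := tnear_trans_ex Gself Gcontr; exists k => p q q' pq /pr_eq qq'.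
exact: kP pq (qq' _).
Qed.

(** The points having some adjacency neighbourhood inside [O] pull back to a union of tile
    cylinders, hence form an open set. Conversely, counterexamples at every level converge along
    [om] to a point identified with [p]. *)
Lemma nbhs_pr p O : nbhs (pr p) O <-> exists n, forall q, tnear n p q -> O (pr q).
Proof.
have [k kP] := tnear_trans_ex Gself Gcontr.
split; last first.
  move=> [n hn]; rewrite nbhsE.
  exists [set z | exists2 p', pr p' = z & exists n, forall q, tnear n p' q -> O (pr q)].
    split; last by exists p => //; exists n.
    rewrite /open /= /quotient_open.
    have -> : (\pi_({eq_quot (@limit_rel X G)}) @^-1`
         [set z | exists2 p', pr p' = z & exists n, forall q, tnear n p' q -> O (pr q)])%qT
       = \bigcup_(i in [set nt : nat * (seq X * T) | forall q q', tile nt.1 q = nt.2 ->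
             tnear nt.1 q q' -> O (pr q')])
           [set q : pt | tile i.1 q = i.2].
      apply/seteqP; split=> q.
        move=> [p' /pr_eq e [m hm]]; exists ((m + k)%N, tile (m + k) q) => //=.
        move=> r r' er rr'; apply: hm; apply: kP (e _) _.
        exact: tnear_eql rr'.
      move=> [[m t] /= h et]; exists q => //; exists m => r; exact: h.
    by apply: bigcup_open => i _; apply: tile_open.
  move=> _ [p' <- [m]]; apply; exact: tnear_refl.
rewrite nbhsE => -[W [oW Wp] WO].
apply: contrapT => /forallNP h.
have /choice[f fP] : forall n, exists q, tnear n p q /\ ~ W (pr q).
  move=> n; have /existsNP[q /not_implyP[pq nO]] := h n.
  by exists q; split=> // /WO.
have [|q qP] := @lim_near X G Gself Gcontr f p.
  by apply: om_all => n; apply: (tnear_le Gcontr (leq0n n) (fP n).1).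
have pq : pr p = pr q.
  apply/pr_eq => n.
  have [m [e nm]] := om_ex (om_and (qP n) (om_ge n)).
  by apply: tnear_eqr e _; apply: (tnear_le Gcontr nm (fP m).1).
have [m mW] : exists m, forall r, tile m r = tile m q -> W (pr r).
  apply: (@open_tile (pr @^-1` W)); first exact: oW.
  by rewrite /preimage /= -pq.
have [n e] := om_ex (qP m).
by have [_] := fP n; apply; apply: mW.
Qed.

Lemma open_prP O : open O <->
  forall p, O (pr p) -> exists n, forall q, tnear n p q -> O (pr q).
Proof.
split=> [oO p Op|h]; first by apply/nbhs_pr; apply: open_nbhs_nbhs.
by rewrite openE => z; have [p <-] := pr_surj z => /h/nbhs_pr.
Qed.

Lemma not_open_lim O (f : nat -> pt) q : open O ->
  (forall m, om (fun n => tile m (f n) = tile m q)) ->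
  om (fun n => ~ O (pr (f n))) -> ~ O (pr q).
Proof.
move=> /open_prP oO fq fO /oO[m hm].
have [n [e nO]] := om_ex (om_and (fq m) fO); apply: nO; apply: hm.
by apply: tnear_tile.
Qed.

Lemma closed_tiles n (M : set (seq X * T)) : finite_set M ->
  closed [set z | exists2 p, pr p = z & M (tile n p)].
Proof.
move=> fM; rewrite -[X in closed X]setCK closedC; apply/open_prP => p pM.
apply: contrapT => /forallNP h.
have /choice[f fP] : forall j, exists q, [/\ M (tile n q) & tnear j p q].
  move=> j; have [k kP] := tnear_pr j.
  have /existsNP[q /not_implyP[pq /contrapT[q' e Mq]]] := h (j + k)%N.
  by exists q'; split=> //; apply: kP pq _.
have [|q qP] := @lim_near X G Gself Gcontr f p.
  by apply: om_all => j; apply: (tnear_le Gcontr (leq0n j) (fP j).2).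
apply: pM; exists q.
  apply/esym/pr_eq => m; have [j [e mj]] := om_ex (om_and (qP m) (om_ge m)).
  by apply: tnear_eqr e _; apply: (tnear_le Gcontr mj (fP j).2).
by have [j <-] := om_ex (qP n); case: (fP j).
Qed.

End LimitTopology.

(** * Chains of tiles and connectedness *)

Section Linking.
Variables (X : finType) (G : groupClosed (tree_aut X)).
Local Notation T := (group_of G).
Hypotheses (Gself : self_similar G) (Gcontr : contracting G).
Local Notation sec := (sec Gself).
Local Notation tact := (tact Gself).
Local Notation nuc := (@nuc X G).
Local Notation pw := (@pw X G).
Local Notation pt := (pre_limit_space G).
Local Notation tnear := (tnear Gself).
Implicit Types (p q r : pt) (K : pt -> Prop) (m n i j : nat).

(* Reachability in [K] through adjacent tiles of level [m], phrased with
   invariant sets, which is how colorings use it. *)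
Definition linked m K p q : Prop := forall V : pt -> Prop, V p ->
  (forall a b, K a -> K b -> tnear m a b -> V a -> V b) -> V q.

Lemma linked_refl m K p : linked m K p p. Proof. by []. Qed.

Lemma linked_trans m K p q r : linked m K p q -> linked m K q r -> linked m K p r.
Proof. by move=> pq qr V Vp h; exact: (qr V (pq V Vp h) h). Qed.

Lemma linked_step m K p q : K p -> K q -> tnear m p q -> linked m K p q.
Proof. by move=> Kp Kq pq V Vp h; exact: (h p q). Qed.

Lemma linked_sub m K K' p q : (forall a, K a -> K' a) ->
  linked m K p q -> linked m K' p q.
Proof.
by move=> KK' pq V Vp h; apply: (pq V Vp) => a b /KK' Ka /KK' Kb; apply: h.
Qed.

Lemma linked_sym m K p q : linked m K p q -> linked m K q p.
Proof.
move=> pq; apply: (pq (linked m K ^~ p)) => [|a b]; first exact: linked_refl.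
move=> Ka Kb ab ap.
by apply: linked_trans ap; apply: linked_step => //; apply: tnear_sym ab.
Qed.

Lemma linked_le m n K p q : (m <= n)%N -> linked n K p q -> linked m K p q.
Proof.
move=> mn pq V Vp h; apply: (pq V Vp) => a b Ka Kb ab.
by apply: h => //; apply: (tnear_le Gcontr mn).
Qed.

Lemma linked_in m K p q : K p -> linked m K p q -> K q.
Proof. by move=> Kp pq; apply: (pq K). Qed.

Variable x0 : X.
Hypotheses (Grepl : self_replicating G) (Gfg : finitely_generated T).

(* How far a chain refined [j] times, each time by words of length at most
   [l], can drift away from its starting tile. *)
Fixpoint drift l j (d : T) : Prop :=
  if j is i.+1 then exists d' x k, [/\ drift l i d', pw l k & d = sec d' [:: x] * k]
  else d = 1.

Lemma drift_add l j i d : drift l (j + i) d -> exists d' v k,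
  [/\ drift l j d', size v = i, pw (i * l) k & d = sec d' v * k].
Proof.
elim: i d => [|i IH] d.
  rewrite addn0 => h; exists d, [::], 1.
  by rewrite sec_nil mulg1; split=> //; apply: pw1.
rewrite addnS => -[d1 [x [k [/IH [d' [v [c [hd' sv hc ->]]]] hk ->]]]].
exists d', (v ++ c [:: x]), (sec c [:: x] * k); split=> //.
- by rewrite size_cat sv size_act addn1.
- by rewrite mulSn addnC; apply: pwM => //; apply: (pw_sec Gself Gcontr).
- by rewrite secM sec_cat mulgA.
Qed.

(** The value [(k * l).*2] reproduces itself: by [pw_half], [k] refinements halve the length and
    then add at most [k * l]. *)
Lemma drift_bounded l : exists R, forall j d, drift l j d -> pw R d.
Proof.
have [k k0 kP] := pw_half Gself Gcontr.
exists (k * l).*2; elim/ltn_ind => j IH d.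
case: (ltnP j k) => jk.
  move=> /(@drift_add _ 0) [d' [v [c [-> sv hc ->]]]].
  rewrite sec1 mul1g; apply: (pw_le Gself Gcontr x0) hc.
  by rewrite -addnn; apply: leq_trans (leq_addr _ _); rewrite leq_mul2r ltnW ?orbT.
rewrite -(subnK jk) => /drift_add [d' [v [c [hd' sv hc ->]]]].
rewrite -addnn; apply: pwM => //; apply: kP => //.
by apply: IH hd'; rewrite ltn_subrL k0 (leq_trans k0).
Qed.

Lemma drift1 l j : drift l j 1.
Proof.
case: j => // j; elim: j => [|j IH]; exists 1, x0, 1; rewrite sec1 mulg1; split=> //;
exact: (pw1 Gself Gcontr x0).
Qed.

(** By induction on the number of refinements: the level [n.+1] pieces of the two points are joined
    by a walk of nucleus steps from [pw_letters]; each step crosses at a shared point, and between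
    crossings the induction hypothesis applies inside one piece. *)
Lemma linked_drift : exists l, forall j n p q, tile n p = tile n q ->
  linked (n + j) (fun r => exists2 d, drift l j d & tile n r = tact d (tile n p)) p q.
Proof.
have [l lP] := pw_letters Gself Gcontr Grepl x0 Gfg; exists l.
elim=> [|j IH] n p q pq.
  rewrite addn0; apply: linked_step; last exact: (tnear_tile _ Gcontr x0 pq).
    by exists 1; rewrite ?tact1.
  by exists 1; rewrite ?tact1.
set K := (fun r => _).
(* A drift [d] away from the piece at [c], seen one level higher, is the section of [d * c] at a
   letter: a drift with one more refinement. *)
have KP r c d : pw l c -> tile n.+1 r = tact c (tile n.+1 p) -> forall r',
    drift l j d -> tile n.+1 r' = tact d (tile n.+1 r) -> K r'.
  move=> lc er r' hd; rewrite er -tactM => /esym er'.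
  exists (sec (d * c) [:: p.1 n]).
    have sc := size_act c [:: p.1 n].
    have [z ez] : exists z, c [:: p.1 n] = [:: z].
      by case: (c _) sc => [//|z []// _]; exists z.
    exists d, z, (sec c [:: p.1 n]); rewrite secM ez; split=> //.
    exact: (pw_sec Gself Gcontr).
  by have := @tact_drop X G Gself 1 n p r' _ er' => /= <-; rewrite take0.
have main : forall i c, pw i c -> (i <= l)%N -> forall r,
    tile n.+1 r = tact c (tile n.+1 p) -> linked (n + j.+1) K p r.
  elim=> [|i IHi] c.
    move=> /= -> _ r er; rewrite addnS -addSn.
    apply: linked_sub (IH n.+1 p r _); last by rewrite er tact1.
    move=> a [d hd ea]; apply: (KP p 1 d _ _ a hd ea); first exact: (pw1 Gself Gcontr x0).
    by rewrite tact1.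
  move=> [s [c' [ns hc' ->]]] il r er.
  have pwc' : pw l c' by apply: (pw_le Gself Gcontr x0) hc'; apply: ltnW.
  have pwc : pw l (s * c').
    by apply: (pw_le Gself Gcontr x0 il); exists s, c'.
  have [b eb] : exists b, tile n.+1 b = tact c' (tile n.+1 p).
    by apply: (tile_surj x0); rewrite /= size_act /= size_word.
  have [p1 [q1 [ep1 eq1 near1]]] := adjacent_tiles Gself Gcontr x0 n.+1 b ns.
  have eq1' : tile n.+1 q1 = tact (s * c') (tile n.+1 p) by rewrite eq1 eb tactM.
  apply: (@linked_trans _ _ _ p1).
    by apply: (IHi c' hc' (ltnW il)); rewrite ep1.
  apply: (@linked_trans _ _ _ q1).
    apply: linked_step (near1 _).
      apply: (KP p1 c' 1 pwc' _ p1 (drift1 l j)); rewrite ?tact1 //.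
      by rewrite ep1.
    by apply: (KP q1 _ 1 pwc eq1' q1 (drift1 l j)); rewrite tact1.
  rewrite addnS -addSn; apply: linked_sub (IH n.+1 q1 r _); last by rewrite eq1' er.
  by move=> a [d hd ea]; apply: (KP q1 _ d pwc eq1' a hd ea).
have [c lc ec] := lP (p.1 n) (q.1 n).
have ec1 : c [:: p.1 n] = [:: q.1 n] := congr1 fst ec.
have ec2 : sec c [:: p.1 n] = 1 by rewrite -[LHS]mulg1; exact: (congr1 snd ec).
apply: (main l c lc (leqnn l)).
have [pq1 pq2] := pq.
rewrite /tile /tact /= -[p.1 n :: _]cat1s (act_cat Gself) sec_cat ec1 ec2.
by rewrite sec1 mul1g -pq1 -pq2.
Qed.

Lemma linked_tile : exists R, forall n p q, tile n p = tile n q -> forall m,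
  linked m (fun r => exists2 g, pw R g & tile n r = tact g (tile n p)) p q.
Proof.
have [l lP] := linked_drift; have [R RP] := drift_bounded l.
exists R => n p q pq m; case: (leqP m n) => mn.
  apply: linked_step.
  - by exists 1; [apply: pw1|rewrite tact1].
  - by exists 1; [apply: pw1|rewrite tact1].
  - by apply: (tnear_le Gcontr mn); apply: tnear_tile.
rewrite -(subnKC (ltnW mn)); apply: linked_sub (lP _ _ _ _ pq) => a [d /RP hd ea].
by exists d.
Qed.

(** The two tiles are crossed at a shared point, and on either side [linked_tile] stays within
    distance [R]; the radius [R.+1] is absorbed by passing from level [n + k] to level [n]. *)
Lemma linked_ball : exists k, forall n p q, tnear (n + k) p q ->
  forall m, linked m (tnear n p) p q.
Proof.
have [R RP] := linked_tile; have [k kP] := tnear_pw Gself Gcontr R.+1.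
exists k => n p q [s ns es] m.
have [p1 [q1 [ep1 eq1 near1]]] := adjacent_tiles Gself Gcontr x0 (n + k) p ns.
have K1 g r : pw R g -> tile (n + k) r = tact g (tile (n + k) p) -> tnear n p r.
  move=> pg e; apply: (kP n (n + k)%N p r g) => //.
  exact: (pw_le Gself Gcontr x0 (leqnSn R)).
have K2 g r : pw R g -> tile (n + k) r = tact g (tile (n + k) q1) -> tnear n p r.
  move=> pg e; apply: (kP n (n + k)%N p r (g * s)) => //.
    by rewrite -addn1; apply: pwM => //; apply: pw_nuc.
  by rewrite tactM -eq1.
have pw_1 : pw R 1 by exact: pw1.
apply: (@linked_trans _ _ _ p1).
  by apply: linked_sub (RP _ _ _ (esym ep1) m) => a [g pg ea]; apply: K1 ea.
apply: (@linked_trans _ _ _ q1).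
  apply: linked_step (near1 m); first by apply: (K1 1); rewrite ?tact1.
  by apply: (K2 1); rewrite ?tact1.
apply: linked_sub (RP (n + k)%N q1 q _ m); last by rewrite eq1 es.
by move=> a [g pg ea]; apply: K2 ea.
Qed.

(** A combinatorial stand-in for the connected component of [p] in its level-[n] neighbourhood. *)
Definition chain_component n p : set pt := [set q | forall m, linked m (tnear n p) p q].

Lemma chain_component_near n p q : chain_component n p q -> tnear n p q.
Proof. by move=> /(_ 0); apply: linked_in; apply: tnear_refl. Qed.

Lemma chain_component_lim n p (f : nat -> pt) q :
  om (fun i => chain_component n p (f i)) ->
  (forall m, om (fun i => tile m (f i) = tile m q)) -> chain_component n p q.
Proof.
move=> cf fq m; have [i [[ci e1] e2]] := om_ex (om_and (om_and cf (fq m)) (fq n)).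
apply: linked_trans (ci m) _; have ni := chain_component_near ci.
apply: linked_step => //; first by apply: tnear_eqr ni.
exact: tnear_tile.
Qed.

Lemma lim_tnear (f g : nat -> pt) a b : (forall m, om (fun i => tile m (f i) = tile m a)) ->
  (forall m, om (fun i => tile m (g i) = tile m b)) ->
  (forall m, om (fun i => tnear m (f i) (g i))) -> forall m, tnear m a b.
Proof.
move=> fa gb fg m; have [i [[ea eb] e]] := om_ex (om_and (om_and (fa m) (gb m)) (fg m)).
exact: tnear_eql ea (tnear_eqr eb e).
Qed.

(** A proper clopen part [B] would give, at each level [m], adjacent points of [C] inside and
    outside [B]; the limit of these pairs is a single point lying both inside and outside. *)
Lemma chain_component_connected n p : connected [set pr q | q in chain_component n p].
Proof.
set C := chain_component n p.
move=> B [b0 Bb0] [O1 oO1 BO] [F cF BF].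
have [[c1 Cc1 ec1] _] : ([set pr q | q in C] `&` O1) b0 by rewrite -BO.
have Bc1 : B (pr c1) by rewrite ec1.
have CK a : C a -> tnear n p a by exact: chain_component_near.
apply: contrapT => BU.
have [c2 Cc2 nB2] : exists2 c2, C c2 & ~ B (pr c2).
  apply: contrapT => h; apply: BU; apply/seteqP; split=> z; first by rewrite BO => -[].
  by move=> [q Cq <-]; apply: contrapT => nB; apply: h; exists q.
have inB q : C q -> O1 (pr q) -> B (pr q).
  by move=> Cq Oq; rewrite BO; split=> //; exists q.
have inBF q : C q -> F (pr q) -> B (pr q).
  by move=> Cq Oq; rewrite BF; split=> //; exists q.
have BsubF z : B z -> F z by rewrite BF => -[].
have limK f : (forall i, tnear n p (f i)) ->
    exists q, forall m, om (fun i => tile m (f i) = tile m q).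
  move=> h; apply: (@lim_near X G Gself Gcontr f p); apply: om_all => i.
  exact: (tnear_le Gcontr (leq0n n)).
have limE f g a b : (forall m, om (fun i => tile m (f i) = tile m a)) ->
  (forall m, om (fun i => tile m (g i) = tile m b)) ->
  (forall i, tnear i (f i) (g i)) -> pr a = pr b.
  move=> fa gb fg; apply/(pr_eq Gself Gcontr x0); apply: lim_tnear fa gb _ => m.
  by apply: (@om_ev m) => i mi; apply: (tnear_le Gcontr mi).
(* A level-[i] chain from [c1] to [c2] has a link leaving the set of points adjacent to [B] at level
   [m]. As [i] grows, the ends of that link converge to one point of [C], outside [B] yet adjacent
   to it at level [m]. *)
have gap m : exists ab : pt * pt,
    [/\ C ab.1, C ab.2, ~ B (pr ab.1), B (pr ab.2) & tnear m ab.2 ab.1].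
  case: (pselect (exists b, [/\ C b, B (pr b) & tnear m b c2])) => [[b [? ? ?]]|n2].
    by exists (c2, b).
  have /choice[fg fgP] : forall i, exists fg : (pt * pt) * pt,
      [/\ tnear n p fg.1.1, tnear n p fg.1.2, tnear i fg.1.1 fg.1.2 &
       [/\ linked i (tnear n p) p fg.1.1,
         [/\ C fg.2, B (pr fg.2) & tnear m fg.2 fg.1.1] &
         ~ exists b, [/\ C b, B (pr b) & tnear m b fg.1.2]]].
    move=> i; pose V q := linked i (tnear n p) p q /\
       exists b, [/\ C b, B (pr b) & tnear m b q].
    have l12 : linked i (tnear n p) c1 c2.
      exact: linked_trans (linked_sym (Cc1 i)) (Cc2 i).
    have Vc1 : V c1.
      by split=> //; exists c1; split=> //; apply: tnear_refl.
    have nV : ~ V c2 by move=> [_ /n2].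
    apply: contrapT => h; apply: nV; apply: l12 => // a b Ka Kb ab [la [b' b'P]].
    have lb : linked i (tnear n p) p b.
      by apply: linked_trans la _; apply: linked_step.
    split=> //; apply: contrapT => nb; apply: h; exists ((a, b), b').
    by split.
  have [a aP] := limK (fun i => (fg i).1.1) (fun i => let: And4 h _ _ _ := fgP i in h).
  have [b bP] := limK (fun i => (fg i).1.2) (fun i => let: And4 _ h _ _ := fgP i in h).
  have eab : pr a = pr b.
    by apply: limE aP bP _ => i; case: (fgP i).
  have Ka : tnear n p a.
    by have [i e] := om_ex (aP n); apply: tnear_eqr e _; case: (fgP i).
  have Kb : tnear n p b.
    by have [i e] := om_ex (bP n); apply: tnear_eqr e _; case: (fgP i).
  have Ca : C a.
    move=> j; have [i [e ji]] := om_ex (om_and (aP j) (om_ge j)).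
    have [Ki _ _ [li _ _]] := fgP i.
    apply: linked_trans (linked_le ji li) _; apply: linked_step => //.
    exact: tnear_tile.
  have Cb : C b.
    move=> j; apply: linked_trans (Ca j) _; apply: linked_step => //.
    by move: j; apply/(pr_eq Gself Gcontr x0).
  have nBa : ~ B (pr a).
    move=> Ba; have [i e] := om_ex (bP m); have [_ _ _ [_ _ nb]] := fgP i.
    apply: nb; exists b; split=> //; first by rewrite -eab.
    by apply: tnear_tile.
  have [i e] := om_ex (aP m); have [_ _ _ [_ [? ? ?] _]] := fgP i.
  by exists (a, (fg i).2); split=> //; apply: tnear_eqr e _.
have /choice[ab abP] := gap.
have [a aP] := limK (fun i => (ab i).1) (fun i => let: And5 h _ _ _ _ := abP i in CK _ h).
have [b bP] := limK (fun i => (ab i).2) (fun i => let: And5 _ h _ _ _ := abP i in CK _ h).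
have eab : pr b = pr a by apply: limE bP aP _ => i; case: (abP i).
have Ca : C a by apply: chain_component_lim aP; apply: om_all => i; case: (abP i).
have Cb : C b by apply: chain_component_lim bP; apply: om_all => i; case: (abP i).
have nOa : ~ O1 (pr a).
  apply: (not_open_lim Gself Gcontr x0 oO1 aP); apply: om_all => i Oi.
  by have [Ci _ nB _ _] := abP i; apply: nB; apply: inB.
have Fb : F (pr b).
  apply: contrapT; apply: (not_open_lim Gself Gcontr x0 (O := ~` F) _ bP).
    by rewrite openC.
  by apply: om_all => i; apply; apply: BsubF; case: (abP i).
by apply: nOa; rewrite -eab; have := inBF _ Cb Fb; rewrite BO => -[].
Qed.

Lemma connected_nbhs n p : exists U : set (limit_space G),
  [/\ connected U, nbhs (pr p) U & forall z, U z -> exists2 q, pr q = z & tnear n p q].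
Proof.
have [k kP] := linked_ball.
exists [set pr q | q in chain_component n p]; split.
- exact: chain_component_connected.
- apply/(nbhs_pr Gself Gcontr x0); exists (n + k)%N => q pq; exists q => // m.
  exact: kP pq m.
- by move=> z [q Cq <-]; exists q => //; apply: chain_component_near.
Qed.

(** A clopen set is stable under adjacency at level [k], by connectedness of chain components, and
    nucleus steps lead from any tile to any other. *)
Lemma connected_limit_space : connected [set: limit_space G].
Proof.
have [k kP] := linked_ball.
move=> B [z0 Bz0] [O1 oO1 BO] [F cF BF]; rewrite setTI in BO; rewrite setTI in BF.
have step p q : tnear k p q -> B (pr p) -> B (pr q).
  move=> pq Bp; pose U := [set pr q | q in chain_component 0 p].
  have Uq : U (pr q) by exists q => // m; exact: (kP 0 p q pq m).
  suff : B `&` U = U by move=> e; move: Uq; rewrite -e => -[].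
  apply: (@chain_component_connected 0 p).
  - by exists (pr p); split=> //; exists p => // m; apply: linked_refl.
  - by exists O1 => //; rewrite setIC BO.
  - by exists F => //; rewrite setIC BF.
have steps i g p q : pw i g -> tact g (tile k p) = tile k q -> B (pr p) -> B (pr q).
  elim: i g q => [|i IH] g q.
    by move=> /= ->; rewrite tact1 => e; apply: step; apply: tnear_tile.
  move=> [s [h [ns ph ->]]]; rewrite tactM => e Bp.
  have [r er] : exists r, tile k r = tact h (tile k p).
    by apply: (tile_surj x0); rewrite /= size_act size_word.
  apply: (step r); first by exists s => //; rewrite er.
  exact: (IH h).
apply/seteqP; split=> // z _.
have [p ep] := pr_surj z0; have [q <-] := pr_surj z.
have [g eg] := tile_transitive Gself Grepl (p.2 : T) (q.2 : T)
  (etrans (size_word p.1 k) (esym (size_word q.1 k))).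
have [i pg] := pw_gen Gself Gcontr Grepl x0 Gfg g.
by apply: (steps i g p q pg eg); rewrite ep.
Qed.

End Linking.

(** * A local cut point yields a commensurated set *)

Section CutPointColoring.
Variables (X : finType) (G : groupClosed (tree_aut X)).
Local Notation T := (group_of G).
Hypotheses (Gself : self_similar G) (Gcontr : contracting G).
Local Notation sec := (sec Gself).
Local Notation tact := (tact Gself).
Local Notation nuc := (@nuc X G).
Local Notation pw := (@pw X G).
Local Notation pt := (pre_limit_space G).
Local Notation tnear := (tnear Gself).
Implicit Types (p q r : pt) (m n i j : nat).

(** Both sides are open in the whole space but need to be disjoint and covering only on [U] without
    [z], which avoids the subspace topology. *)
Definition cut_by (z : limit_space G) (U O1 O2 : set (limit_space G)) : Prop :=
  [/\ nbhs z U, connected U, open O1, open O2 &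
   [/\ forall x, U x -> x <> z -> O1 x \/ O2 x,
       forall x, U x -> x <> z -> O1 x -> ~ O2 x,
       exists x, [/\ U x, x <> z & O1 x] &
       exists x, [/\ U x, x <> z & O2 x]]].

Lemma cut_by_sym z U O1 O2 : cut_by z U O1 O2 -> cut_by z U O2 O1.
Proof.
move=> [zU cU o1 o2 [cov dis e1 e2]]; split=> //; split=> //.
  by move=> x Ux xz; case: (cov x Ux xz); [right|left].
by move=> x Ux xz h2 h1; apply: dis h1 h2.
Qed.

(** From a separation into two pieces, each disjoint from the closure of the other, the complements
    of the two closures are the open sets. *)
Lemma local_cut_pointP z :
  local_cut_point z <-> exists U O1 O2, cut_by z U O1 O2.
Proof.
split=> [[U [zU cU [a [b [Ua Ub ab]]]]]|].
  have nc : ~ connected (U `\ z).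
    move=> c; apply: ab; apply/seteqP; split=> x /connected_component_sub Ux;
      exact: (connected_component_max _ _ c).
  have [E [En UE [s1 s2]]] := (connectedPn _).1 nc.
  have UE' x : U x -> x <> z -> E false x \/ E true x.
    by move=> Ux xz; have : (U `\ z) x by []; rewrite UE.
  have EU c x : E c x -> U x /\ x <> z.
    by move=> Ex; have : (U `\ z) x by rewrite UE; case: c Ex; [right|left].
  exists U, (~` closure (E true)), (~` closure (E false)); split=> //.
  - by rewrite openC; exact: closed_closure.
  - by rewrite openC; exact: closed_closure.
  - have d1 x : E true x -> ~ closure (E false) x.
      by move=> Ex cx; have : (closure (E false) `&` E true) x by []; rewrite s1.
    have d2 x : E false x -> ~ closure (E true) x.
      by move=> Ex cx; have : (E false `&` closure (E true)) x by []; rewrite s2.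
    split.
    + by move=> x Ux xz; case: (UE' x Ux xz) => [/d2|/d1]; [left|right].
    + move=> x Ux xz h1 h2; case: (UE' x Ux xz) => Ex.
        by apply: h2; apply: subset_closure.
      by apply: h1; apply: subset_closure.
    + by have [x Ex] := En false; have [Ux xz] := EU _ _ Ex; exists x; split=> //; apply: d2.
    + by have [x Ex] := En true; have [Ux xz] := EU _ _ Ex; exists x; split=> //; apply: d1.
move=> [U [O1 [O2 [zU cU o1 o2 [cov dis [a [Ua az O1a]] [b [Ub bz O2b]]]]]]].
exists U; split=> //; exists a, b; split=> // e.
have Ub' : connected_component (U `\ z) a b.
  by rewrite e; apply: connected_component_refl; split.
pose C := connected_component (U `\ z) a.
have CU x : C x -> U x /\ x <> z by move=> /connected_component_sub.
have := @component_connected _ (U `\ z) a (C `&` O1).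
suff h : C `&` O1 = C -> False.
  move=> h'; apply: h; apply: h'.
  - by exists a; split=> //; apply: connected_component_refl; split.
  - by exists O1.
  - exists (~` O2); first by rewrite closedC.
    apply/seteqP; split=> x [Cx h]; split=> //; have [Ux xz] := CU _ Cx.
      exact: dis.
    by case: (cov x Ux xz).
move=> h; have : C b by []; rewrite -h => -[_ O1b].
exact: (dis b).
Qed.

Variable x0 : X.
Hypotheses (Grepl : self_replicating G) (Gfg : finitely_generated T).

Lemma lim_tiles n (M : set (seq X * T)) (f : nat -> pt) : finite_set M ->
  (forall i, M (tile n (f i))) ->
  exists q, M (tile n q) /\ forall m, om (fun i => tile m (f i) = tile m q).
Proof.
move=> fM Mf; have [|q [_ qP]] := @lim_point X G f _ (finite_image snd fM).
  by apply: om_all => i; exists (tile n (f i)).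
by exists q; split=> //; have [i <-] := om_ex (qP n).
Qed.

Lemma finite_tiles i (t : seq X * T) : finite_set [set u | exists2 g, pw i g & u = tact g t].
Proof.
apply: sub_finite_set (finite_image (tact ^~ t) (pw_fin Gself Gcontr i)) => u [g pg ->].
by exists g.
Qed.

Variables (p : pt) (U O1 O2 : set (limit_space G)).
Hypothesis cut : cut_by (pr p) U O1 O2.

Lemma cut_reaches_far i : exists N, forall n, (N <= n)%N -> exists h q,
  [/\ pw i.+1 h, tile n q = tact h (tile n p),
      forall g, pw i g -> tact h (tile n p) <> tact g (tile n p) &
      [/\ O1 (pr q), U (pr q) & pr q <> pr p]].
Proof.
have [zU cU oO1 oO2 [cov dis [a [Ua az O1a]] _]] := cut.
have [pa epa] := pr_surj a.
have [n0 hn0] : exists n0, forall q, tnear n0 p q -> pr q <> a.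
  apply: contrapT => /forallNP h; apply: az; rewrite -epa.
  apply/esym/(pr_eq Gself Gcontr x0) => n.
  have [k kP] := tnear_pr Gself Gcontr x0 n.
  have /existsNP[q /not_implyP[nq /contrapT e]] := h (n + k)%N.
  by apply: kP nq _; rewrite epa.
have [k kP] := tnear_pw Gself Gcontr i.+1.
exists (n0 + k)%N => n nn; apply: contrapT => nofar.
pose S j := [set x | exists2 q, pr q = x & exists2 g, pw j g & tile n q = tact g (tile n p)].
have cS j : closed (S j).
  exact: (closed_tiles Gself Gcontr x0 (finite_tiles j (tile n p))) .
have aS : ~ S i.+1 a.
  move=> [q eq [g pg e]]; apply: (hn0 q) => //; exact: (kP n0 n p q g nn pg (esym e)).
have le_S x : S i x -> S i.+1 x.
  by move=> [q <- [g pg e]]; exists q => //; exists g => //; apply: (pw_le Gself Gcontr x0) pg.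
have S_int x : S i x -> nbhs x (S i.+1).
  move=> [q <- [g pg e]]; apply/(nbhs_pr Gself Gcontr x0); exists n => q' [s ns es].
  exists q' => //; exists (s * g); last by rewrite -es e tactM.
  by exists s, g.
have Sp : S i (pr p) by exists p => //; exists 1; rewrite ?tact1 //; apply: pw1.
have noS x : U x -> x <> pr p -> O1 x -> S i.+1 x -> S i x.
  move=> Ux xz Ox [q eq [g pg e]]; apply: contrapT => nS; apply: nofar.
  exists g, q; split=> //; last by rewrite eq.
  by move=> g' pg' e'; apply: nS; exists q => //; exists g' => //; rewrite e.
have Uz : U (pr p) by exact: nbhs_singleton.
have := cU (U `&` (O1 `&` ~` S i)).
suff h : U `&` (O1 `&` ~` S i) = U -> False.
  move=> h'; apply: h; apply: h'.
  - by exists a; split=> //; split=> // /le_S.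
  - by exists (O1 `&` ~` S i) => //; apply: openI => //; rewrite openC.
  - exists (~` O2 `&` ~` interior (S i.+1)).
      by apply: closedI; rewrite closedC //; apply: open_interior.
    apply/seteqP; split=> x [Ux].
      move=> [O1x nS]; have xz : x <> pr p by move=> e; apply: nS; rewrite e.
      split=> //; split; first exact: dis.
      by move=> /interior_subset /(noS x Ux xz O1x).
    move=> [nO2 nI]; have xz : x <> pr p.
      by move=> e; apply: nI; rewrite e; apply: S_int.
    split=> //; split; first by case: (cov x Ux xz).
    by move=> /S_int.
by move=> h; move: Uz; rewrite -h => -[_ [_]].
Qed.

(** Ever finer chains from [q] to [q'] inside the [R]-neighbourhood of the tile would change color,
    and the limit of the changes would be a point of [U], other than the cut point, in neither [O1]
    nor [O2]. *)
Lemma cut_monochromatic : exists R, forall n q q', tile n q = tile n q' ->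
  (forall r g, pw R g -> tile n r = tact g (tile n q) -> U (pr r) /\ pr r <> pr p) ->
  O1 (pr q) -> O1 (pr q').
Proof.
have [zU cU oO1 oO2 [cov dis _ _]] := cut.
have [R RP] := linked_tile Gself Gcontr x0 Grepl Gfg.
exists R => n q q' e good O1q; apply: contrapT => nO1.
pose M := [set u | exists2 g, pw R g & u = tact g (tile n q)].
have goodM r : M (tile n r) -> U (pr r) /\ pr r <> pr p by move=> [g pg]; apply: good.
have /choice[ab abP] : forall m, exists ab : pt * pt, [/\ M (tile n ab.1), M (tile n ab.2),
    tnear m ab.1 ab.2, O1 (pr ab.1) & ~ O1 (pr ab.2)].
  move=> m; apply: contrapT => h; apply: nO1.
  apply: (RP n q q' e m (fun r => O1 (pr r))) => // a b Ma Mb nab Oa.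
  by apply: contrapT => nb; apply: h; exists (a, b).
have fM : finite_set M by exact: finite_tiles.
have [a [Ma aP]] := lim_tiles (f := fun m => (ab m).1) fM (fun m => let: And5 h _ _ _ _ := abP m in h).
have [b [Mb bP]] := lim_tiles (f := fun m => (ab m).2) fM (fun m => let: And5 _ h _ _ _ := abP m in h).
have eab : pr a = pr b.
  apply/(pr_eq Gself Gcontr x0); apply: (lim_tnear aP bP) => m.
  by apply: (@om_ev m) => i mi; apply: (tnear_le Gcontr mi); case: (abP i).
have nO1b : ~ O1 (pr b).
  apply: (not_open_lim Gself Gcontr x0 oO1 bP); apply: om_all => i.
  by case: (abP i).
have nO2a : ~ O2 (pr a).
  apply: (not_open_lim Gself Gcontr x0 oO2 aP); apply: om_all => i.
  by have [/goodM[? ?] _ _ h _] := abP i; apply: dis.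
by have [Ua az] := goodM a Ma; case: (cov _ Ua az); rewrite // eab.
Qed.

End CutPointColoring.

(** * The ultralimit of the colored tile sets *)

Section CutPointNotFW.
Variables (X : finType) (G : groupClosed (tree_aut X)).
Local Notation T := (group_of G).
Hypotheses (Gself : self_similar G) (Gcontr : contracting G).
Local Notation tact := (tact Gself).
Local Notation nuc := (@nuc X G).
Local Notation pw := (@pw X G).
Local Notation pt := (pre_limit_space G).
Hypotheses (Grepl : self_replicating G) (Gfg : finitely_generated T).

Lemma local_cut_point_not_FW (z : limit_space G) : local_cut_point z -> ~ property_FW T.
Proof.
have [p <-] := pr_surj z; pose x0 : X := p.1 0.
move=> /local_cut_pointP[U [O1 [O2 cut]]].
have [zU cU oO1 oO2 [cov dis _ _]] := cut.
have [R mono] := cut_monochromatic Gself Gcontr x0 Grepl Gfg cut.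
pose W n := tile n p.
(* [H] is the stabilizer of the base point in the ultralimit of the tile sets based at [W n], so the
   left cosets of [H] are the points of its orbit. *)
pose H : set T := [set g | om (fun n => tact g (W n) = W n)].
pose white n (t : seq X * T) := exists q, [/\ tile n q = t, O1 (pr q), U (pr q) & pr q <> pr p].
pose A : set T := [set g | om (fun n => white n (tact g (W n)))].
have sH : subgroup H.
  split.
  - by apply: om_all => n; rewrite tact1.
  - move=> x y Hx Hy; apply: (om_imp (om_and Hx Hy)) => n [ex ey].
    by rewrite tactM ey.
  - move=> x Hx; apply: (om_imp Hx) => n ex.
    by rewrite -{1}ex tactK.
have neqH c g : ~ H (c^-1 * g) -> om (fun n => tact g (W n) <> tact c (W n)).
  move=> /om_not h; apply: (om_imp h) => n ne e; apply: ne.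
  by rewrite tactM e tactK.
(* Were the cut point within distance [R] of a tile, that tile would be at most one further nucleus
   step from the base tile, which avoiding [pw R.+2] excludes. *)
have good i : om (fun n => forall g, pw i g ->
    (forall c, pw R.+2 c -> tact g (W n) <> tact c (W n)) ->
    forall r c, pw R c -> tile n r = tact c (tact g (W n)) -> U (pr r) /\ pr r <> pr p).
  have [n0 Un0] := (nbhs_pr Gself Gcontr x0 p U).1 zU.
  have [k kP] := tnear_pw Gself Gcontr (R + i).
  apply: (@om_ev (n0 + k)) => n nn g pg far r c pc er; split.
    apply: Un0; apply: (kP n0 n p r (c * g) nn); first exact: pwM.
    by rewrite tactM.
  move=> /esym/(pr_eq Gself Gcontr x0)/(_ n)[s ns es].
  apply: (far (c^-1 * s)); last by rewrite tactM es er tactK.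
  rewrite -addn2; apply: pwM; first exact: (pwV Gself Gcontr).
  by apply: (pw_le Gself Gcontr x0 (leqnSn 1)); apply: pw_nuc.
have [lR lRP] := finite_set_seq (pw_fin Gself Gcontr R.+2).
have far_list (l : seq T) g : (forall c, c \in l -> ~ H (c^-1 * g)) ->
    om (fun n => forall c, c \in l -> tact g (W n) <> tact c (W n)).
  elim: l => [|c l IH] h; first by apply: om_all.
  have h1 := neqH c g (h c (mem_head _ _)).
  have h2 := IH (fun c' cl => h c' (@mem_behead _ (c :: l) c' cl)).
  apply: (om_imp (om_and h1 h2)) => n [a b] c'.
  by rewrite inE => /orP[/eqP ->|]; [exact: a|exact: b].
have edge s g : nuc s -> A g -> ~ A (s * g) -> exists2 c, c \in lR & H (c^-1 * g).
  move=> ns Ag nA; apply: contrapT => h; apply: nA.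
  have [i pg] := pw_gen Gself Gcontr Grepl x0 Gfg g.
  have fl : om (fun n => forall c, c \in lR -> tact g (W n) <> tact c (W n)).
    by apply: far_list => c cl Hc; apply: h; exists c.
  apply: (om_imp (om_and (om_and fl (good i)) Ag)) => n [[fn gn] [q [eq O1q Uq qz]]].
  have gq r c : pw R c -> tile n r = tact c (tile n q) -> U (pr r) /\ pr r <> pr p.
    by move=> pc er; apply: (gn g pg _ r c pc); [move=> c' /lRP; apply: fn|rewrite er eq].
  have [q1 [q2 [e1 e2 n12]]] := adjacent_tiles Gself Gcontr x0 n q ns.
  have O1q1 : O1 (pr q1) by apply: (mono n q) gq O1q.
  have [Uq1 q1z] := gq q1 1 (pw1 Gself Gcontr x0 R) (etrans e1 (esym (tact1 _ _))).
  have e12 : pr q1 = pr q2 by apply/(pr_eq Gself Gcontr x0).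
  by exists q2; rewrite -e12; split=> //; rewrite e2 eq tactM.
have farP (O1' O2' : set (limit_space G)) i : cut_by (pr p) U O1' O2' ->
    exists2 h, pw i.+1 h & om (fun n => exists q,
    [/\ tile n q = tact h (W n), forall g, pw i g -> tact h (W n) <> tact g (W n) &
      [/\ O1' (pr q), U (pr q) & pr q <> pr p]]).
  move=> cut'; have [N hN] := cut_reaches_far Gself Gcontr x0 cut' i.
  have [l lP] := finite_set_seq (pw_fin Gself Gcontr i.+1).
  have [|h /lP ph hh] := @om_mem _ (fun n h => exists q,
    [/\ tile n q = tact h (W n), forall g, pw i g -> tact h (W n) <> tact g (W n) &
      [/\ O1' (pr q), U (pr q) & pr q <> pr p]]) l; last by exists h.
  apply: (@om_ev N) => n /hN [h [q [ph e1 e2 e3]]].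
  by exists h; [apply/lP|exists q].
have notH h i c : om (fun n => forall g, pw i g -> tact h (W n) <> tact g (W n)) ->
    pw i c -> ~ H (c^-1 * h).
  move=> far pc Hc; have [n [a b]] := om_ex (om_and far Hc).
  by apply: (a c pc); rewrite -[in RHS]b -tactM mulVKg.
apply: (@not_FW_of_cosets _ H A nuc sH).
- move=> a h Aa Hh; apply: (om_imp (om_and Aa Hh)) => n [wa eh].
  by rewrite tactM eh.
- exact: nuc_generated.
- move=> s hs; exists lR => a Aa nA; apply: (edge s) => //.
  by case: hs => // /(nucV Gself Gcontr); rewrite invgK.
- move=> l; have [i lP] := pw_gen_seq Gself Gcontr Grepl x0 Gfg l.
  have [h ph hh] := farP O1 O2 i cut; exists h.
    by apply: (om_imp hh) => n [q [e1 _ [? ? ?]]]; exists q.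
  move=> t /lP pt; apply: notH pt; apply: (om_imp hh) => n [q [_ + _]]; exact.
- move=> l; have [i lP] := pw_gen_seq Gself Gcontr Grepl x0 Gfg l.
  (* Beyond distance [R.+2] tiles are monochromatic, so one with a point of [O2] is not white;
     beyond [i] it avoids the given cosets. *)
  have [h ph hh] := farP O2 O1 (maxn i R.+2) (cut_by_sym cut); exists h.
    move=> Ah.
    have [n [[[q [e1 far [O2q Uq qz]]] [q' [e1' O1q' Uq' qz']]] gn]] :=
      om_ex (om_and (om_and hh Ah) (good (maxn i R.+2).+1)).
    have gq r g : pw R g -> tile n r = tact g (tile n q') -> U (pr r) /\ pr r <> pr p.
      move=> pg er; apply: (gn h ph _ r g pg); last by rewrite er e1'.
      by move=> c pc; apply: far; apply: (pw_le Gself Gcontr x0 (leq_maxr i R.+2) pc).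
    have e' : tile n q' = tile n q by rewrite e1 e1'.
    exact: (dis (pr q) Uq qz (mono n q' q e' gq O1q') O2q).
  move=> t /lP pt; apply: (notH h (maxn i R.+2)).
    by apply: (om_imp hh) => n [q [_ + _]]; exact.
  exact: (pw_le Gself Gcontr x0 (leq_maxl _ _) pt).
Qed.

End CutPointNotFW.

(** * Tile colorings yield a local cut point *)

Section TileCuts.
Variables (X : finType) (G : groupClosed (tree_aut X)).
Local Notation T := (group_of G).
Hypotheses (Gself : self_similar G) (Gcontr : contracting G).
Local Notation sec := (sec Gself).
Local Notation tact := (tact Gself).
Local Notation nuc := (@nuc X G).
Local Notation pw := (@pw X G).
Local Notation pt := (pre_limit_space G).
Local Notation tnear := (tnear Gself).
Implicit Types (p q r : pt) (m n i j : nat).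

(** The color component of [t0] reaches a group coordinate outside [pw 2]. Since the coordinate of
    [t0] is nuclear, every tile adjacent to it has coordinate in [pw 2]; this radius is what
    [escape_limit] contradicts. *)
Definition escapes n (a : seq X * T -> Prop) (t0 : seq X * T) : Prop :=
  [/\ size t0.1 = n, nuc t0.2, a t0 &
   forall V : seq X * T -> Prop, V t0 ->
     (forall t s, V t -> nuc s -> a (tact s t) -> V (tact s t)) ->
     exists t, V t /\ ~ pw 2 t.2].

(* The bound [c] on the number of exceptional vertices does not depend on [n];
   escaping chains guarantee that both colors survive in the limit. *)
Definition tile_cuts (c : nat) : Prop :=
  forall n, exists (a : seq X * T -> Prop) (U : seq (seq X)) (t0 t1 : seq X * T),
  [/\ (size U <= c)%N,
      forall t s, size t.1 = n -> nuc s -> a t -> ~ a (tact s t) -> t.1 \in U,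
      escapes n a t0 & escapes n (fun t => ~ a t) t1].

(** The set of limit points of the sets [S n] along [om], closed by [tile_limit_nbhs]. *)
Definition tile_limit (S : nat -> pt -> Prop) q : Prop :=
  forall m, om (fun n => exists q', S n q' /\ tnear m q q').

Lemma tile_limit_nbhs S q : ~ tile_limit S q ->
  exists m, forall q', tnear m q q' -> ~ tile_limit S q'.
Proof.
have [k kP] := tnear_trans_ex Gself Gcontr.
move=> /existsNP[m0 h0]; exists (m0 + k)%N => q' qq' Sq'; apply: h0.
apply: (om_imp (Sq' (m0 + k)%N)) => n [q'' [Sq'' e]]; exists q''; split=> //.
exact: kP qq' e.
Qed.

Variable x0 : X.
Hypotheses (Grepl : self_replicating G) (Gfg : finitely_generated T).

Lemma tile_limit_sat S q q' : pr q = pr q' -> tile_limit S q -> tile_limit S q'.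
Proof.
move=> e Sq; apply: contrapT => /tile_limit_nbhs[m hm]; apply: (hm q) => //.
by move: m {hm}; apply/(pr_eq Gself Gcontr x0).
Qed.

Lemma tnear_snd m p q : tnear m p q -> exists2 s : T, nuc s & (q.2 : T) = s * (p.2 : T).
Proof.
move=> [s ns [_ e]]; exists (sec s (word p.1 m)) => //.
exact: (nuc_sec Gself Gcontr).
Qed.

Lemma tnear_pw_snd m p q i : tnear m p q -> pw i p.2 -> pw i.+1 q.2.
Proof. by move=> /tnear_snd[s ns ->] pi; exists s, p.2. Qed.

Variable c : nat.
Hypothesis cuts : tile_cuts c.

Let cut_data : exists aU : nat -> (seq X * T -> Prop) * seq (seq X), forall n,
  [/\ (size (aU n).2 <= c)%N,
      forall t s, size t.1 = n -> nuc s -> (aU n).1 t -> ~ (aU n).1 (tact s t) ->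
         t.1 \in (aU n).2,
      exists t0, escapes n (aU n).1 t0 & exists t1, escapes n (fun t => ~ (aU n).1 t) t1].
Proof.
suff /choice[f fP] : forall n, exists aU : (seq X * T -> Prop) * seq (seq X),
  [/\ (size aU.2 <= c)%N,
      forall t s, size t.1 = n -> nuc s -> aU.1 t -> ~ aU.1 (tact s t) -> t.1 \in aU.2,
      exists t0, escapes n aU.1 t0 & exists t1, escapes n (fun t => ~ aU.1 t) t1].
  by exists f.
move=> n; have [a [U [t0 [t1 [h1 h2 h3 h4]]]]] := cuts n.
by exists (a, U); split=> //; [exists t0|exists t1].
Qed.

Let a n := (projT1 (cid cut_data) n).1.
Let U n := (projT1 (cid cut_data) n).2.

Let sizeU n : (size (U n) <= c)%N.
Proof. by have [] := projT2 (cid cut_data) n. Qed.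

Let cross n t s : size t.1 = n -> nuc s -> a n t -> ~ a n (tact s t) -> t.1 \in U n.
Proof. by have [_ h _ _] := projT2 (cid cut_data) n; apply: h. Qed.

Let black := tile_limit (fun n q => a n (tile n q)).
Let white := tile_limit (fun n q => ~ a n (tile n q)).
Let border := tile_limit (fun n q => word q.1 n \in U n).

Let cover q : ~ black q -> white q.
Proof.
move=> /existsNP[m0 /om_not h] m; apply: (om_imp h) => n hn; exists q.
split; last exact: tnear_refl.
by move=> an; apply: hn; exists q; split=> //; apply: tnear_refl.
Qed.

(** Near such a point a level-[n] chain joins a black tile to a white one, and its color change
    takes place over an exceptional vertex. *)
Let black_white_border q : black q -> white q -> border q.
Proof.
have [k kP] := linked_ball Gself Gcontr x0 Grepl Gfg.
move=> bq wq m.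
apply: (om_imp (om_and (bq (m + k)%N) (wq (m + k)%N))) => n [[q1 [a1 n1]] [q2 [a2 n2]]].
have l12 : linked Gself n (tnear m q) q1 q2.
  exact: linked_trans (linked_sym Gcontr (kP m q q1 n1 n)) (kP m q q2 n2 n).
apply: contrapT => h; apply: a2.
apply: (l12 (fun r => a n (tile n r))) => // r r' Kr Kr' [s ns e] ar.
apply: contrapT => nar'; apply: h; exists r; split=> //.
by apply: (@cross n (tile n r) s); rewrite ?e //= size_word.
Qed.

(** Border points with coordinate in [F] are approached by tiles over exceptional vertices with
    coordinate in [lF], at most [c * size lF] at every level. Finitely many distinct points need
    distinct tiles at deep levels, so the same number bounds the points, and one level [m] separates
    them all. *)
Let border_discrete (F : set T) : finite_set F -> exists m, forall q q',
  border q -> border q' -> F q.2 -> F q'.2 -> tnear m q q' -> pr q = pr q'.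
Proof.
move=> fF.
have [k kP] := tnear_trans_ex Gself Gcontr.
have fF' : finite_set [set h : T | exists2 s : T, nuc s & exists2 h', F h' & h = s * h'].
  apply: sub_finite_set (finite_image2 mul (nuc_fin Gself Gcontr) fF).
  by move=> h [s ns [h' Fh' ->]]; exists s => //; exists h'.
have [lF lFP] := finite_set_seq fF'.
pose Z : Type := {classic limit_space G}.
pose good (z : limit_space G) := exists q, [/\ pr q = z, border q & F q.2].
have /choice[rho rhoP] : forall z, exists q, good z -> [/\ pr q = z, border q & F q.2].
  move=> z; case: (pselect (good z)) => [[q hq]|n]; first by exists q.
  by have [q _] := pr_surj z; exists q.
have sep (L : seq {classic limit_space G}) : exists m, forall z z', z \in L -> z' \in L ->
    tnear m (rho z) (rho z') -> pr (rho z) = pr (rho z').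
  have one z (L' : seq {classic limit_space G}) : exists m, forall z', z' \in L' ->
      tnear m (rho z) (rho z') -> pr (rho z) = pr (rho z').
    elim: L' => [|z1 L' [m IH]]; first by exists 0.
    have [m1 h1] : exists m1, tnear m1 (rho z) (rho z1) -> pr (rho z) = pr (rho z1).
      apply: contrapT => /forallNP h; have h' i : tnear i (rho z) (rho z1).
        by apply: contrapT => ni; apply: (h i) => /ni.
      by apply: (h 0) => _; apply/(pr_eq Gself Gcontr x0).
    exists (maxn m m1) => z'; rewrite inE => /orP[/eqP ->|zL'] nz.
      by apply/h1/(tnear_le Gcontr (leq_maxr m m1)).
    by apply: IH => //; apply: (tnear_le Gcontr (leq_maxl m m1)).
  suff : forall L' : seq {classic limit_space G}, exists m, forall z z', z \in L' ->
      z' \in L -> tnear m (rho z) (rho z') -> pr (rho z) = pr (rho z') by [].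
  elim=> [|z1 L' [m IH]]; first by exists 0.
  have [m1 h1] := one z1 L.
  exists (maxn m m1) => z z'; rewrite inE => /orP[/eqP ->|zL'] zL nz.
    by apply: h1 => //; apply/(tnear_le Gcontr (leq_maxr m m1)).
  by apply: IH => //; apply: (tnear_le Gcontr (leq_maxl m m1)).
have bound (L : seq {classic limit_space G}) : uniq L -> (forall z, z \in L -> good z) ->
    (size L <= c * size lF)%N.
  move=> uL gL; have [m sepm] := sep L.
  have : om (fun n => forall z, z \in L -> exists q', word q'.1 n \in U n /\
      tnear (m + k) (rho z) q').
    elim: L gL {uL sepm} => [|z L IH] gL; first exact: om_all.
    have [_ bz _] := rhoP z (gL z (mem_head _ _)).
    have h := IH (fun z' zL => gL z' (@mem_behead _ (z :: L) z' zL)).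
    apply: (om_imp (om_and (bz (m + k)%N) h)) => n [h1 h2] z'.
    by rewrite inE => /orP[/eqP ->|/h2].
  move=> hom; have [n [hn mn]] := om_ex (om_and hom (om_ge (m + k)%N)).
  have /choice[f fP] : forall z, exists q', z \in L -> word q'.1 n \in U n /\
      tnear (m + k) (rho z) q'.
    move=> z; case: (boolP (z \in L)) => [zL|_].
      by have [q' h] := hn z zL; exists q'.
    by have [q' _] := pr_surj z; exists q'.
  have u : uniq [seq tile n (f z) | z <- L].
    rewrite map_inj_in_uniq // => z z' zL z'L e.
    have [_ n1] := fP z zL; have [_ n2] := fP z' z'L.
    have [<- _ _] := rhoP z (gL z zL); have [<- _ _] := rhoP z' (gL z' z'L).
    apply: sepm => //; apply: (kP m _ (f z') _).
      exact: tnear_eqr (tile_le mn e) n1.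
    exact: (tnear_sym Gcontr n2).
  have sub : {subset [seq tile n (f z) | z <- L] <= [seq (u, h) | u <- U n, h <- lF]}.
    move=> _ /mapP[z zL ->]; have [h1 /tnear_snd[s ns e]] := fP z zL.
    apply/allpairsP; exists (word (f z).1 n, (f z).2 : T); split=> //=.
    apply/lFP; exists s => //; exists ((rho z).2 : T) => //.
    by case: (rhoP z (gL z zL)).
  have := uniq_leq_size u sub; rewrite size_map size_allpairs => h.
  by apply: leq_trans h _; rewrite leq_mul2r sizeU orbT.
have [L [uL gL maxL]] : exists L : seq {classic limit_space G},
    [/\ uniq L, forall z, z \in L -> good z & forall z, good z -> z \in L].
  have : exists L : seq {classic limit_space G}, uniq L /\ (forall z, z \in L -> good z).
    by exists [::].
  move=> [L]; have [N] := ubnP (c * size lF - size L); elim: N L => // N IH L.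
  rewrite ltnS => hN [uL gL].
  case: (pselect (forall z, good z -> z \in L)) => [h|]; first by exists L.
  move=> /existsNP[z /not_implyP[gz /negP zL]].
  pose zL' : seq {classic limit_space G} := (z : {classic limit_space G}) :: L.
  have uzL : uniq zL' by apply/andP; split; [exact: zL|exact: uL].
  have gzL (z' : {classic limit_space G}) : z' \in zL' -> good z'.
    by rewrite inE => /orP[/eqP ->|h]; [|exact: gL].
  apply: (IH zL') => //; apply: leq_trans hN.
  by have := bound _ uzL gzL; rewrite /= => h; rewrite subnS prednK // subn_gt0.
have [m sepm] := sep L.
exists (m + k + k)%N => q q' bq bq' Fq Fq' nqq'.
have Lq : (pr q : {classic limit_space G}) \in L by apply: maxL; exists q.
have Lq' : (pr q' : {classic limit_space G}) \in L by apply: maxL; exists q'.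
have [e _ _] := rhoP _ (gL _ Lq); have [e' _ _] := rhoP _ (gL _ Lq').
rewrite -e -e'; apply: sepm => //.
have n1 : tnear (m + k + k) (rho (pr q)) q by move: (m + k + k)%N; apply/(pr_eq Gself Gcontr x0).
have n2 : tnear (m + k) q' (rho (pr q')) by move: (m + k)%N; apply/(pr_eq Gself Gcontr x0).
exact: kP (kP _ _ _ _ n1 nqq') n2.
Qed.

(** If the color accumulated only at border points, each of its tiles with coordinate in [pw 3]
    would be close to a border point with coordinate in [pw 4]. Adjacent tiles would be close to the
    same one, so a component starting at a nuclear coordinate would stay near its origin, inside
    [pw 2]. *)
Let escape_limit (b : nat -> seq X * T -> Prop) :
  (forall n, exists t0, escapes n (b n) t0) ->
  ~ (forall q, tile_limit (fun n q => b n (tile n q)) q -> border q).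
Proof.
move=> esc sub.
have [m0 disc] := border_discrete (pw_fin Gself Gcontr 4).
have [k kP] := tnear_trans_ex Gself Gcontr.
pose m := (m0 + k + k + k)%N.
have : om (fun n => forall q', b n (tile n q') -> pw 3 q'.2 ->
    exists2 q, border q & tnear m q q').
  case: (om_em (fun n => forall q', b n (tile n q') -> pw 3 q'.2 ->
    exists2 q, border q & tnear m q q')) => // h.
  have /choice[f fP] : forall n, exists q', ~ (forall q', b n (tile n q') -> pw 3 q'.2 ->
      exists2 q, border q & tnear m q q') ->
      [/\ b n (tile n q'), pw 3 q'.2 & forall q, border q -> ~ tnear m q q'].
    move=> n; case: (pselect (forall q', b n (tile n q') -> pw 3 q'.2 ->
      exists2 q, border q & tnear m q q')) => [hn|hn].
      by exists (mkpt x0 [::] 1).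
    have /existsNP[q' /not_implyP[h1 /not_implyP[h2 h3]]] := hn.
    by exists q' => _; split=> // q bq nq; apply: h3; exists q.
  have h' : om (fun n => [/\ b n (tile n (f n)), pw 3 (f n).2 &
      forall q, border q -> ~ tnear m q (f n)]).
    by apply: (om_imp h) => n /fP.
  have [|q [_ qP]] := @lim_point X G f _ (pw_fin Gself Gcontr 3).
    by apply: (om_imp h') => n [].
  have bq : border q.
    apply: sub => j; apply: (om_imp (om_and h' (qP j))) => n [[h1 _ _] e].
    by exists (f n); split=> //; apply: tnear_tile.
  have [n [[_ _ h3] e]] := om_ex (om_and h' (qP m)).
  by case: (h3 q bq); apply: tnear_tile.
move=> hom; have [n [near_border mn]] := om_ex (om_and hom (om_ge m)).
have [t0 [st0 nt0 bt0 esc0]] := esc n.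
have [p0 ep0] : exists p0, tile n p0 = t0 by apply: (tile_surj x0).
have pw1 : pw 1 p0.2 by apply: pw_nuc; move: nt0; rewrite -ep0.
have pw_3 i g : (i <= 3)%N -> pw i g -> pw 3 g by exact: (pw_le Gself Gcontr x0).
have b0 : b n (tile n p0) by rewrite ep0.
have [q0 bq0 n0] := near_border p0 b0 (pw_3 1%N _ isT pw1).
have pw_near i q q' : tnear m q q' -> pw i q'.2 -> pw i.+1 q.2.
  by move=> /(tnear_sym Gcontr) /tnear_pw_snd; apply.
pose V t := exists q' q1, [/\ tile n q' = t, pw 2 t.2, tnear m q1 q' & pr q1 = pr q0].
have Vt0 : V t0.
  by exists p0, q0; split=> //; rewrite -ep0; apply: (pw_le Gself Gcontr x0) pw1.
have [t s [q' [q1 [e pw2 n1 e1]]] ns bst|t [[? [? [_ + _ _]]]]] := esc0 V Vt0; last by [].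
have [q'' eq''] : exists q'', tile n q'' = tact s t.
  by apply: (tile_surj x0); rewrite /= size_act -e /= size_word.
have nq : tnear n q' q'' by exists s; rewrite // e.
have pw3 : pw 3 q''.2 by apply: (tnear_pw_snd nq); rewrite -e in pw2.
have b2 : b n (tile n q'') by rewrite eq''.
have [q2 bq2 n2] := near_border q'' b2 pw3.
have n01 j : tnear j q0 q1.
  by move: j; apply/(pr_eq Gself Gcontr x0).
have n0q' : tnear (m0 + k + k) q0 q' by apply: kP (n01 _) n1.
have le1 : (m0 + k + k <= n)%N by apply: leq_trans mn; rewrite /m leq_addr.
have le2 : (m0 + k <= m)%N by rewrite /m -addnA leq_addr.
have n0q'' : tnear (m0 + k) q0 q''.
  by apply: kP n0q' _; apply: (tnear_le Gcontr le1).
have n02 : tnear m0 q0 q2.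
  by apply: kP n0q'' _; apply: (tnear_le Gcontr le2); apply: tnear_sym.
have e02 : pr q0 = pr q2.
  apply: disc n02 => //.
    by apply: (pw_near 3 q0 p0 n0); apply: (pw_le Gself Gcontr x0) pw1.
  exact: (pw_near 3 q2 q'' n2).
exists q'', q2; split=> //.
have np : tnear m0 p0 q''.
  by apply: kP n0q''; apply: (tnear_le Gcontr le2); apply: tnear_sym.
by rewrite -eq''; apply: (tnear_pw_snd np).
Qed.

(** [PO] and [QO] are disjoint nonempty open sets whose complementary points are isolated from one
    another; connectedness of the space forces one of these points to touch both sides. *)
Lemma local_cut_point_of_tile_cuts : exists z : limit_space G, local_cut_point z.
Proof.
pose PO := [set z | exists2 q, pr q = z & ~ white q].
pose QO := [set z | exists2 q, pr q = z & ~ black q].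
have oO S : open [set z | exists2 q, pr q = z & ~ tile_limit S q].
  apply/(open_prP Gself Gcontr x0) => p [q epq nS].
  have nSp : ~ tile_limit S p by move=> Sp; apply: nS; apply: tile_limit_sat Sp.
  by have [m hm] := tile_limit_nbhs nSp; exists m => q' /hm; exists q'.
have oP : open PO by exact: oO.
have oQ : open QO by exact: oO.
have disj z : PO z -> QO z -> False.
  move=> [q <- nw] [q' e /cover wq']; apply: nw; exact: tile_limit_sat wq'.
have escb : forall n, exists t0, escapes n (a n) t0.
  by move=> n; have [_ _ h _] := projT2 (cid cut_data) n.
have escw : forall n, exists t0, escapes n (fun t => ~ a n t) t0.
  by move=> n; have [_ _ _ h] := projT2 (cid cut_data) n.
have [zP Pz] : exists z, PO z.
  apply: contrapT => /forallNP h; apply: (escape_limit escb) => q bq.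
  apply: black_white_border => //; apply: contrapT => nw.
  by apply: (h (pr q)); exists q.
have [zQ Qz] : exists z, QO z.
  apply: contrapT => /forallNP h; apply: (escape_limit escw) => q wq.
  apply: black_white_border => //; apply: contrapT => nb.
  by apply: (h (pr q)); exists q.
have isolated q : border q -> exists V, [/\ connected V, nbhs (pr q) V &
    forall z, V z -> z <> pr q -> PO z \/ QO z].
  move=> bq; pose F : set T := [set h | exists q', tnear 0 q q' /\ (q'.2 : T) = h].
  have [m disc] := border_discrete (tnear_fin Gself Gcontr 0 q : finite_set F).
  have [V [cV nV Vm]] := connected_nbhs Gself Gcontr x0 Grepl Gfg m q.
  exists V; split=> // z /Vm[q' <- nq'] zq.
  have nb : ~ border q'.
    move=> bq'; apply: zq; apply/esym/disc => //.
    - by exists q; split=> //; apply: tnear_refl.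
    - by exists q'; split=> //; apply: (tnear_le Gcontr (leq0n m)).
  case: (pselect (white q')) => wq'; last by left; exists q'.
  right; exists q' => // bq'; exact: nb (black_white_border bq' wq').
apply: contrapT => nocut.
pose punct (O : set (limit_space G)) z := nbhs z [set x | x <> z -> O x].
have alt z : ~ PO z -> ~ QO z -> punct PO z \/ punct QO z.
  have [q <-] := pr_surj z => nP nQ.
  have wq : white q by apply: contrapT => h; apply: nP; exists q.
  have bq : black q by apply: contrapT => h; apply: nQ; exists q.
  have [V [cV nV VPQ]] := isolated q (black_white_border bq wq).
  case: (pselect (exists x, [/\ V x, x <> pr q & PO x])) => hP; last first.
    right; apply: filterS nV => x Vx xq; case: (VPQ x Vx xq) => // Px.
    by case: hP; exists x.
  case: (pselect (exists x, [/\ V x, x <> pr q & QO x])) => hQ; last first.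
    left; apply: filterS nV => x Vx xq; case: (VPQ x Vx xq) => // Qx.
    by case: hQ; exists x.
  case: nocut; exists (pr q); apply/local_cut_pointP; exists V, PO, QO.
  by split=> //; split=> // x _ _ Px Qx; apply: disj Px Qx.
(* Without a local cut point, [alt] attaches each remaining point to one side; [PO] with the points
   attached to it is clopen, nonempty and disjoint from [QO]. *)
pose P1 := [set z | PO z \/ [/\ ~ PO z, ~ QO z & punct PO z]].
have P1T : P1 = setT.
  have cT := connected_limit_space Gself Gcontr x0 Grepl Gfg.
  apply: (cT P1); first by exists zP; left.
  - exists P1; last by rewrite setTI.
    rewrite openE => z [Pz1|[nP nQ pz]].
      by apply: filterS (open_nbhs_nbhs (conj oP Pz1)) => x; left.
    apply: filterS (pz) => x hx; case: (pselect (x = z)) => [->|xz].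
      by right.
    by left; apply: hx.
  - exists P1; last by rewrite setTI.
    rewrite -[P1]setCK closedC openE => z nP1.
    have nPz : ~ PO z by move=> h; apply: nP1; left.
    case: (pselect (QO z)) => Qz1.
      apply: filterS (open_nbhs_nbhs (conj oQ Qz1)) => x Qx [Px|[]//].
      exact: disj Px Qx.
    case: (alt z nPz Qz1) => pz; first by case: nP1; right.
    apply: filterS pz => x hx; case: (pselect (x = z)) => [-> //|xz].
    by have Qx := hx xz; case=> [Px|[]//]; apply: disj Px Qx.
have : P1 zQ by rewrite P1T.
by case=> [Px|[]//]; apply: disj Px Qz.
Qed.

End TileCuts.

(** * Property FW implies just-infiniteness *)

Section CommuteModulo.
Variable T : groupType.
Implicit Types (M K : set T) (a b g x : T).

(** Commutation in the quotient by [M]; the quotient group itself is never formed. *)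
Definition commute_mod M a b : Prop := M (a * b * a^-1 * b^-1).

Lemma normal_conj M g h : normal_subgroup M -> M h -> M (g * h * g^-1).
Proof. by move=> [_ nM] /(nM g^-1); rewrite conjgE invgK mulgA. Qed.

Lemma commute_mod_sym M a b : subgroup M -> commute_mod M a b -> commute_mod M b a.
Proof.
by move=> sM /(subgroupV sM); rewrite /commute_mod !invgM !invgK !mulgA.
Qed.

Lemma commute_mod_subgroup M b : normal_subgroup M ->
  subgroup [set a | commute_mod M a b].
Proof.
move=> nM; have sM := nM.1; split.
- rewrite /= /commute_mod mul1g invg1 mulg1 mulgV; exact: subgroup1.
- move=> x y /= hx hy; rewrite /commute_mod.
  have -> : x * y * b * (x * y)^-1 * b^-1 =
     (x * (y * b * y^-1 * b^-1) * x^-1) * (x * b * x^-1 * b^-1).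
    by rewrite invgM !mulgA !mulgVK.
  by apply: subgroupM => //; apply: normal_conj.
- move=> x /= hx; rewrite /commute_mod invgK.
  have -> : x^-1 * b * x * b^-1 = x^-1 * (x * b * x^-1 * b^-1)^-1 * x^-1^-1.
    by rewrite !invgM !invgK !mulgA mulgVK.
  by apply: normal_conj => //; apply: subgroupV.
Qed.

Lemma commute_mod_generated M (A : set T) : normal_subgroup M ->
  (forall a b, A a -> A b -> commute_mod M a b) ->
  forall a b, generated A a -> generated A b -> commute_mod M a b.
Proof.
move=> nM h a b ga gb; apply: (commute_mod_sym nM.1).
apply: (gb [set x | commute_mod M x a]); split; first exact: commute_mod_subgroup.
move=> c Ac; apply: (commute_mod_sym nM.1).
apply: (ga [set x | commute_mod M x c]); split; first exact: commute_mod_subgroup.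
by move=> d Ad; apply: h.
Qed.

Lemma avoid_cosets K (f : nat -> T) : subgroup K ->
  (forall i j, K ((f i)^-1 * f j) -> i = j) ->
  forall l : seq T, exists i, forall t, t \in l -> ~ K (t^-1 * f i).
Proof.
move=> sK finj l; apply: contrapT => /forallNP h.
have /choice[c cP] : forall i, exists t, t \in l /\ K (t^-1 * f i).
  move=> i; have /existsNP[t /not_implyP[tl /contrapT Kt]] := h i.
  by exists t.
have u : uniq [seq c i | i <- iota 0 (size l).+1].
  rewrite map_inj_in_uniq ?iota_uniq // => i j _ _ e; apply: finj.
  have [_ hi] := cP i; have [_ hj] := cP j; rewrite -e in hj.
  by have := subgroupM sK (subgroupV sK hi) hj; rewrite invgM invgK mulgA mulgK.
have := uniq_leq_size u (_ : {subset _ <= l}).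
rewrite size_map size_iota ltnn; suff: false by [].
have hs : {subset [seq c i | i <- iota 0 (size l).+1] <= l}.
  by move=> _ /mapP[i _ ->]; case: (cP i).
by have := uniq_leq_size u hs; rewrite size_map size_iota ltnn.
Qed.

End CommuteModulo.

(** * Infinite virtually abelian quotients *)

Section VirtuallyAbelianQuotient.
Variable T : groupType.
Variables (M : set T) (S : set T).
Hypotheses (nM : normal_subgroup M) (Minf : ~ finite_index M).
Hypotheses (fS : finite_set S) (Sind : finite_index (generated S)).
Hypothesis Scom : forall a b, S a -> S b -> commute_mod M a b.

Let P (l : seq T) := generated (M `|` [set` l]).

(** Adjoining the generators one by one to [M], the index passes from infinite to finite at some
    [g]; modulo [P l] this [g] then generates an infinite cyclic group. *)
Let chain : exists g l, [/\ S g, forall x, x \in l -> S x, ~ finite_index (P l) &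
  finite_index (P (g :: l))].
Proof.
have [l lP] := finite_set_seq fS.
have Pfin : finite_index (P l).
  apply: finite_index_sub Sind; try exact: generated_subgroup.
  move=> x gx; apply: (gx (P l)); split; first exact: generated_subgroup.
  by move=> y /lP yl; apply: sub_generated; right.
have lS x : x \in l -> S x by move/lP.
elim: l {lP} Pfin lS => [|g l IH] Pfin lS.
  case: Minf; apply: finite_index_sub Pfin; [exact: generated_subgroup|exact: nM.1|].
  move=> x gx; apply: (gx M); split; first exact: nM.1.
  by move=> y [|] //.
case: (pselect (finite_index (P l))) => [fl|nfl].
  by apply: IH => // x xl; apply: lS; rewrite inE xl orbT.
exists g, l; split=> // [|x xl]; apply: lS; first exact: mem_head.
by rewrite inE xl orbT.
Qed.

(** The power of [g] with integer exponent [a - b]. *)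
Let J (g : T) (a b : nat) : T := g ^+ a * (g ^+ b)^-1.

Let J_mul g a b c d : J g a b * J g c d = J g (a + c) (b + d).
Proof.
have e : (g ^+ b)^-1 * g ^+ c = g ^+ c * (g ^+ b)^-1.
  exact: commute_sym (commuteV (commuteX2 c b (commute_refl g))).
rewrite /J expgnDr (addnC b d) expgnDr invgM !mulgA; congr (_ * _).
by rewrite -!mulgA e.
Qed.

Let J_inv g a b : (J g a b)^-1 = J g b a.
Proof. by rewrite /J invgM invgK. Qed.

Lemma not_FW_virtually_abelian_quotient : ~ property_FW T.
Proof.
have [g [l [Sg lS Pinf Pfin]]] := chain.
have sM := nM.1; pose K := P l; pose Q := P (g :: l).
have sK : subgroup K by exact: generated_subgroup.
have sQ : subgroup Q by exact: generated_subgroup.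
have normK h : (forall x, S x -> commute_mod M h x) -> forall k, K k -> K (h * k * h^-1).
  move=> hS k Kk; apply: (Kk [set k | K (h * k * h^-1)]); split.
    split=> [|x y|x] /=.
    - by rewrite mulg1 mulgV; apply: (subgroup1 sK).
    - move=> hx hy; have -> : h * (x * y) * h^-1 = (h * x * h^-1) * (h * y * h^-1).
        by rewrite !mulgA mulgVK.
      exact: (subgroupM sK).
    - by move/(subgroupV sK); rewrite !invgM invgK mulgA.
  move=> x [Mx|xl] /=.
    by apply: sub_generated; left; apply: normal_conj.
  have -> : h * x * h^-1 = (h * x * h^-1 * x^-1) * x by rewrite mulgVK.
  apply: (subgroupM sK) => //; first by apply: sub_generated; left; apply/hS/lS.
  by apply: sub_generated; right.
have comg x : S x -> commute_mod M g x by exact: Scom.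
have comg' x : S x -> commute_mod M g^-1 x.
  by move=> Sx; apply: (subgroupV (commute_mod_subgroup x nM)); apply: comg.
have comX h n x : (forall x, S x -> commute_mod M h x) -> S x -> commute_mod M (h ^+ n) x.
  by move=> hS Sx; exact: (subgroupX n (commute_mod_subgroup x nM) (hS x Sx)).
have normJ a b k : K k -> K ((J g a b)^-1 * k * J g a b).
  move=> Kk; rewrite -{2}[J g a b]invgK J_inv; apply: (normK _ _ k Kk) => x Sx.
  apply: (subgroupM (commute_mod_subgroup x nM)); first exact: comX.
  by apply: (subgroupV (commute_mod_subgroup x nM)); apply: comX.
have id1 (u v x y : T) : v^-1 * u^-1 * (x * y) = (v^-1 * (u^-1 * x) * v) * (v^-1 * y).
  by rewrite !mulgA mulgK.
have id2 (u x : T) : u * x^-1 = (u^-1)^-1 * (u^-1 * x)^-1 * u^-1.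
  by rewrite !invgM !invgK !mulgA mulgK.
have id3 (u v w x y z : T) :
    (x * (u * v))^-1 * (y * z) = (v^-1 * (u^-1 * (x^-1 * (y * w))) * v) * ((w * v)^-1 * z).
  by rewrite !invgM !mulgA mulgK mulgK.
have id4 (u v w x : T) : u * x * v = (u * w * v) * (v^-1 * (w^-1 * x) * v).
  by rewrite !mulgA !mulgK.
have id5 (u v x : T) : u^-1 * x = v * ((u * v)^-1 * x).
  by rewrite invgM !mulgA mulgV mul1g.
have QJ q : Q q -> exists a b, K ((J g a b)^-1 * q).
  move=> Qq; apply: (Qq [set q | exists a b, K ((J g a b)^-1 * q)]); split.
    split=> [|x y [a [b hx]] [c [d hy]]|x [a [b hx]]] /=.
    - by exists 0, 0; rewrite /J expg0 invg1 !mulg1 invg1; apply: (subgroup1 sK).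
    - exists (a + c)%N, (b + d)%N; rewrite -J_mul invgM.
      have -> : (J g c d)^-1 * (J g a b)^-1 * (x * y) =
        ((J g c d)^-1 * ((J g a b)^-1 * x) * J g c d) * ((J g c d)^-1 * y).
        exact: id1.
      by apply: (subgroupM sK) => //; apply: normJ.
    - exists b, a; rewrite -J_inv invgK.
      have -> : J g a b * x^-1 = (J g b a)^-1 * ((J g a b)^-1 * x)^-1 * J g b a.
        by rewrite -(J_inv g a b); apply: id2.
      by apply: normJ; apply: (subgroupV sK).
  move=> x [Mx|]; first by exists 0, 0;
    rewrite /J expg0 invg1 !mulg1 invg1 mul1g; apply: sub_generated; left.
  rewrite /= inE => /orP[/eqP ->|xl].
    by exists 1%N, 0; rewrite /J expg0 expg1 invg1 mulg1 mulVg; apply: (subgroup1 sK).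
  by exists 0, 0; rewrite /J expg0 invg1 !mulg1 invg1 mul1g; apply: sub_generated; right.
(* If a positive power of [g] were in [K], reducing exponents modulo [i] would leave finitely many
   cosets of [K] in [Q], against the infinite index of [K]. *)
have gK i : K (g ^+ i) -> i = 0.
  move=> Ki; apply: contrapT => /eqP; rewrite -lt0n => i0; apply: Pinf.
  apply: (finite_index_trans sQ sK Pfin).
  exists [seq J g a b | a <- iota 0 i, b <- iota 0 i] => q /QJ[a [b hq]].
  exists (J g (a %% i) (b %% i)).
    by apply/allpairsP; exists (a %% i, b %% i); rewrite !mem_iota !add0n !ltn_mod.
  have e1 x : K (g ^+ (x %/ i * i)) by rewrite mulnC expgnA; exact: (subgroupX _ sK Ki).
  have -> : (J g (a %% i) (b %% i))^-1 * q =
     J g (a %/ i * i) (b %/ i * i) * ((J g a b)^-1 * q).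
    have -> : J g a b = J g (a %% i) (b %% i) * J g (a %/ i * i) (b %/ i * i).
      by rewrite J_mul ![(_ %% i + _)%N]addnC -!divn_eq.
    exact: id5.
  apply: (subgroupM sK) => //; apply: (subgroupM sK) => //; exact: (subgroupV sK).
have gKJ a b : K (J g a b) -> a = b.
  move=> Kab; wlog ab : a b Kab / (a <= b)%N.
    move=> h; case: (leqP a b) => [|/ltnW]; first exact: h.
    by move=> ba; apply/esym/h => //; rewrite -J_inv; apply: (subgroupV sK).
  apply/eqP; rewrite eqn_leq ab -subn_eq0; apply/eqP/gK.
  have -> : g ^+ (b - a) = (J g a b)^-1 by rewrite J_inv /J expgnFr.
  exact: (subgroupV sK).
have [lt ltP] := (finite_indexP sQ).1 Pfin.
(* The cosets of [K] form finitely many lines [t g^i K], and [A] is made of their halves with [i]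
   nonnegative; a translation shifts each half-line by a bounded amount. *)
pose A := [set x | exists2 t, t \in lt & exists i, K ((t * g ^+ i)^-1 * x)].
apply: (@not_FW_of_cosets T K A [set: T]) => //.
- move=> a h [t tl [i hi]] Kh; exists t => //; exists i.
  by rewrite mulgA; apply: (subgroupM sK).
- by apply/seteqP; split=> // x _; apply: sub_generated.
- move=> s _.
  have /choice[B BP] : forall t, exists b, forall i x, K ((t * g ^+ i)^-1 * x) ->
      (b <= i)%N -> A (s * x).
    move=> t; have [t' t'l Qt] := ltP (s * t); have [a [b hab]] := QJ _ Qt.
    exists b => i x hx bi; exists t' => //; exists (a + (i - b))%N.
    have Ji : J g (a + i) b = g ^+ (a + (i - b)) by rewrite /J addnBA // expgnFr // (leq_trans bi) ?leq_addl.
    rewrite -Ji -[b in J g _ b]addn0 -J_mul.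
    have -> : J g i 0 = g ^+ i by rewrite /J expg0 invg1 mulg1.
    have -> : (t' * (J g a b * g ^+ i))^-1 * (s * x) =
       ((g ^+ i)^-1 * ((J g a b)^-1 * (t'^-1 * (s * t))) * g ^+ i) * ((t * g ^+ i)^-1 * x).
      exact: id3.
    have -> : ((g ^+ i)^-1 * ((J g a b)^-1 * (t'^-1 * (s * t))) * g ^+ i) * ((t * g ^+ i)^-1 * x) =
       ((J g i 0)^-1 * ((J g a b)^-1 * (t'^-1 * (s * t))) * J g i 0) * ((t * g ^+ i)^-1 * x).
      by have -> : J g i 0 = g ^+ i by rewrite /J expg0 invg1 mulg1.
    by apply: (subgroupM sK) => //; apply: normJ.
  exists [seq t * g ^+ i | t <- lt, i <- iota 0 (\max_(t <- lt) B t)] => x [t tl [i hi]] nA.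
  exists (t * g ^+ i) => //; apply/allpairsP; exists (t, i); split=> //.
  rewrite mem_iota add0n /=; apply: leq_trans (leq_bigmax_seq _ tl isT).
  by rewrite ltnNge; apply/negP => /(BP _ _ _ hi).
- move=> l'; have [t0 t0l _] := ltP 1.
  have inj i j : K ((t0 * g ^+ i)^-1 * (t0 * g ^+ j)) -> i = j.
    rewrite invgM mulgA mulgVK => h; have := gKJ j i; rewrite /J.
    have -> : g ^+ j * (g ^+ i)^-1 = (g ^+ i)^-1 * g ^+ j.
      exact: commuteV (commuteX2 j i (commute_refl g)).
    by move=> ->.
  have [i iP] := avoid_cosets sK inj l'.
  exists (t0 * g ^+ i) => //; exists t0 => //; exists i; rewrite mulVg.
  exact: (subgroup1 sK).
- move=> l'.
  (* If [g^-j] lies in [t g^i K] while [t^-1] lies in [g^(a-b) K], then [a = i + b + j]; hence large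
     negative powers of [g] are outside [A]. *)
  have /choice[B BP] : forall t, exists N, forall i j,
      K ((t * g ^+ i)^-1 * (g ^+ j)^-1) -> (j <= N)%N.
    move=> t; have J0 i : (g ^+ i)^-1 = J g 0 i by rewrite /J expg0 mul1g.
    have KQ k : K k -> Q k.
      move=> Kk; apply: (Kk Q); split=> // x [Mx|xl]; apply: sub_generated; [by left|].
      by right; rewrite /= inE [x \in l]xl orbT.
    case: (pselect (Q t^-1)) => [/QJ[a [b hab]]|nQ]; last first.
      exists 0 => i j; rewrite invgM => /KQ h; case: nQ.
      have Qg n : Q (g ^+ n).
        by apply: (subgroupX n sQ); apply: sub_generated; right; apply: mem_head.
      have -> : t^-1 = g ^+ i * ((g ^+ i)^-1 * t^-1 * (g ^+ j)^-1) * g ^+ j.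
        by rewrite !mulgA mulgVK mulgV mul1g.
      by apply: (subgroupM sQ) => //; apply: (subgroupM sQ).
    exists a => i j; rewrite invgM !J0.
    have -> : J g 0 i * t^-1 * J g 0 j =
        J g a (i + b + j) * ((J g 0 j)^-1 * ((J g a b)^-1 * t^-1) * J g 0 j).
      have -> : J g a (i + b + j) = J g 0 i * J g a b * J g 0 j.
        by rewrite !J_mul add0n addn0.
      exact: id4.
    move=> h; have := subgroupM sK h (subgroupV sK (normJ 0 j _ hab)).
    by rewrite mulgK => /gKJ ->; apply: leq_addl.
  pose N := \max_(t <- lt) B t.
  have inj i j : K ((g ^+ (N.+1 + i))^-1^-1 * (g ^+ (N.+1 + j))^-1) -> i = j.
    by rewrite invgK => /gKJ /eqP; rewrite eqn_add2l => /eqP.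
  have [i iP] := avoid_cosets sK inj l'.
  exists (g ^+ (N.+1 + i))^-1 => // -[t tl [j /BP]].
  apply/negP; rewrite -ltnNge; apply: leq_trans (leq_addr _ _); rewrite ltnS.
  exact: leq_bigmax_seq.
Qed.

End VirtuallyAbelianQuotient.

(** * Rigid stabilizers and commutators in normal subgroups *)

Section RigidStabilizers.
Variables (X : finType) (G : groupClosed (tree_aut X)).
Local Notation T := (group_of G).
Implicit Types (a b g h k : T) (u v w : seq X).

Definition cone_fixer v : set T := [set k : T | forall w, k (v ++ w) = v ++ w].

Lemma prefix_size_eq u v w : size u = size v -> prefix u (v ++ w) -> u = v.
Proof.
move=> suv /prefixP[t]; move/eqP; rewrite eqseq_cat //; by case/andP => /eqP.
Qed.

Lemma rist_subgroup v : subgroup (rist v : set T).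
Proof.
split=> [w //|a b ra rb w vw|a ra w vw].
  by rewrite group_of_actM rb // ra.
by rewrite -{1}(ra w vw) group_of_actK.
Qed.

Lemma cone_fixer_subgroup v : subgroup (cone_fixer v).
Proof.
split=> [w //|a b ra rb w|a ra w]; first by rewrite group_of_actM rb ra.
by rewrite -{1}(ra w) group_of_actK.
Qed.

Lemma cone_fixer_fix v k : cone_fixer v k -> k v = v.
Proof. by move=> /(_ [::]); rewrite cats0. Qed.

Lemma rist_fix u v h : size u = size v -> rist u h -> h v = v.
Proof.
move=> suv ru; have [e|nuv] := eqVneq u v; last first.
  apply: ru; apply: contra nuv => p; apply/eqP.
  by apply: (@prefix_size_eq _ _ [::]); rewrite ?cats0.
rewrite {}e in ru; apply/eqP; case: (eqVneq (h v) v) => // ne.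
have np : ~~ prefix v (h v).
  apply: contra ne => p; apply/eqP/esym.
  by apply: (@prefix_size_eq _ _ [::]); rewrite ?cats0 // size_act.
have := ru _ np => /group_of_act_inj e; by rewrite e eqxx in ne.
Qed.

Lemma rist_cone_fixer u v h : size u = size v -> u <> v -> rist u h -> cone_fixer v h.
Proof.
move=> suv uv ru w; apply: ru; apply/negP => /(prefix_size_eq suv); exact: uv.
Qed.

Lemma cone_fixer_rist_commute v k h : cone_fixer v k -> rist v h -> k * h = h * k.
Proof.
move=> Kk rh; apply: group_of_ext => x; rewrite !group_of_actM.
have [/prefixP[w ->]|nv] := boolP (prefix v x).
  have hv := rist_fix (erefl (size v)) rh.
  have : prefix (h v) (h (v ++ w)) by rewrite prefix_act prefix_prefix.
  by rewrite hv Kk => /prefixP[w' ->]; rewrite Kk.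
by rewrite (rh x nv) rh // -(cone_fixer_fix Kk) prefix_act.
Qed.

Lemma rist_conj g v h : rist v h -> rist (g v) (g * h * g^-1).
Proof.
move=> rh w nv; rewrite !group_of_actM rh ?group_of_actVK //.
by rewrite -(prefix_act g) group_of_actVK.
Qed.

Lemma cone_fixer_conj g v k : cone_fixer v k -> cone_fixer (g v) (g * k * g^-1).
Proof.
move=> Kk w; rewrite !group_of_actM.
have : prefix v (g^-1 (g v ++ w)).
  by rewrite -(prefix_act g) group_of_actVK prefix_prefix.
move=> /prefixP[t e]; rewrite e Kk -e; exact: group_of_actVK.
Qed.

Hypothesis Gbranch : branch G.

Lemma level_transitive_act u v : size u = size v -> exists g, g u = v.
Proof.
by move=> /Gbranch.1[g gG e]; exists (GroupOf gG).
Qed.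

(* A double commutator [[g, a], b] with [g v <> v] and [a], [b] in the rigid
   stabilizer of [v] reduces to a commutator of [a^-1] and [b]. *)
Lemma normal_contains_commutators (M : set T) : normal_subgroup M -> M <> [set 1] ->
  exists n, forall a b, level_rist n a -> level_rist n b -> commute_mod M a b.
Proof.
move=> nM M1; have sM := nM.1.
have [g Mg g1] : exists2 g, M g & g <> 1.
  apply: contrapT => h; apply: M1; apply/seteqP; split=> x.
    by move=> Mx; apply: contrapT => x1; apply: h; exists x.
  by move=> ->; apply: subgroup1.
have [v gv] : exists v, g v <> v.
  by apply: contrapT => /forallNP h; apply: g1; apply: group_of_ext => v; apply: contrapT.
have comv a b : rist v a -> rist v b -> commute_mod M a b.
  move=> ra rb; have ra' : rist v a^-1 by apply: (subgroupV (rist_subgroup v)).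
  pose x := g * a^-1 * g^-1 * a.
  have Mx : M x.
    have -> : x = g * (a^-1 * g^-1 * a^-1^-1) by rewrite invgK /x !mulgA.
    by apply: subgroupM => //; apply: normal_conj => //; apply: subgroupV.
  have My : M (x * b * x^-1 * b^-1).
    have -> : x * b * x^-1 * b^-1 = x * (b * x^-1 * b^-1) by rewrite !mulgA.
    by apply: subgroupM => //; apply: normal_conj => //; apply: subgroupV.
  have rg := rist_conj (g := g) ra'.
  have Kg : cone_fixer v (g * a^-1 * g^-1).
    by apply: rist_cone_fixer rg => //; rewrite size_act.
  have rab : rist v (a * b * a^-1).
    by apply: (subgroupM (rist_subgroup v)) => //; apply: (subgroupM (rist_subgroup v)).
  rewrite /commute_mod -[a * b * a^-1](mulgK (g * a^-1 * g^-1)).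
  rewrite -(cone_fixer_rist_commute Kg rab).
  by move: My; rewrite /x invgM !mulgA.
exists (size v); apply: commute_mod_generated => // a b [u su ra] [w sw rb].
case: (eqVneq u w) => [e|/eqP uw].
  rewrite -{w}e in sw rb.
  have [c cu] := level_transitive_act (su : size u = size v).
  have ra' := rist_conj (g := c) ra; have rb' := rist_conj (g := c) rb; rewrite cu in ra' rb'.
  have := normal_conj c^-1 nM (comv _ _ ra' rb').
  by rewrite /commute_mod !invgM !invgK !mulgA !mulgVK mulVg mul1g.
have Ka : cone_fixer w a by apply: rist_cone_fixer ra => //; rewrite su sw.
rewrite /commute_mod (cone_fixer_rist_commute Ka rb) mulgK mulgV.
exact: subgroup1.
Qed.

Lemma FW_just_infinite : finitely_generated T -> property_FW T -> just_infinite T.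
Proof.
move=> Gfg FW M nM M1; apply: contrapT => Minf.
have [n hn] := normal_contains_commutators nM M1.
have fn := Gbranch.2 n.
have [S fS genS] := finite_index_fg Gfg (generated_subgroup _) fn.
apply: (@not_FW_virtually_abelian_quotient T M S nM Minf fS _ _ FW).
  by rewrite genS.
have SL s : S s -> level_rist n s.
  by move=> Ss; rewrite /level_rist -genS; apply: sub_generated.
by move=> a b Sa Sb; apply: hn; apply: SL.
Qed.

End RigidStabilizers.

(** * Commensurated sets of a branch group *)

Section Orbits.
Variables (T : groupType) (Y : Type) (act : T -> Y -> Y).
Hypothesis actP : is_left_action act.
Implicit Types (R S : set T) (A : set Y) (y z : Y) (g r : T).

Let aM := actM actP.
Let aK := actK actP.
Let a1 := act1 actP.

Definition orb R y : set Y := [set act r y | r in R].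

Lemma orb_refl R y : subgroup R -> orb R y y.
Proof. by move=> sR; exists 1; [exact: subgroup1|rewrite a1]. Qed.

Lemma orb_act R y z r : subgroup R -> R r -> orb R y z -> orb R y (act r z).
Proof.
by move=> sR Rr [r' Rr' <-]; exists (r * r'); [exact: subgroupM|rewrite aM].
Qed.

Lemma orb_eq R y z : subgroup R -> orb R y z -> orb R y = orb R z.
Proof.
move=> sR [r Rr <-]; apply/seteqP; split=> _ [r' Rr' <-].
  exists (r' * r^-1); last by rewrite -aM mulgVK.
  by apply: subgroupM => //; apply: subgroupV.
by exists (r' * r); [exact: subgroupM|rewrite aM].
Qed.

Definition almost_inv A : Prop := forall g, finite_set [set y | A y /\ ~ A (act g y)].

Lemma almost_invC A : almost_inv A -> almost_inv (~` A).
Proof.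
move=> hA g; apply: (finite_set_inj (hA g^-1) (f := act g)) => [y [/= nA /contrapT Ay]|].
  by split=> //; rewrite aK.
by move=> x y _ _; apply: act_inj.
Qed.

(** An orbit meeting both [A] and its complement contains a point of [A] moved out by a generator or
    its inverse; only finitely many points are. *)
Lemma mixed_orbits S A : finite_set S -> almost_inv A -> exists2 F : set Y, finite_set F &
  forall y r r', generated S r -> generated S r' -> A (act r y) -> ~ A (act r' y) ->
    exists2 z, F z & orb (generated S) y z.
Proof.
move=> fS hA; have sR := generated_subgroup S.
exists [set z | exists2 s, (S `|` [set x^-1 | x in S]) s & A z /\ ~ A (act s z)].
  apply: finite_set_bigcup => [|s _]; last exact: hA.
  by rewrite finite_setU; split=> //; apply: finite_image.
move=> y r r' Rr Rr' Ar nAr'; apply: contrapT => nF.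
pose good g := generated S g /\ forall q, generated S q -> A (act q y) -> A (act g (act q y)).
have step s q : (S `|` [set x^-1 | x in S]) s -> generated S q ->
    A (act q y) -> A (act s (act q y)).
  move=> Ss Rq Aq; apply: contrapT => nA; apply: nF; exists (act q y); last by exists q.
  by exists s.
suff [[_ h] _] : good (r' * r^-1) /\ good (r' * r^-1)^-1.
  by apply: nAr'; have := h r Rr Ar; rewrite -aM mulgVK.
have : generated S (r' * r^-1) by apply: (subgroupM sR) => //; apply: (subgroupV sR).
apply: (@generated_ind _ S (fun g => good g /\ good g^-1)).
  have gM g h : good g -> good h -> good (g * h).
    move=> [Rg hg] [Rh hh]; split; first exact: (subgroupM sR).
    move=> q Rq Aq; rewrite aM -[act h _]aM; apply: hg; first exact: (subgroupM sR).
    by rewrite aM; apply: hh.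
  split.
  - by rewrite invg1; split; split; rewrite ?a1 //; try exact: (subgroup1 sR);
      move=> q _ Aq; rewrite a1.
  - by move=> g h [g1 g2] [h1 h2]; split; rewrite ?invgM; apply: gM.
  - by move=> g [g1 g2]; rewrite invgK.
move=> s Ss; have Rs := sub_generated Ss.
split; split=> //; try exact: (subgroupV sR).
- by move=> q Rq Aq; apply: step => //; left.
- by move=> q Rq Aq; apply: step => //; right; exists s.
Qed.

Definition cut_orbit A R y : Prop :=
  infinite_set (orb R y `&` A) /\ infinite_set (orb R y `\` A).

(** With [uncut_out], this compares [A] with a union of orbits almost contained in it when no orbit
    is cut; both are used for the whole group and for rigid stabilizers. *)
Lemma uncut_in S A : finite_set S -> almost_inv A ->
  finite_set [set y | [/\ ~ cut_orbit A (generated S) y, A y &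
     infinite_set (orb (generated S) y `\` A)]].
Proof.
move=> fS hA; have sR := generated_subgroup S; have [F fF FP] := mixed_orbits fS hA.
apply: (sub_finite_set (B := [set y | exists2 z, F z &
   (finite_set (orb (generated S) z `&` A) /\ (orb (generated S) z `&` A) y)])).
  move=> y [nc Ay inf].
  have [_ [[r Rr <-] nAr]] := infinite_setN0 inf.
  have [|z Fz yz] := FP y 1 r (subgroup1 sR) Rr _ nAr; first by rewrite a1.
  exists z => //; rewrite -(orb_eq sR yz); split; last by split=> //; apply: orb_refl.
  by apply: contrapT => h; apply: nc.
apply: finite_set_bigcup => // z _.
case: (pselect (finite_set (orb (generated S) z `&` A))) => h.
  by apply: sub_finite_set h => y [].
by apply: sub_finite_set (finite_set0 Y) => y [].
Qed.

Lemma uncut_out S A : finite_set S -> almost_inv A ->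
  finite_set [set y | [/\ ~ A y, finite_set (orb (generated S) y `\` A) &
     (orb (generated S) y `&` A) !=set0]].
Proof.
move=> fS hA; have sR := generated_subgroup S; have [F fF FP] := mixed_orbits fS hA.
apply: (sub_finite_set (B := [set y | exists2 z, F z &
   (finite_set (orb (generated S) z `\` A) /\ (orb (generated S) z `\` A) y)])).
  move=> y [nAy fin [_ [[r Rr <-] Ar]]].
  have [|z Fz yz] := FP y r 1 Rr (subgroup1 sR) Ar; first by rewrite a1.
  exists z => //; rewrite -(orb_eq sR yz); split=> //.
  by split=> //; apply: orb_refl.
apply: finite_set_bigcup => // z _.
case: (pselect (finite_set (orb (generated S) z `\` A))) => h.
  by apply: sub_finite_set h => y [].
by apply: sub_finite_set (finite_set0 Y) => y [].
Qed.

End Orbits.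

Section TransitiveNotFW.
Variable T : groupType.

(** If no orbit were cut, the orbits that meet [A] and are almost contained in it would form an
    invariant set close to [A]; so some orbit is cut, and the action is restricted to it. *)
Lemma not_FW_transitive : finitely_generated T -> ~ property_FW T ->
  exists (Y : Type) (act : T -> Y -> Y) (A : set Y),
  [/\ is_left_action act, forall y z, exists g, act g y = z, almost_inv act A,
      infinite_set A & infinite_set (~` A)].
Proof.
move=> [S [fS genS]] nFW.
have [Y [act [actP [A [cA nA]]]]] : exists (Y : Type) (act : T -> Y -> Y),
    is_left_action act /\ exists A : set Y, commensurated act A /\ ~ transfixed act A.
  apply: contrapT => h; apply: nFW => Y act actP A cA; apply: contrapT => nA.
  by apply: h; exists Y, act; split=> //; exists A.
have hA : almost_inv act A by apply/(commensuratedP actP).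
have [y0 [i1 i2]] : exists y, cut_orbit act A (generated S) y.
  apply: contrapT => /forallNP nc; apply: nA.
  have sR := generated_subgroup S.
  exists [set y | finite_set (orb act (generated S) y `\` A) /\
     (orb act (generated S) y `&` A) !=set0]; split.
    move=> g; have Rg : generated S g by rewrite genS.
    have e y : orb act (generated S) y = orb act (generated S) (act g y).
      by apply: orb_eq => //; exists g.
    apply/seteqP; split=> y.
      by move=> [z hz <-]; rewrite /= -e.
    move=> hy; exists (act g^-1 y); last exact: (actVK actP).
    by rewrite /= (e (act _ y)) (actVK actP).
  rewrite finite_setU; split.
    apply: sub_finite_set (uncut_in actP fS hA) => y [Ay nB]; split=> //.
    move=> fin; apply: nB; split=> //; exists y; split=> //.
    exact: orb_refl.
  by apply: sub_finite_set (uncut_out actP fS hA) => y [[? ?] ?].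
rewrite genS in i1 i2.
pose O := {y : Y | exists g, act g y0 = y}.
have actO (g : T) (y : O) : exists h, act h y0 = act g (sval y).
  by case: y => y /= [h <-]; exists (g * h); rewrite (actM actP).
pose act' (g : T) (y : O) : O := exist _ (act g (sval y)) (actO g y).
have Oeq (y z : O) : sval y = sval z -> y = z.
  by case: y z => y hy [z hz] /= e; subst z; congr exist; apply: Prop_irrelevance.
pose A' : set O := [set y | A (sval y)].
have infO (B : set Y) : infinite_set (orb act setT y0 `&` B) ->
    infinite_set [set y : O | B (sval y)].
  move=> h f; apply: h; apply: sub_finite_set (finite_image sval f) => y [[g _ e] By].
  have hy : exists g, act g y0 = y by exists g.
  by exists (exist _ y hy).
exists O, act', A'; split.
- by split=> [y|g h y]; apply: Oeq; rewrite /= ?(act1 actP) ?(actM actP).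
- move=> [y hy] [z hz]; have [g ey] := hy; have [h ez] := hz.
  exists (h * g^-1); apply: Oeq; rewrite /= -ey -ez -(actM actP).
  by rewrite mulgVK.
- move=> g; apply: (finite_set_inj (hA g) (f := sval)) => // y z _ _; exact: Oeq.
- exact: (infO A i1).
- exact: (infO (~` A) i2).
Qed.

End TransitiveNotFW.

(** * Signed differences of commensurate sets *)

Section Cardinal.
Variable Y : Type.
Implicit Types (C D E : set Y).

Definition setcard C : nat :=
  xget 0 [set n | exists s : seq {classic Y}, [/\ uniq s, size s = n & forall x, C x <-> x \in s]].

Lemma setcardE C (s : seq {classic Y}) : uniq s -> (forall x, C x <-> x \in s) ->
  setcard C = size s.
Proof.
move=> us sC; rewrite /setcard; case: xgetP => [n _ [s' [us' <- sC']]|h]; last first.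
  by case: (h (size s)); exists s.
apply: perm_size; apply: uniq_perm => // x.
by apply/idP/idP => [/sC' /sC|/sC /sC'].
Qed.

Lemma setcard_count C (s : seq {classic Y}) : uniq s -> (forall x, C x -> x \in s) ->
  setcard C = count (fun x => `[< C x >]) s.
Proof.
move=> us Cs; rewrite -size_filter; apply: setcardE; first exact: filter_uniq.
move=> x; rewrite (@mem_filter {classic Y}); split=> [Cx|/andP[/asboolP]//].
by apply/andP; split; [apply/asboolP|apply: Cs].
Qed.

Lemma finite_set_uniq C : finite_set C -> exists s : seq {classic Y},
  uniq s /\ forall x, C x <-> x \in s.
Proof.
move=> /(@finite_set_seq {classic Y})[s sP]; exists (undup s).
by split=> [|x]; [exact: undup_uniq|rewrite (@mem_undup {classic Y})].
Qed.

Lemma setcard_eq0 C : finite_set C -> setcard C = 0 -> forall x, ~ C x.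
Proof.
move=> /finite_set_uniq[s [us sC]]; rewrite (setcardE us sC) => /size0nil s0 x.
by move/sC; rewrite s0.
Qed.

Lemma setcard0 C : (forall x, ~ C x) -> setcard C = 0.
Proof.
move=> h; apply: (@setcardE _ [::]) => // x; split=> // Cx; exfalso; exact: (h x).
Qed.

Lemma setcard_preimage C (f g : Y -> Y) : cancel f g -> cancel g f -> finite_set C ->
  setcard [set y | C (f y)] = setcard C.
Proof.
move=> fK gK /finite_set_uniq[s [us sC]].
rewrite (setcardE us sC) -(size_map (g : {classic Y} -> {classic Y}) s); apply: setcardE.
  by rewrite map_inj_uniq //; apply: (can_inj gK).
move=> x; split=> [/sC h|/mapP[y /sC Cy ->]]; last by rewrite /= gK.
by apply/mapP; exists (f x); rewrite ?fK.
Qed.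

(** Additivity of the signed size [|C - D| - |D - C|] along [C], [D], [E], stated without
    subtraction and checked pointwise on a finite list carrying all differences. *)
Lemma setcard_cocycle C D E : finite_set (C `\` D) -> finite_set (D `\` C) ->
  finite_set (D `\` E) -> finite_set (E `\` D) ->
  setcard (C `\` E) + setcard (D `\` C) + setcard (E `\` D) =
  setcard (E `\` C) + setcard (C `\` D) + setcard (D `\` E) :> nat.
Proof.
move=> f1 f2 f3 f4.
have : finite_set ((C `\` D `|` D `\` C) `|` (D `\` E `|` E `\` D)).
  by rewrite !finite_setU.
move=> /finite_set_uniq[s [us sP]].
have sub F : (forall x, F x -> ((C `\` D `|` D `\` C) `|` (D `\` E `|` E `\` D)) x) ->
    setcard F = count (fun x => `[< F x >]) s.
  by move=> h; apply: setcard_count => // x /h /sP.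
have h1 := sub (C `\` D) (fun x h => or_introl (or_introl h)).
have h2 := sub (D `\` C) (fun x h => or_introl (or_intror h)).
have h3 := sub (D `\` E) (fun x h => or_intror (or_introl h)).
have h4 := sub (E `\` D) (fun x h => or_intror (or_intror h)).
have h5 : setcard (E `\` C) = count (fun x => `[< (E `\` C) x >]) s.
  apply: sub => x [Ex nC]; case: (pselect (D x)) => Dx; last by right; right.
  by left; right.
have h6 : setcard (C `\` E) = count (fun x => `[< (C `\` E) x >]) s.
  apply: sub => x [Cx nE]; case: (pselect (D x)) => Dx; last by left; left.
  by right; left.
rewrite h1 h2 h3 h4 h5 h6 {h1 h2 h3 h4 h5 h6}.
elim: s {us sP sub} => //= x s IH.
have e F F' : `[< (F `\` F') x >] = `[< F x >] && ~~ `[< F' x >].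
  apply/idP/idP => [/asboolP[Fx nF]|/andP[/asboolP Fx /asboolPn nF]].
    by apply/andP; split; [apply/asboolP|apply/asboolPn].
  by apply/asboolP.
rewrite !e; move: IH.
set c1 := count _ s; set c2 := count _ s; set c3 := count _ s.
set c4 := count _ s; set c5 := count _ s; set c6 := count _ s.
by case: `[< C x >]; case: `[< D x >]; case: `[< E x >] => /=; lia.
Qed.

End Cardinal.

Section Balance.
Variables (T : groupType) (Y : Type) (act : T -> Y -> Y).
Hypothesis actP : is_left_action act.
Variables (P : set T) (B : set Y).
Hypothesis sP : subgroup P.
Hypothesis PB : forall p, P p -> finite_set [set y | B y /\ ~ B (act p y)].

Definition gain (p : T) : nat := setcard [set y | ~ B y /\ B (act p y)].
Definition loss (p : T) : nat := setcard [set y | B y /\ ~ B (act p y)].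

Lemma gain_finite p : P p -> finite_set [set y | ~ B y /\ B (act p y)].
Proof.
move=> Pp; apply: (finite_set_inj (PB (subgroupV sP Pp)) (f := act p)).
  by move=> y [nB Bp]; split=> //; rewrite (actK actP).
by move=> x y _ _; apply: act_inj.
Qed.

(** The difference [gain - loss] is a homomorphism from [P] to the integers: the cocycle identity
    for the preimages of [B] under [p * q] and [q], and [B] itself. *)
Lemma gain_loss_mul p q : P p -> P q ->
  (gain (p * q)%g + loss p + loss q = loss (p * q)%g + gain p + gain q)%N.
Proof.
move=> Pp Pq.
pose C := [set y | B (act p (act q y))]; pose D := [set y | B (act q y)].
have qK : cancel (act q) (act q^-1) by exact: actK.
have qVK : cancel (act q^-1) (act q) by exact: actVK.
have := @setcard_cocycle _ C D B.
have -> : setcard (C `\` B) = gain (p * q).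
  by rewrite /gain; congr setcard; apply/seteqP; split=> y; rewrite /= (actM actP) => -[].
have -> : setcard (B `\` C) = loss (p * q).
  by rewrite /loss; congr setcard; apply/seteqP; split=> y; rewrite /= (actM actP) => -[].
have -> : setcard (B `\` D) = loss q by [].
have -> : setcard (D `\` B) = gain q.
  by rewrite /gain; congr setcard; apply/seteqP; split=> y /= -[].
have eD : D `\` C = [set y | [set z | B z /\ ~ B (act p z)] (act q y)] by [].
have eC : C `\` D = [set y | [set z | ~ B z /\ B (act p z)] (act q y)].
  by apply/seteqP; split=> y /= -[].
have -> : setcard (D `\` C) = loss p.
  by rewrite eD (setcard_preimage qK qVK) //; apply: PB.
have -> : setcard (C `\` D) = gain p.
  by rewrite eC (setcard_preimage qK qVK) //; apply: gain_finite.
apply.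
- rewrite eC; apply: (finite_set_inj (gain_finite Pp) (f := act q)) => // x y _ _.
  exact: act_inj.
- rewrite eD; apply: (finite_set_inj (PB Pp) (f := act q)) => // x y _ _.
  exact: act_inj.
- by apply: sub_finite_set (gain_finite Pq) => y [].
- exact: PB.
Qed.

End Balance.

(** * Intersections, conjugates and normal cores *)

Section FiniteIndexMore.
Variable T : groupType.
Implicit Types (H K R P : set T).

Lemma subgroupI H K : subgroup H -> subgroup K -> subgroup (H `&` K).
Proof.
move=> sH sK; split=> [|x y [? ?] [? ?]|x [? ?]].
- by split; [exact: (subgroup1 sH)|exact: (subgroup1 sK)].
- by split; [exact: (subgroupM sH)|exact: (subgroupM sK)].
- by split; [exact: (subgroupV sH)|exact: (subgroupV sK)].
Qed.

Lemma finite_indexI H K : subgroup H -> subgroup K -> finite_index H ->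
  finite_index K -> finite_index (H `&` K).
Proof.
move=> sH sK fH fK.
have coset_mem (L : set T) g h : subgroup L -> left_coset L g = left_coset L h -> L (g^-1 * h).
  move=> sL e; have : left_coset L h h by exists 1; [exact: (subgroup1 sL)|rewrite mulg1].
  by rewrite -e => -[x Lx <-]; rewrite mulKg.
apply: (@finite_index_fun _ _ (fun g => (left_coset H g, left_coset K g)) _ _
  (subgroupI sH sK) (finite_setX fH fK)).
  by move=> g; split; exists g.
by move=> g h [e1 e2]; split; apply: coset_mem.
Qed.

Lemma subgroup_conj H x : subgroup H -> subgroup [set g | H (x^-1 * g * x)].
Proof.
move=> sH; split=> [|a b /= ha hb|a /= ha] /=.
- by rewrite mulg1 mulVg; apply: (subgroup1 sH).
- have -> : x^-1 * (a * b) * x = (x^-1 * a * x) * (x^-1 * b * x).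
    by rewrite !mulgA mulgK.
  exact: (subgroupM sH).
- have -> : x^-1 * a^-1 * x = (x^-1 * a * x)^-1 by rewrite !invgM invgK mulgA.
  exact: (subgroupV sH).
Qed.

Lemma finite_index_conj H x : subgroup H -> finite_index H ->
  finite_index [set g | H (x^-1 * g * x)].
Proof.
move=> sH /(finite_indexP sH)[l lP].
apply/(finite_indexP (subgroup_conj x sH)).
exists [seq x * t * x^-1 | t <- l] => g; have [t tl ht] := lP (x^-1 * g * x).
exists (x * t * x^-1); first exact: (map_f (fun t => x * t * x^-1)).
by rewrite /= !invgM invgK !mulgA mulVg mul1g; rewrite !mulgA in ht.
Qed.

Definition core P : set T := [set g | forall x, P (x^-1 * g * x)].

Lemma core_normal P : subgroup P -> normal_subgroup (core P).
Proof.
move=> sP; split.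
  split=> [x|a b ha hb x|a ha x].
  - exact: (subgroup1 (subgroup_conj x sP)).
  - exact: (subgroupM (subgroup_conj x sP) (ha x) (hb x)).
  - exact: (subgroupV (subgroup_conj x sP) (ha x)).
by move=> x h hc y; rewrite conjgE !mulgA; have := hc (x * y); rewrite invgM !mulgA.
Qed.

Lemma core_finite_index P : subgroup P -> finite_index P -> finite_index (core P).
Proof.
move=> sP fP; have [l lP] := (finite_indexP sP).1 fP.
pose C (l : seq T) := [set g | forall t, t \in l -> P (t^-1 * g * t)].
have [sC fC] : subgroup (C l) /\ finite_index (C l).
  elim: l {lP} => [|t l [sl fl]].
    have s0 : subgroup (C [::]) by split.
    by split=> //; apply/(finite_indexP s0); exists [:: 1] => g; exists 1; rewrite ?inE.
  have -> : C (t :: l) = [set g | P (t^-1 * g * t)] `&` C l.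
    apply/seteqP; split=> g; first by move=> h; split=> [|u ul]; apply: h;
      rewrite inE ?eqxx ?ul ?orbT.
    by move=> [h1 h2] u; rewrite inE => /orP[/eqP ->|]; [|exact: h2].
  split; first by apply: subgroupI => //; apply: subgroup_conj.
  by apply: finite_indexI => //; [apply: subgroup_conj|apply: finite_index_conj].
apply: (finite_index_sub sC _ _ fC); first by case: (core_normal sP).
move=> g hg x; have [t tl ht] := lP x; pose q := t^-1 * x.
have -> : x^-1 * g * x = q^-1 * (t^-1 * g * t) * q.
  by rewrite /q invgM invgK !mulgA mulgK mulgK.
by apply: (subgroupM sP); [apply: (subgroupM sP)|] => //;
  [apply: (subgroupV sP)|apply: hg].
Qed.

Lemma finite_index_meets H R : subgroup H -> finite_index H -> subgroup R ->
  infinite_set R -> exists2 r, R r /\ H r & r <> 1.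
Proof.
move=> sH /(finite_indexP sH)[l lP] sR iR; apply: contrapT => h; apply: iR.
have /choice[f fP] : forall g, exists t, t \in l /\ H (t^-1 * g).
  by move=> g; have [t] := lP g; exists t.
apply: (finite_set_inj (finite_seq l) (f := f)) => [x _|x y Rx Ry e]; first by case: (fP x).
have Hxy : H (x^-1 * y).
  have [_ hx] := fP x; have [_ hy] := fP y; rewrite -e in hy.
  by have := subgroupM sH (subgroupV sH hx) hy; rewrite invgM invgK mulgA mulgK.
apply: contrapT => xy; apply: h; exists (x^-1 * y); first split=> //.
  by apply: (subgroupM sR) => //; apply: (subgroupV sR).
by move=> e1; apply: xy; rewrite -[RHS](mulVKg x) e1 mulg1.
Qed.

End FiniteIndexMore.

(** * Actions of rigid stabilizers and absence of characters *)

Section BranchActions.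
Variables (X : finType) (G : groupClosed (tree_aut X)).
Local Notation T := (group_of G).
Implicit Types (g h k : T) (u v w : seq X).
Hypothesis Gbranch : branch G.

Lemma words_enum n : exists l : seq (seq X), uniq l /\ forall v, v \in l <-> size v = n.
Proof.
exists [seq val t | t <- enum {: n.-tuple X}]; split.
  by rewrite map_inj_uniq ?enum_uniq //; apply: val_inj.
move=> v; split=> [/mapP[t _ ->]|sv]; first exact: size_tuple.
by apply/mapP; exists (tcast sv (in_tuple v)); [rewrite mem_enum|rewrite /= val_tcast].
Qed.

Lemma rist_normalized g v h : rist v h -> g v = v -> rist v (g * h * g^-1).
Proof. by move=> rh gv; rewrite -{1}gv; apply: rist_conj. Qed.

Section Action.
Variables (Y : Type) (act : T -> Y -> Y).
Hypothesis actP : is_left_action act.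

Lemma orb_rist_act g v y : orb act (rist (g v)) (act g y) = [set act g z | z in orb act (rist v) y].
Proof.
apply/seteqP; split=> z.
  move=> [r rr <-]; exists (act (g^-1 * r * g) y).
    exists (g^-1 * r * g) => //.
    by have := rist_conj (g := g^-1) rr; rewrite group_of_actK invgK.
  by rewrite -!(actM actP) !mulgA mulgV mul1g.
move=> [_ [r rr <-] <-]; exists (g * r * g^-1); first exact: rist_conj.
by rewrite -!(actM actP) mulgVK.
Qed.

(** If all these orbits of [y] were finite, so would be its orbit under their product, built one
    vertex at a time ([H] fixes level [n], hence normalizes each factor); finite index of
    [level_rist] would then make [Y] finite. *)
Lemma infinite_rist_orbit n y : (forall z, exists g, act g y = z) ->
  infinite_set [set: Y] -> exists v, size v = n /\ infinite_set (orb act (rist v) y).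
Proof.
move=> trans iY; apply: contrapT => h.
have fin v : size v = n -> finite_set (orb act (rist v) y).
  by move=> sv; apply: contrapT => i; apply: h; exists v.
have main (l : seq (seq X)) : (forall v, v \in l -> size v = n) ->
    exists H : set T, [/\ subgroup H, forall h v, H h -> size v = n -> h v = v,
      forall v, v \in l -> rist v `<=` H & finite_set (orb act H y)].
  elim: l => [|v l IH] sl.
    exists [set 1]; split=> //.
    - split=> [//|a b -> ->|a ->]; [exact: mulg1|exact: invg1].
    - by move=> k v -> _.
    - by apply: sub_finite_set (finite_set1 y) => z [r -> <-]; rewrite (act1 actP).
  have [|H [sH Hfix Hl Hfin]] := IH.
    by move=> u ul; apply: sl; rewrite inE ul orbT.
  have sv : size v = n by apply: sl; apply: mem_head.
  have sR : subgroup (rist v : set T) by exact: rist_subgroup.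
  exists [set a * b | a in rist v & b in H]; split.
  - split.
    + by exists 1; [exact: (subgroup1 sR)|exists 1; [exact: (subgroup1 sH)|rewrite mulg1]].
    + move=> _ _ [a ra [b hb <-]] [c rc [d hd <-]].
      exists (a * (b * c * b^-1)).
        by apply: (subgroupM sR) => //; apply: rist_normalized => //; apply: Hfix.
      by exists (b * d); [exact: (subgroupM sH)|rewrite !mulgA mulgVK].
    + move=> _ [a ra [b hb <-]]; have hb' := subgroupV sH hb.
      exists (b^-1 * a^-1 * b^-1^-1).
        by apply: rist_normalized; [exact: (subgroupV sR)|exact: Hfix].
      by exists b^-1 => //; rewrite mulgVK invgM.
  - move=> _ u [a ra [b hb <-]] su; rewrite group_of_actM (Hfix b) //.
    by apply: rist_fix ra; rewrite sv.
  - move=> u; rewrite inE => /orP[/eqP -> a ra|ul a ra].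
      by exists a => //; exists 1; [exact: (subgroup1 sH)|rewrite mulg1].
    exists 1; first exact: (subgroup1 sR).
    by exists a; [exact: (Hl u)|rewrite mul1g].
  - have ff : finite_set [set z | exists2 y', orb act H y y' & orb act (rist v) y' z].
      apply: finite_set_bigcup => // _ [b hb <-].
      have -> : orb act (rist v) (act b y) = [set act b z | z in orb act (rist v) y].
        by rewrite -orb_rist_act (Hfix b v hb sv).
      by apply: finite_image; apply: fin.
    apply: sub_finite_set ff => _ [_ [a ra [b hb <-]] <-].
    exists (act b y); first by exists b.
    by exists a; rewrite ?(actM actP).
have [l [_ lP]] := words_enum n.
have [|H [sH _ Hl Hfin]] := main l; first by move=> v /lP.
have LH : level_rist n `<=` H.
  by move=> x Lx; apply: Lx; split=> // a [v sv ra]; apply: (Hl v) => //; apply/lP.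
have [reps repsP] := (finite_indexP (generated_subgroup _)).1 (Gbranch.2 n).
apply: iY.
have ff : finite_set [set z | exists2 y', orb act H y y' & exists2 t, t \in reps & act t y' = z].
  apply: finite_set_bigcup => // y' _.
  apply: sub_finite_set (finite_image (act ^~ y') (finite_seq reps)).
  by move=> z [t tr <-]; exists t.
apply: sub_finite_set ff => z _; have [g gz] := trans z; have [t tr ht] := repsP g.
exists (act (t^-1 * g) y); first by exists (t^-1 * g) => //; apply: LH.
by exists t; rewrite // -(actM actP) mulVKg.
Qed.

End Action.

Hypothesis Ginf : infinite_set [set: T].

(** The preceding lemma for left translation of the group on itself gives an infinite rigid
    stabilizer at some vertex of the level, and conjugation moves it to [v]. *)
Lemma rist_infinite v : infinite_set (rist v : set T).
Proof.
have trP : is_left_action (fun g h : T => g * h) by split=> [y|g h y]; rewrite ?mul1g ?mulgA.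
have [|u [su iu]] := @infinite_rist_orbit T _ trP (size v) 1 _ Ginf.
  by move=> z; exists z; rewrite mulg1.
have [g gu] := level_transitive_act Gbranch su.
move=> fv; apply: iu; apply: (finite_set_inj fv (f := fun h => g * h * g^-1)).
  by move=> _ [h rh <-]; rewrite mulg1 -gu; apply: rist_conj.
by move=> x y _ _ /mulIg /mulgI.
Qed.

(** A nontrivial element of [N] in the rigid stabilizer of [v] cannot commute with an element moving
    [v]: it would also be supported below another vertex of the same level. *)
Lemma finite_index_nonabelian (N : set T) : subgroup N -> finite_index N ->
  exists x y, [/\ N x, N y & x * y <> y * x].
Proof.
move=> sN fN.
have sT : subgroup [set: T] by split.
have [g [_ Ng] g1] := finite_index_meets sN fN sT Ginf.
have [v gv] : exists v, g v <> v.
  by apply: contrapT => /forallNP h; apply: g1; apply: group_of_ext => v; apply: contrapT.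
have sR : subgroup (rist v : set T) by exact: rist_subgroup.
have [r [rr Nr] r1] := finite_index_meets sN fN sR (@rist_infinite v).
exists g, r; split=> // e; apply: r1.
have rg : rist (g v) r by have := rist_conj (g := g) rr; rewrite e mulgK.
have Kr : cone_fixer v r by apply: rist_cone_fixer rg => //; rewrite size_act.
apply: group_of_ext => x; have [/prefixP[w ->]|nv] := boolP (prefix v x).
  exact: Kr.
exact: rr.
Qed.

(** Here [a - b] is a homomorphism to the integers. The part [E] of the core of [P] killed by all
    its conjugates is normal and contains the commutators of the core, so it has finite index; a
    power of [p] then lies in [E], and the integers have no torsion. *)
Lemma just_infinite_no_character (P : set T) (a b : T -> nat) : just_infinite T ->
  subgroup P -> finite_index P ->
  (forall p q, P p -> P q -> (a (p * q)%g + b p + b q = b (p * q)%g + a p + a q)%N) ->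
  forall p, P p -> a p = b p.
Proof.
move=> JI sP fP hom.
have cancel1 (m n i j : nat) : (m + i + j = n + i + j -> m = n)%N by lia.
have cancel2 (m n : nat) : (m + n + n = n + m + m -> m = n)%N by lia.
have cancel3 (m n i j : nat) : (i + j + m = i + j + n -> n = m)%N by lia.
have cancel4 (i j k l m n u v s t : nat) : (i + m + u = j + n + v ->
  k + u + m = l + v + n -> i + s + l = j + t + k -> t = s)%N by lia.
have cancel5 (i j m n u v s t : nat) : (m + u = n + v ->
  s + i + n = t + j + m -> s + (i + u) = t + (j + v))%N by lia.
have nC := core_normal sP; have fC := core_finite_index sP fP.
have e1 : a 1 = b 1.
  have := hom 1 1 (subgroup1 sP) (subgroup1 sP); rewrite mulg1; exact: cancel2.
pose E := [set g | core P g /\ forall x, a (x^-1 * g * x) = b (x^-1 * g * x)].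
have nE : normal_subgroup E.
  split.
    split.
    - by split=> [|x]; [exact: (subgroup1 nC.1)|rewrite mulg1 mulVg].
    - move=> g h [Cg eg] [Ch eh]; split=> [|x]; first exact: (subgroupM nC.1).
      have -> : x^-1 * (g * h) * x = (x^-1 * g * x) * (x^-1 * h * x).
        by rewrite !mulgA mulgK.
      have := hom _ _ (Cg x) (Ch x); rewrite (eg x) (eh x); exact: cancel1.
    - move=> g [Cg eg]; split=> [|x]; first exact: (subgroupV nC.1).
      have Cx := Cg x; have ex := eg x; move: Cx ex.
      have -> : x^-1 * g^-1 * x = (x^-1 * g * x)^-1 by rewrite !invgM invgK mulgA.
      set q := x^-1 * g * x => Cx ex.
      have := hom _ _ Cx (subgroupV sP Cx); rewrite mulgV e1 ex; exact: cancel3.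
  move=> x h [Ch eh]; split=> [|y]; first exact: nC.2.
  by rewrite conjgE !mulgA; have := eh (x * y); rewrite invgM !mulgA.
have [x [y [Cx Cy xy]]] := finite_index_nonabelian nC.1 fC.
have idc (u v : T) : u * v * u^-1 * v^-1 * (v * u) = u * v by rewrite !mulgA !mulgVK.
have E1 : E <> [set 1].
  move=> e; apply: xy; have : E (x * y * x^-1 * y^-1).
    split.
      apply: (subgroupM nC.1); last exact: (subgroupV nC.1).
      by apply: (subgroupM nC.1); [exact: (subgroupM nC.1)|exact: (subgroupV nC.1)].
    move=> z; pose x' := z^-1 * x * z; pose y' := z^-1 * y * z.
    have -> : z^-1 * (x * y * x^-1 * y^-1) * z = x' * y' * x'^-1 * y'^-1.
      by rewrite /x' /y' !invgM !invgK !mulgA !mulgK.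
    have Px : P x' by exact: Cx.
    have Py : P y' by exact: Cy.
    have Pc : P (x' * y' * x'^-1 * y'^-1).
      apply: (subgroupM sP); last exact: (subgroupV sP).
      by apply: (subgroupM sP); [exact: (subgroupM sP)|exact: (subgroupV sP)].
    have h1 := hom _ _ Px Py; have h2 := hom _ _ Py Px.
    have := hom _ _ Pc (subgroupM sP Py Px).
    rewrite idc.
    exact: cancel4 h1 h2.
  by rewrite e => ec; rewrite -[LHS]idc (ec : _ = 1) mul1g.
have fE := JI E nE E1.
move=> p Pp; have [k k0 [Ek ek]] := finite_index_pow p nE.1 fE.
have lin i : (a (p ^+ i) + i * b p = b (p ^+ i) + i * a p)%N.
  elim: i => [|i IH]; first by rewrite expg0 e1 !mul0n.
  have := hom _ _ Pp (subgroupX i sP Pp); rewrite -expgS !mulSn; exact: cancel5 IH.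
have := ek 1; rewrite invg1 mul1g mulg1 => e2.
have := lin k; rewrite e2 => /eqP; rewrite eqn_add2l eqn_pmul2l // => /eqP.
by move=> ->.
Qed.

End BranchActions.

(** * Translates of a finite connected boundary *)

Section Translate.
Variables (T : groupType) (Y : Type) (act : T -> Y -> Y).
Hypothesis actP : is_left_action act.
Variables (S : set T) (y0 : Y).
Let S' : set T := S `|` [set x^-1 | x in S].
Let R := generated S.
Let O := orb act R y0.

Let sR : subgroup R. Proof. exact: generated_subgroup. Qed.

Let S'R s : S' s -> R s.
Proof.
move=> [Ss|[x Sx <-]]; first exact: sub_generated.
by apply: (subgroupV sR); apply: sub_generated.
Qed.

Let S'V s : S' s -> S' s^-1.
Proof. by move=> [Ss|[x Sx <-]]; [right; exists s|left; rewrite invgK]. Qed.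

Let Oact r z : R r -> O z -> O (act r z).
Proof. by move=> Rr; apply: orb_act. Qed.

Let Oy0 : O y0. Proof. exact: orb_refl. Qed.

Lemma edge_invariant (V : Y -> Prop) :
  (forall z s, O z -> S' s -> V z -> V (act s z)) ->
  forall z z', O z -> O z' -> V z -> V z'.
Proof.
move=> hV z z' Oz Oz' Vz.
have [r Rr <-] : orb act R z z' by rewrite -(orb_eq actP sR Oz).
pose Q : set T := [set r | R r /\ forall z, O z ->
  (V z -> V (act r z)) /\ (V z -> V (act r^-1 z))].
suff [_ h] : Q r by case: (h z Oz) => + _; apply.
apply: (Rr Q); split.
  split.
  - split; first exact: (subgroup1 sR).
    by move=> u _; rewrite invg1 (act1 actP).
  - move=> g h [Rg hg] [Rh hh]; split; first exact: (subgroupM sR).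
    move=> u Ou; rewrite invgM !(actM actP); split=> Vu.
      by apply: (hg _ (Oact Rh Ou)).1; apply: (hh _ Ou).1.
    by apply: (hh _ (Oact (subgroupV sR Rg) Ou)).2; apply: (hg _ Ou).2.
  - move=> g [Rg hg]; split; first exact: (subgroupV sR).
    by move=> u Ou; rewrite invgK; case: (hg u Ou).
move=> s Ss; split; first exact: sub_generated.
by move=> u Ou; split; apply: hV => //; [left|right; exists s].
Qed.

(** Connectedness of the graph induced on [D] by the generators and their inverses, phrased with
    invariant sets as in [linked]. *)
Definition edge_connected (D : set Y) : Prop := forall V : Y -> Prop,
  (forall z s, D z -> S' s -> D (act s z) -> V z -> V (act s z)) ->
  forall z z', D z -> D z' -> V z -> V z'.

Lemma edge_connectedU (D E : set Y) z : edge_connected D -> edge_connected E ->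
  D z -> E z -> edge_connected (D `|` E).
Proof.
move=> cD cE Dz Ez V hV a b hab hb Va.
have Vz : V z.
  case: hab => ha.
    by apply: (cD V) ha Dz Va => u s Du Ss Dsu; apply: hV => //; left.
  by apply: (cE V) ha Ez Va => u s Du Ss Dsu; apply: hV => //; right.
case: hb => hb.
  by apply: (cD V) Dz hb Vz => u s Du Ss Dsu; apply: hV => //; left.
by apply: (cE V) Ez hb Vz => u s Du Ss Dsu; apply: hV => //; right.
Qed.

Let hull z z' := exists D, [/\ finite_set D, D `<=` O, edge_connected D, D z & D z'].

Let hull_trans z1 z2 z3 : hull z1 z2 -> hull z2 z3 -> hull z1 z3.
Proof.
move=> [D [f1 s1 c1 a1 b1]] [E [f2 s2 c2 a2 b2]]; exists (D `|` E); split.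
- by rewrite finite_setU.
- by move=> u [/s1|/s2].
- exact: edge_connectedU b1 a2.
- by left.
- by right.
Qed.

Let hull_all z : O z -> hull y0 z.
Proof.
move=> Oz; apply: (edge_invariant (V := hull y0)) Oy0 Oz _.
  move=> u s Ou Ss; move/hull_trans; apply.
  exists [set u; act s u]; split.
  - exact: finite_set2.
  - by move=> _ [->|->] //; apply: Oact => //; apply: S'R.
  - move=> V hV a b.
    have V1 : V u -> V (act s u) by apply: hV => //; [left|right].
    have V2 : V (act s u) -> V u.
      have := hV (act s u) s^-1; rewrite (actK actP); apply; [by right|exact: S'V|by left].
    by move=> [->|->] [->|->].
  - by left.
  - by right.
exists [set y0]; split=> //.
- by move=> _ ->.
- by move=> V _ a b -> ->.
Qed.

Lemma connected_hull (F : set Y) : finite_set F -> F `<=` O ->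
  exists D, [/\ finite_set D, D `<=` O, edge_connected D & F `<=` D].
Proof.
move=> /(@finite_set_seq {classic Y})[l lP] FO.
suff [D [fD DO cD Dy0 lD]] : exists D, [/\ finite_set D, D `<=` O, edge_connected D,
    D y0 & forall z, z \in l -> D z].
  by exists D; split=> // z /lP; apply: lD.
have lO z : z \in l -> O z by move=> /lP /FO.
elim: l {lP} lO => [|z l IH] lO.
  have [D [fD DO cD Dy _]] := hull_all Oy0.
  by exists D.
have [|D [fD DO cD Dy lD]] := IH; first by move=> u ul; apply: lO; rewrite inE ul orbT.
have [E [fE EO cE Ey Ez]] := hull_all (lO z (mem_head _ _)).
exists (D `|` E); split.
- by rewrite finite_setU.
- by move=> u [/DO|/EO].
- exact: edge_connectedU Dy Ey.
- by left.
- by move=> u; rewrite inE => /orP[/eqP ->|/lD]; [right|left].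
Qed.

Section Nested.
Variables (A D : set Y) (c : T).
Hypotheses (hA : almost_inv act A).
Hypotheses (iA : infinite_set (O `&` A)) (iAc : infinite_set (O `\` A)).
Hypotheses (DO : D `<=` O) (cD : edge_connected D).
Hypothesis bdD : forall z s, O z -> S' s -> A z -> ~ A (act s z) -> D z /\ D (act s z).
Hypothesis comc : forall s, S' s -> c * s = s * c.
Hypothesis cO : forall z, O z -> O (act c z) /\ O (act c^-1 z).
Hypothesis disj : forall z, D z -> ~ D (act c z).
(** The vanishing of [gain - loss] in the form used: if nothing is gained, nothing is lost. *)
Hypothesis gainless : (forall z, O z -> ~ A z -> ~ A (act c^-1 z)) ->
  forall z, O z -> A z -> A (act c^-1 z).

Let comV s : S' s -> c^-1 * s = s * c^-1.
Proof.
by move=> /comc e; apply: (mulgI c); rewrite mulVKg mulgA e mulgK.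
Qed.

Let act_comV s z : S' s -> act c^-1 (act s z) = act s (act c^-1 z).
Proof. by move=> Ss; rewrite -!(actM actP) comV. Qed.

(* The translate [c D] lies in [A]; then [A] and [c A] are nested or cover the
   orbit, according to the side of [c A] on which [D] lies. *)
Lemma no_nested_translate : (forall z, D z -> A (act c z)) -> False.
Proof.
move=> cDA.
have bdD' z s : O z -> S' s -> ~ A z -> A (act s z) -> D z.
  move=> Oz Ss nA As; have := bdD (Oact (S'R Ss) Oz) (S'V Ss) As.
  by rewrite (actK actP) => /(_ nA)[].
have notall : forall V : Y -> Prop,
    (forall z s, O z -> S' s -> V z -> V (act s z)) ->
    (exists2 z, O z & ~ V z) -> forall z, O z -> ~ V z.
  by move=> V hV [z Oz nV] z' Oz' Vz'; apply: nV; apply: edge_invariant hV _ _ Oz' Oz Vz'.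
have [za [Oza Aza]] := infinite_setN0 iA.
have [zc [Ozc nAzc]] := infinite_setN0 iAc.
have [d [Dd Ad]] : exists d, D d /\ A d.
  apply: contrapT => h; apply: nAzc.
  apply: (edge_invariant (V := A)) Oza Ozc Aza => z s Oz Ss Az.
  by apply: contrapT => nA; apply: h; exists z; split=> //; case: (bdD Oz Ss Az nA).
have constc z z' : D z -> D z' -> A (act c^-1 z) -> A (act c^-1 z').
  move=> Dz Dz' Az. refine (@cD (fun z => A (act c^-1 z)) _ z z' Dz Dz' Az).
  move=> u s Du Ss Dsu Au; apply: contrapT => nA.
  have [_ Oc] := cO (DO Du).
  rewrite act_comV // in nA.
  have [Dc _] := bdD Oc Ss Au nA; apply: (disj Dc); by rewrite (actVK actP).
(* Here [A] and [c A] cover the orbit, so every point outside [A] is moved into [A] by [c^-1];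
   almost invariance makes the complement finite. *)
case: (pselect (A (act c^-1 d))) => Acd.
  have DcA z : D z -> A (act c^-1 z) by move=> Dz; apply: constc Dd Dz Acd.
  have empty : forall z, O z -> ~ (~ A z /\ ~ A (act c^-1 z)).
    apply: notall; last by exists za => // -[].
    move=> z s Oz Ss [nA nAc]; have [_ Ocz] := cO Oz; split=> As.
      by apply: nAc; apply: DcA; apply: bdD' As.
    rewrite act_comV // in As.
    by have := cDA _ (bdD' _ _ Ocz Ss nAc As); rewrite (actVK actP).
  apply: iAc; apply: (sub_finite_set _ (almost_invC actP hA c^-1)) => z [Oz nA].
  by split=> // nAc; apply: (empty z Oz).
(* Here [c A] is contained in [A], and [d] witnesses that the inclusion is proper, against
   [gainless]. *)
have DncA z : D z -> ~ A (act c^-1 z) by move=> Dz Az; apply: Acd; apply: constc Dz Dd Az.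
have empty : forall z, O z -> ~ (~ A z /\ A (act c^-1 z)).
  apply: notall; last by exists za => // -[].
  move=> z s Oz Ss [nA Ac]; have [_ Ocz] := cO Oz; split=> [As|].
    by apply: (DncA z) Ac; apply: bdD' As.
  rewrite act_comV //; apply: contrapT => nAs.
  have [Dc _] := bdD Ocz Ss Ac nAs.
  by have := cDA _ Dc; rewrite (actVK actP).
apply: Acd; apply: gainless (DO Dd) Ad => z Oz nA Ac; exact: (empty z).
Qed.

End Nested.

(** If [D] and [c D] were disjoint, no color change would occur along [c D], which is connected
    since [c] commutes with the generators; so [c D] lies on one side of [A], and the two sides are
    exchanged by complementation. *)
Lemma no_disjoint_translate (A D : set Y) (c : T) : almost_inv act A ->
  infinite_set (O `&` A) -> infinite_set (O `\` A) -> D `<=` O -> edge_connected D ->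
  (forall z s, O z -> S' s -> A z -> ~ A (act s z) -> D z /\ D (act s z)) ->
  (forall s, S' s -> c * s = s * c) ->
  (forall z, O z -> O (act c z) /\ O (act c^-1 z)) ->
  ((forall z, O z -> ~ A z -> ~ A (act c^-1 z)) -> forall z, O z -> A z -> A (act c^-1 z)) ->
  ((forall z, O z -> A z -> A (act c^-1 z)) -> forall z, O z -> ~ A z -> ~ A (act c^-1 z)) ->
  exists2 z, D z & D (act c z).
Proof.
move=> hA iA iAc DO cD bdD comc cO g1 g2; apply: contrapT => h.
have disj z : D z -> ~ D (act c z) by move=> Dz Dc; apply: h; exists z.
have bdD' z s : O z -> S' s -> ~ A z -> A (act s z) -> D z /\ D (act s z).
  move=> Oz Ss nA As; have := bdD (act s z) s^-1 (Oact (S'R Ss) Oz) (S'V Ss) As.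
  by rewrite (actK actP) => /(_ nA)[].
have const (B : set Y) : (forall z s, O z -> S' s -> B z -> ~ B (act s z) -> D z) ->
    forall z z', D z -> D z' -> B (act c z) -> B (act c z').
  move=> bd z z' Dz Dz' Bz; apply: (cD (fun z => B (act c z)) _ z z' Dz Dz' Bz) => u s Du Ss Dsu Bu; apply: contrapT => nB.
  have [Oc _] := cO u (DO u Du).
  have e : act c (act s u) = act s (act c u) by rewrite -!(actM actP) comc.
  by rewrite e in nB; apply: (disj u Du); apply: bd Oc Ss Bu nB.
case: (pselect (exists2 d, D d & A (act c d))) => [[d Dd Ad]|nd].
  apply: (no_nested_translate hA iA iAc DO cD bdD comc cO disj g1) => z Dz.
  by apply: (const A) Dd Dz Ad => u s Ou Ss Au nA; case: (bdD u s Ou Ss Au nA).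
apply: (@no_nested_translate (~` A) D c _ _ _ DO cD _ comc cO disj).
- exact: almost_invC.
- exact: iAc.
- by move=> f; apply: iA; apply: sub_finite_set f => z [Oz Az]; split=> // /(_ Az).
- by move=> z s Oz Ss nA /contrapT; apply: bdD'.
- move=> h' z Oz nA; apply: g2 => // u Ou Au.
  by apply: contrapT => nAc; apply: (h' u Ou _ nAc) => /(_ Au).
- by move=> z Dz Az; apply: nd; exists z.
Qed.

End Translate.

(** * Cut orbits of rigid stabilizers *)

Section RistOrbits.
Variables (X : finType) (G : groupClosed (tree_aut X)).
Local Notation T := (group_of G).
Implicit Types (g h k r : T) (u v w : seq X).
Hypotheses (Gbranch : branch G) (Gfg : finitely_generated T).

Lemma agree_subgroup v (R : set T) : subgroup R -> R `<=` rist v ->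
  subgroup [set g : T | exists2 r : T, R r & forall w, r (v ++ w) = g (v ++ w)].
Proof.
move=> sR Rv.
have pre r w : R r -> exists w', r (v ++ w) = v ++ w'.
  move=> /Rv rr; have := rist_fix (erefl (size v)) rr.
  have : prefix (r v) (r (v ++ w)) by rewrite prefix_act prefix_prefix.
  by move=> /[swap] -> /prefixP[w' ->]; exists w'.
split.
- by exists 1; [exact: (subgroup1 sR)|].
- move=> g h [a Ra ea] [b Rb eb]; exists (a * b); first exact: (subgroupM sR).
  move=> w; rewrite !group_of_actM -eb; have [w' ->] := pre b w Rb; exact: ea.
- move=> g [a Ra ea]; exists a^-1; first exact: (subgroupV sR).
  move=> w; have [w' e] := pre a^-1 w (subgroupV sR Ra).
  have : a (v ++ w') = v ++ w by rewrite -e group_of_actVK.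
  by rewrite ea e => <-; rewrite group_of_actK.
Qed.

Lemma rist_agree v r r' : rist v r -> rist v r' -> (forall w, r (v ++ w) = r' (v ++ w)) -> r = r'.
Proof.
move=> rr rr' e; apply: group_of_ext => x.
have [/prefixP[w ->]|nv] := boolP (prefix v x); first exact: e.
by rewrite rr // rr'.
Qed.

(** Every element of the finitely generated group [level_rist] agrees below [v] with an element of
    the rigid stabilizer; the elements so attached to its generators generate. *)
Lemma rist_fg v : exists2 S : set T, finite_set S & generated S = rist v.
Proof.
have sR : subgroup (rist v : set T) by exact: rist_subgroup.
have [E fE genE] := finite_index_fg Gfg (generated_subgroup _) (Gbranch.2 (size v)).
have ex g : level_rist (size v) g -> exists2 r : T, rist v r & forall w, r (v ++ w) = g (v ++ w).
  apply: (@generated_ind _ _ (fun g : T => exists2 r : T, rist v r & forall w, r (v ++ w) = g (v ++ w))).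
    exact: (agree_subgroup sR).
  move=> a [u su ra]; case: (eqVneq u v) => [<-|/eqP uv]; first by exists a.
  exists 1; first exact: (subgroup1 sR).
  by move=> w; rewrite (rist_cone_fixer su uv ra).
have /choice[p pP] : forall g, exists r : T, level_rist (size v) g ->
    rist v r /\ forall w, r (v ++ w) = g (v ++ w).
  move=> g; case: (pselect (level_rist (size v) g)) => [/ex[r h1 h2]|n].
    by exists r.
  by exists 1.
have El g : E g -> level_rist (size v) g by move=> Eg; rewrite /level_rist -genE; apply: sub_generated.
pose S := [set p g | g in E].
have Sv : generated S `<=` rist v.
  by move=> r gr; apply: gr; split=> // _ [g /El/pP[? _] <-].
exists S; first exact: finite_image.
apply/seteqP; split=> // r rr.
have : generated E r by rewrite genE; apply: sub_generated; exists v.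
have sQ := agree_subgroup (generated_subgroup S) Sv.
move=> /(_ _ (conj sQ _))[|r' gr' e].
  move=> g Eg; exists (p g); last by case: (pP g (El g Eg)).
  by apply: sub_generated; exists g.
by rewrite -(rist_agree (Sv _ gr') rr e).
Qed.

Variables (Y : Type) (act : T -> Y -> Y) (A : set Y).
Hypothesis actP : is_left_action act.
Hypothesis hA : almost_inv act A.
Local Notation cut v y := (cut_orbit act A (rist v) y).

Lemma cut_act g v y : cut v y -> cut (g v) (act g y).
Proof.
have fin (B : set Y) : almost_inv act B -> infinite_set (orb act (rist v) y `&` B) ->
    infinite_set (orb act (rist (g v)) (act g y) `&` B).
  move=> hB i f; apply: i.
  have f2 : finite_set [set z | orb act (rist v) y z /\ B (act g z)].
    apply: (finite_set_inj f (f := act g)) => [z [oz Bz]|a b _ _ /(act_inj actP)//].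
    by rewrite (orb_rist_act actP); split=> //; exists z.
  have : finite_set ([set z | B z /\ ~ B (act g z)] `|`
      [set z | orb act (rist v) y z /\ B (act g z)]).
    by rewrite finite_setU; split=> //; apply: hB.
  apply: sub_finite_set => z [oz Bz].
  by case: (pselect (B (act g z))) => h; [right|left].
move=> [i1 i2]; split; first exact: fin.
exact: (fin (~` A) (almost_invC actP hA) i2).
Qed.

Lemma cut_orb v y z : orb act (rist v) y z -> cut v y -> cut v z.
Proof.
move=> yz; have sR : subgroup (rist v : set T) by exact: rist_subgroup.
by rewrite /cut_orbit (orb_eq actP sR yz).
Qed.

Lemma cut_orbits_finite v : exists2 F : set Y, finite_set F &
  forall y, cut v y -> exists2 z, F z & orb act (rist v) y z.
Proof.
have [S fS genS] := rist_fg v.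
have [F fF FP] := mixed_orbits actP fS hA; rewrite genS in FP.
exists F => // y [i1 i2].
have [_ [[r rr <-] Ar]] := infinite_setN0 i1; have [_ [[r' rr' <-] nA]] := infinite_setN0 i2.
exact: (FP y r r').
Qed.

Definition orbit_stabilizer v y : set T := [set g : T | g v = v /\
  forall z, orb act (rist v) y z <-> orb act (rist v) y (act g z)].

Lemma orbit_stabilizer_subgroup v y : subgroup (orbit_stabilizer v y).
Proof.
split=> [|g h [g1 g2] [h1 h2]|g [g1 g2]].
- by split=> // z; rewrite (act1 actP).
- split; first by rewrite group_of_actM h1.
  by move=> z; rewrite (actM actP) h2.
- split; first by rewrite -{1}g1 group_of_actK.
  by move=> z; rewrite -[z in X in X <-> _](actVK actP g) -g2.
Qed.

(** The group carries a cut orbit to cut orbits over vertices of the same level, of which there are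
    finitely many. *)
Lemma orbit_stabilizer_finite_index v y : cut v y -> finite_index (orbit_stabilizer v y).
Proof.
move=> cy; have /choice[F FP] : forall u, exists F : set Y, finite_set F /\
    forall y, cut u y -> exists2 z, F z & orb act (rist u) y z.
  by move=> u; have [F] := cut_orbits_finite u; exists F.
have [l [_ lP]] := words_enum X (size v).
have fB : finite_set [set uO : seq X * set Y | exists2 u, u \in l &
    exists2 z, F u z & uO = (u, orb act (rist u) z)].
  apply: finite_set_bigcup_seq => u _.
  apply: sub_finite_set (finite_image (fun z => (u, orb act (rist u) z)) (FP u).1).
  by move=> _ [z Fz ->]; exists z.
apply: (finite_index_fun (f := fun g : T => (g v, [set act g z | z in orb act (rist v) y]))
  (orbit_stabilizer_subgroup v y) fB).
  move=> g; exists (g v); first by apply/lP; rewrite size_act.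
  have [z Fz oz] := (FP (g v)).2 _ (cut_act g cy); exists z => //; congr pair.
  have sR : subgroup (rist (g v) : set T) by exact: rist_subgroup.
  by rewrite -(orb_eq actP sR oz) (orb_rist_act actP).
move=> g h [e1 e2]; split; first by rewrite group_of_actM -e1 group_of_actK.
move=> z; rewrite (actM actP); split=> oz.
  have : [set act h z | z in orb act (rist v) y] (act h z) by exists z.
  by rewrite -e2 => -[z' oz' <-]; rewrite (actK actP).
have : [set act g z | z in orb act (rist v) y] (act h z).
  by exists (act g^-1 (act h z)) => //; rewrite (actVK actP).
by rewrite e2 => -[z' oz' /(act_inj actP) <-].
Qed.

Hypothesis JI : just_infinite T.
Hypothesis Ginf : infinite_set [set: T].

(** The character [gain - loss] of the part of [A] in the orbit vanishes; the two implications are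
    the last two hypotheses of [no_disjoint_translate]. *)
Lemma cut_gain_loss v y p : cut v y -> orbit_stabilizer v y p ->
  ((forall z, orb act (rist v) y z -> ~ A z -> ~ A (act p z)) ->
    forall z, orb act (rist v) y z -> A z -> A (act p z)) /\
  ((forall z, orb act (rist v) y z -> A z -> A (act p z)) ->
    forall z, orb act (rist v) y z -> ~ A z -> ~ A (act p z)).
Proof.
move=> cy Pp; pose O := orb act (rist v) y; pose B := O `&` A.
pose P := orbit_stabilizer v y.
have sP : subgroup P by exact: orbit_stabilizer_subgroup.
have fB q : P q -> finite_set [set z | B z /\ ~ B (act q z)].
  move=> [_ Oq]; apply: sub_finite_set (hA q) => z [[Oz Az] nB]; split=> // Aq.
  by apply: nB; split; [exact: ((Oq z).1 Oz)|].
have e : gain act B p = loss act B p.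
  apply: (just_infinite_no_character Gbranch Ginf JI sP) Pp.
    exact: orbit_stabilizer_finite_index.
  by move=> q q' Pq Pq'; apply: (gain_loss_mul actP sP fB).
have [_ Op] := Pp.
split=> h z Oz Az.
  have l0 : loss act B p = 0.
    rewrite -e /gain; apply: setcard0 => u [nB [Opu Au]]; have Ou := (Op u).2 Opu.
    by apply: (h u Ou _ Au) => Au'; apply: nB.
  apply: contrapT => nA; apply: (setcard_eq0 (fB p Pp) l0 (x := z)); split=> //.
  by move=> [].
have g0 : gain act B p = 0.
  rewrite e /loss; apply: setcard0 => u [[Ou Au] nB]; apply: nB.
  by split; [exact: ((Op u).1 Ou)|exact: h].
move=> Ap; apply: (setcard_eq0 (gain_finite actP sP fB Pp) g0 (x := z)); split.
  by move=> [].
by split; [exact: ((Op z).1 Oz)|].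
Qed.

(** Up to finite index the elements [c] preserve the cut orbit [O]. They commute with the rigid
    stabilizer, which is transitive on [O], so [c] is determined on [O] by one value; and
    [no_disjoint_translate] makes [c] map some point of the finite set [D] into [D]. Hence [y] has
    at most as many images as there are pairs in [D]. *)
Lemma cone_fixer_orbit_finite v y : cut v y -> finite_set (orb act (cone_fixer v) y).
Proof.
move=> cy; have [i1 i2] := cy.
have sK : subgroup (cone_fixer v : set T) by exact: cone_fixer_subgroup.
have sR : subgroup (rist v : set T) by exact: rist_subgroup.
pose P := orbit_stabilizer v y.
have sP : subgroup P by exact: orbit_stabilizer_subgroup.
have fP := orbit_stabilizer_finite_index cy.
pose C : set T := cone_fixer v `&` P.
suff fC : finite_set (orb act C y).
  have [l lP] := (finite_indexP sP).1 fP.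
  have /choice[k kP] : forall t, exists k : T, (exists2 k, cone_fixer v k & P (t^-1 * k)) ->
      cone_fixer v k /\ P (t^-1 * k).
    move=> t; case: (pselect (exists2 k, cone_fixer v k & P (t^-1 * k))) => [[k k1 k2]|n].
      by exists k.
    by exists 1.
  have ff : finite_set [set z | exists2 t, t \in l & [set act (k t) x | x in orb act C y] z].
    by apply: finite_set_bigcup_seq => t _; apply: finite_image.
  apply: sub_finite_set ff => _ [g Kg <-]; have [t tl Pt] := lP g.
  have [k1 k2] := kP t (ex_intro2 _ _ g Kg Pt).
  exists t => //; exists (act ((k t)^-1 * g) y); last by rewrite -(actM actP) mulVKg.
  exists ((k t)^-1 * g) => //; split.
    by apply: (subgroupM sK) => //; apply: (subgroupV sK).
  have -> : (k t)^-1 * g = (t^-1 * k t)^-1 * (t^-1 * g) by rewrite invgM invgK mulgA mulgK.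
  by apply: (subgroupM sP) => //; apply: (subgroupV sP).
have [S fS genS] := rist_fg v.
pose S' : set T := S `|` [set x^-1 | x in S].
have fS' : finite_set S' by rewrite finite_setU; split=> //; apply: finite_image.
pose O := orb act (generated S) y.
have OE : O = orb act (rist v) y by rewrite /O genS.
have S'R s : S' s -> rist v s.
  rewrite -genS; move=> [Ss|[x Sx <-]]; first exact: sub_generated.
  by apply: (subgroupV (generated_subgroup S)); apply: sub_generated.
pose F := [set z | O z /\ exists2 s, S' s & (A z /\ ~ A (act s z)) \/
   (A (act s^-1 z) /\ ~ A (act s (act s^-1 z)))].
have fF : finite_set F.
  have : finite_set [set z | exists2 s, S' s & ([set z | A z /\ ~ A (act s z)] `|`
     [set z | A (act s^-1 z) /\ ~ A (act s (act s^-1 z))]) z].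
    apply: finite_set_bigcup => // s _; rewrite finite_setU; split; first exact: hA.
    by apply: (finite_set_inj (hA s) (f := act s^-1)) => // a b _ _ /(act_inj actP).
  by apply: sub_finite_set => z [_ h].
have FO : F `<=` O by move=> z [].
have [D [fD DO cD FD]] := connected_hull actP fF FO.
have bdD z s : O z -> S' s -> A z -> ~ A (act s z) -> D z /\ D (act s z).
  move=> Oz Ss Az nA; split; apply: FD.
    by split=> //; exists s => //; left.
  split; last by exists s => //; right; rewrite (actK actP).
  by rewrite OE in Oz *; apply: orb_act => //; apply: S'R.
have free c c' d : C c -> C c' -> O d -> act c d = act c' d -> act c y = act c' y.
  rewrite OE => -[Kc _] [Kc' _] [r rr <-].
  rewrite -!(actM actP) (cone_fixer_rist_commute Kc rr) (cone_fixer_rist_commute Kc' rr).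
  by rewrite !(actM actP) => /(act_inj actP).
apply: contrapT => iC; apply: iC.
have /choice[f fP'] : forall z, exists dd : Y * Y, orb act C y z ->
    exists c, [/\ C c, act c y = z, D dd.1, D dd.2 & act c dd.1 = dd.2].
  move=> z; case: (pselect (orb act C y z)) => [[c Cc ecz]|n]; last by exists (y, y).
  have [Kc Pc] := Cc.
  have PcV : P c^-1 by exact: (subgroupV sP).
  have [g1 g2] := cut_gain_loss cy PcV; rewrite -OE in g1 g2 i1 i2.
  have comc s : S' s -> c * s = s * c by move=> /S'R; apply: cone_fixer_rist_commute.
  have cO (u : Y) : O u -> O (act c u) /\ O (act c^-1 u).
    by rewrite OE => Ou; split; [exact: ((Pc.2 u).1 Ou)|exact: ((PcV.2 u).1 Ou)].
  have [d Dd Dcd] := no_disjoint_translate actP hA i1 i2 DO cD bdD comc cO g1 g2.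
  by exists (d, act c d) => _; exists c.
apply: (finite_set_inj (finite_setX fD fD) (f := f)).
  by move=> z /fP'[c [_ _ ? ? _]].
move=> z z' /fP'[c [Cc <- D1 _ e1]] /fP'[c' [Cc' <- _ _ e2]] e.
by apply: (free c c' (f (act c y)).1) => //; [exact: DO|rewrite e1 e e2].
Qed.

End RistOrbits.

(** * From a commensurated set to colorings of tiles *)

Section CommensuratedTileCuts.
Variables (X : finType) (G : groupClosed (tree_aut X)).
Local Notation T := (group_of G).
Implicit Types (g h k r s : T) (u v w : seq X).
Hypotheses (Gself : self_similar G) (Gcontr : contracting G).
Hypotheses (Gbranch : branch G) (Gfg : finitely_generated T).
Hypotheses (Grepl : self_replicating G) (JI : just_infinite T).
Variable x0 : X.
Local Notation sec := (sec Gself).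
Local Notation tact := (tact Gself).
Local Notation nuc := (@nuc X G).
Local Notation pw := (@pw X G).

Variables (Y : Type) (act : T -> Y -> Y) (A : set Y).
Hypotheses (actP : is_left_action act) (trans : forall y z, exists g, act g y = z).
Hypotheses (hA : almost_inv act A).
Hypotheses (iA : infinite_set A) (iAc : infinite_set (~` A)).
Local Notation cut v y := (cut_orbit act A (rist v) y).

Let Yinf : infinite_set [set: Y].
Proof. by move=> f; apply: iA; apply: sub_finite_set f. Qed.

Let Ginf : infinite_set [set: T].
Proof.
have [y0 _] := infinite_setN0 iA.
move=> f; apply: Yinf; apply: sub_finite_set (finite_image (fun g => act g y0) f).
by move=> z _; have [g <-] := trans y0 z; exists g.
Qed.

Let sR v : subgroup (rist v : set T). Proof. exact: rist_subgroup. Qed.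
Let sK v : subgroup (cone_fixer v : set T). Proof. exact: cone_fixer_subgroup. Qed.

(** Otherwise the points with an infinite rigid-stabilizer orbit almost contained in [A] form an
    invariant set differing finitely from [A]; by transitivity it is empty or everything, and [A] is
    neither finite nor cofinite. *)
Lemma cut_exists n : exists v y, size v = n /\ cut v y.
Proof.
apply: contrapT => nc.
have nocut v y : size v = n -> ~ cut v y by move=> sv cy; apply: nc; exists v, y.
pose B := [set y | exists v, [/\ size v = n, infinite_set (orb act (rist v) y) &
   finite_set (orb act (rist v) y `\` A)]].
have Bact g y : B y -> B (act g y).
  move=> [v [sv iv fv]]; exists (g v); split; first by rewrite size_act.
    move=> f; apply: iv; apply: (finite_set_inj f (f := act g)).
      by move=> z oz; rewrite (orb_rist_act actP); exists z.
    by move=> a b _ _; apply: act_inj.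
  have : finite_set ([set act g z | z in orb act (rist v) y `\` A] `|`
      [set act g z | z in [set z | A z /\ ~ A (act g z)]]).
    by rewrite finite_setU; split; apply: finite_image.
  apply: sub_finite_set => z' [+ nA]; rewrite (orb_rist_act actP) => -[z oz ez].
  rewrite -ez in nA *; case: (pselect (A z)) => Az; last by left; exists z.
  by right; exists z.
have [l [_ lP]] := words_enum X n.
have f1 : finite_set [set y | A y /\ ~ B y].
  have : finite_set [set y | exists2 v, v \in l & [/\ ~ cut v y, A y &
     infinite_set (orb act (rist v) y `\` A)]].
    apply: finite_set_bigcup_seq => v _; have [S fS genS] := rist_fg Gbranch Gfg v.
    by rewrite -genS; apply: uncut_in.
  apply: sub_finite_set => y [Ay nB].
  have [v [sv iv]] := infinite_rist_orbit Gbranch actP n (trans y) Yinf.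
  exists v; first exact/lP.
  by split=> //; [exact: nocut|move=> f; apply: nB; exists v].
have f2 : finite_set [set y | ~ A y /\ B y].
  have : finite_set [set y | exists2 v, v \in l & [/\ ~ A y,
     finite_set (orb act (rist v) y `\` A) & (orb act (rist v) y `&` A) !=set0]].
    apply: finite_set_bigcup_seq => v _; have [S fS genS] := rist_fg Gbranch Gfg v.
    by rewrite -genS; apply: uncut_out.
  apply: sub_finite_set => y [nA [v [sv iv fv]]]; exists v; first exact/lP.
  split=> //; apply: infinite_setN0 => f; apply: iv.
  have : finite_set ((orb act (rist v) y `\` A) `|` (orb act (rist v) y `&` A)).
    by rewrite finite_setU.
  by apply: sub_finite_set => z oz; case: (pselect (A z)) => Az; [right|left].
case: (pselect (exists y, B y)) => [[y By]|nB].
  apply: iAc; apply: sub_finite_set f2 => z nA; split=> //.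
  by have [g <-] := trans y z; apply: Bact.
by apply: iA; apply: sub_finite_set f1 => y Ay; split=> // By; apply: nB; exists y.
Qed.

(** The length of this list, fixed before the level, is the uniform bound of [tile_cuts]. *)
Let lA_ex : exists lA : seq {classic Y}, forall y s, nuc s -> A y -> ~ A (act s y) -> y \in lA.
Proof.
have : finite_set [set y | exists2 s, nuc s & (A y /\ ~ A (act s y))].
  by apply: finite_set_bigcup (nuc_fin Gself Gcontr) _ => s _; apply: hA.
move=> /(@finite_set_seq {classic Y})[l lP]; exists l => y s ns Ay nA.
by apply/lP; exists s.
Qed.

Let lA := projT1 (cid lA_ex).
Let lAP : forall y s, nuc s -> A y -> ~ A (act s y) -> y \in lA.
Proof. exact: projT2 (cid lA_ex). Qed.

Section Level.
Variable n : nat.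

Let vert_ex y : exists v, size v = n /\ cut v y.
Proof.
have [v [z [sv cz]]] := cut_exists n; have [g <-] := trans z y.
by exists (g v); rewrite size_act; split=> //; apply: cut_act.
Qed.

Let vert y := projT1 (cid (vert_ex y)).
Let size_vert y : size (vert y) = n. Proof. by case: (projT2 (cid (vert_ex y))). Qed.
Let cut_vert y : cut (vert y) y. Proof. by case: (projT2 (cid (vert_ex y))). Qed.

(** Over a different vertex of the level, the rigid stabilizer of [vert y] acts trivially below [v],
    so its orbit of [y] would be finite and not cut. *)
Let vert_unique v y : size v = n -> cut v y -> vert y = v.
Proof.
move=> sv cv; apply: contrapT => ne; have [i _] := cut_vert y.
apply: i; apply: (sub_finite_set _ (cone_fixer_orbit_finite Gbranch Gfg actP hA JI Ginf cv)).
move=> z [[r rr <-] _]; exists r => //.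
by apply: rist_cone_fixer rr => //; rewrite size_vert.
Qed.

Let vert_act g y : vert (act g y) = g (vert y).
Proof. by apply: vert_unique; [rewrite size_act size_vert|apply: cut_act]. Qed.

Let K y : set T := cone_fixer (vert y).

Let Kfin y : finite_set (orb act (K y) y).
Proof. exact: (cone_fixer_orbit_finite Gbranch Gfg actP hA JI Ginf (cut_vert y)). Qed.

Let vert_K y k : K y k -> vert (act k y) = vert y.
Proof. by move=> Kk; rewrite vert_act; apply: cone_fixer_fix. Qed.

Let K_K y k : K y k -> K (act k y) = K y.
Proof. by move=> Kk; rewrite /K vert_K. Qed.

Let K_conj g y k : K y k -> K (act g y) (g * k * g^-1).
Proof. by move=> Kk; rewrite /K vert_act; apply: cone_fixer_conj. Qed.

(** The sets that descend to the quotient of [Y] by the finite [K]-orbits, hence to the level-[n]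
    tiles. *)
Let saturated (V : set Y) := forall y k, K y k -> V y -> V (act k y).

Let saturatedC V : saturated V -> saturated (~` V).
Proof.
move=> sV y k Kk nV Vk; apply: nV; rewrite -(actK actP k y).
by apply: sV Vk; rewrite K_K //; apply: (subgroupV (sK _)).
Qed.

(** The largest saturated subset of [A]. *)
Let At : set Y := [set y | forall k, K y k -> A (act k y)].

Let At_sat : saturated At.
Proof.
move=> y k Kk Ay k'; rewrite K_K // => Kk'; rewrite -(actM actP).
by apply: Ay; apply: (subgroupM (sK _)).
Qed.

Let At_sub : At `<=` A.
Proof. by move=> y /(_ 1 (subgroup1 (sK _))); rewrite (act1 actP). Qed.

(** On each of the finitely many cut orbits an element of [K] acts as determined by its value at a
    base point [z], which has finitely many images; so finitely many elements [kk] detect all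
    failures, and each fails on a finite set. *)
Let At_cofinite : finite_set [set y | A y /\ ~ At y].
Proof.
have [l [_ lP]] := words_enum X n.
have /choice[F FP] : forall v, exists F : set Y, finite_set F /\
    forall y, cut v y -> exists2 z, F z & orb act (rist v) y z.
  by move=> v; have [F] := cut_orbits_finite Gbranch Gfg actP hA v; exists F.
have /choice[kk kkP] : forall zw : Y * Y, exists k, orb act (K zw.1) zw.1 zw.2 ->
    K zw.1 k /\ act k zw.1 = zw.2.
  move=> [z w]; case: (pselect (orb act (K z) z w)) => [[k Kk e]|h].
    by exists k.
  by exists 1.
have fin : finite_set [set y | exists2 v, v \in l & exists2 z, F v z &
    exists2 w, orb act (K z) z w & (A y /\ ~ A (act (kk (z, w)) y))].
  apply: finite_set_bigcup_seq => v _; apply: finite_set_bigcup; first by case: (FP v).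
  by move=> z _; apply: finite_set_bigcup => // w _; apply: hA.
apply: sub_finite_set fin => y [Ay /existsNP[k /not_implyP[Kk nA]]].
exists (vert y); first exact/lP.
have [z Fz yz] := (FP (vert y)).2 y (cut_vert y); exists z => //.
have vz : vert z = vert y.
  by apply: vert_unique => //; apply: cut_orb yz (cut_vert y).
have Kz : K z = K y by rewrite /K vz.
exists (act k z); first by exists k; rewrite ?Kz.
split=> //; suff -> : act (kk (z, act k z)) y = act k y by [].
have [|Kkk e] := kkP (z, act k z); first by exists k; rewrite ?Kz.
have [r rr ry] : orb act (rist (vert y)) z y by rewrite -(orb_eq actP (sR _) yz); apply: orb_refl.
rewrite /= Kz in Kkk; rewrite -{1}ry -(actM actP) (cone_fixer_rist_commute Kkk rr).
rewrite (actM actP) e -(actM actP) -(cone_fixer_rist_commute Kk rr) (actM actP).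
by rewrite ry.
Qed.

Let bd (V : set Y) : set (Y * T) := [set ys | [/\ nuc ys.2, V ys.1 & ~ V (act ys.2 ys.1)]].

Let U := [seq vert y | y <- lA].

(** If [k] moves [s y] out of [A], then [s^-1 k s] moves [y] to a point of [A] that [s] takes out of
    [A], and this point has the same vertex as [y]. *)
Let At_bd_vert ys : bd At ys -> vert ys.1 \in U.
Proof.
move=> [ns Ay /existsNP[k /not_implyP[Kk nA]]]; case: ys => y s /= in ns Ay k Kk nA *.
have Kk' : K y (s^-1 * k * s).
  by have := K_conj s^-1 Kk; rewrite (actK actP) invgK.
rewrite -(vert_K Kk'); apply: (map_f (vert : {classic Y} -> seq X)).
apply: (lAP ns); first exact: Ay.
by rewrite -(actM actP) !mulgA mulgV mul1g (actM actP).
Qed.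

Let At_bd_fin : finite_set (bd At).
Proof.
have f : finite_set [set y | exists2 z, z \in lA & orb act (K z) z y].
  by apply: (finite_set_bigcup_seq (I := {classic Y})) => z _; apply: Kfin.
apply: sub_finite_set (finite_setX f (nuc_fin Gself Gcontr)) => -[y s].
move=> [/= ns Ay /existsNP[k /not_implyP[Kk nA]]]; split=> //=.
have Kk' : K y (s^-1 * k * s).
  by have := K_conj s^-1 Kk; rewrite (actK actP) invgK.
exists (act (s^-1 * k * s) y).
  apply: (lAP ns); first exact: Ay.
  by rewrite -(actM actP) !mulgA mulgV mul1g (actM actP).
exists (s^-1 * k * s)^-1; last by rewrite (actK actP).
by rewrite K_K //; apply: (subgroupV (sK _)).
Qed.

Let good (V : set Y) (l : seq {classic Y * T}) :=
  [/\ saturated V, infinite_set V, infinite_set (~` V),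
      forall ys, bd V ys -> ys \in l & forall ys, ys \in l -> vert ys.1 \in U].

Let nuc_invariant (V : set Y) : (forall y s, nuc s -> V y -> V (act s y)) ->
  (exists y, V y) -> forall z, V z.
Proof.
move=> hV [y Vy] z; have [g <-] := trans y z.
have [i pg] := pw_gen Gself Gcontr Grepl x0 Gfg g.
elim: i g pg => [|i IH] g; first by move=> /= ->; rewrite (act1 actP).
by move=> [s [h [ns ph ->]]]; rewrite (actM actP); apply: hV => //; apply: IH.
Qed.

(* A cut whose boundary is minimal has no finite component on either side. *)
Let minimal_cut : exists V, [/\ saturated V, infinite_set V, infinite_set (~` V),
  forall ys, bd V ys -> vert ys.1 \in U &
  forall P1 : set Y, finite_set P1 -> P1 !=set0 -> saturated P1 ->
    (P1 `<=` V -> (forall y s, nuc s -> P1 y -> V (act s y) -> P1 (act s y)) -> False) /\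
    (P1 `<=` ~` V -> (forall y s, nuc s -> P1 y -> ~ V (act s y) -> P1 (act s y)) -> False)].
Proof.
have ex : exists m, `[< exists V l, good V l /\ size l = m >].
  have [l lP] := @finite_set_seq {classic Y * T} _ At_bd_fin.
  exists (size l); apply/asboolP; exists At, l; split=> //; split=> //.
  - move=> f; apply: iA.
    have : finite_set (At `|` [set y | A y /\ ~ At y]) by rewrite finite_setU.
    by apply: sub_finite_set => y Ay; case: (pselect (At y)) => h; [left|right].
  - by move=> f; apply: iAc; apply: sub_finite_set f => y nA /At_sub.
  - by move=> ys /lP.
  - by move=> ys /lP/At_bd_vert.
case: (ex_minnP ex) => m /asboolP[V [l [[sV iV iVc bl lU] sl]]] minm.
exists V; split=> //; first by move=> ys /bl/lU.
(* A cut whose boundary omits an edge [ys] of the boundary of [V] is listed by [l] with duplicates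
   and [ys] removed, which is too short. *)
have smaller V2 ys : saturated V2 -> infinite_set V2 -> infinite_set (~` V2) ->
    bd V2 `<=` bd V -> bd V ys -> ~ bd V2 ys -> False.
  move=> sV2 i2 i2c sub bys nb2.
  have yl := bl _ bys.
  pose l2 : seq {classic Y * T} := rem (ys : {classic Y * T}) (undup l).
  have : (m <= size l2)%N.
    apply: minm; apply/asboolP; exists V2, l2; split=> //; split=> //.
      move=> zs b2; rewrite /l2 (@mem_rem_uniq {classic Y * T}) ?undup_uniq //.
      rewrite inE mem_undup (bl _ (sub _ b2)) andbT.
      by apply/eqP => e; apply: nb2; rewrite -e.
    by move=> zs /(@mem_rem {classic Y * T}); rewrite mem_undup => /lU.
  rewrite /l2 size_rem ?mem_undup // => h.
  have := leq_trans h (leq_trans (leq_pred _) (size_undup l)).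
  have l0 : (0 < size (undup l))%N.
    have : (ys : {classic Y * T}) \in undup l by rewrite mem_undup.
    by case: (undup l).
  have := size_undup l; rewrite -sl in h; move: h l0.
  by case: (size (undup l)) => // j; rewrite /= => h1 _ h2; have := leq_trans h2 h1; rewrite ltnn.
move=> P1 fP1 nP1 sP1.
have exit : exists y s, [/\ nuc s, P1 y & ~ P1 (act s y)].
  apply: contrapT => h; apply: Yinf; apply: sub_finite_set fP1 => z _.
  apply: nuc_invariant z => // y s ns Py; apply: contrapT => nP; apply: h.
  by exists y, s.
(* Recoloring a finite component removes the edges through which it is left and creates none, while
   both colors stay infinite. *)
split=> sub closed.
  have [y [s [ns Py nPs]]] := exit.
  apply: (smaller (V `\` P1) (y, s)).
  - move=> z k Kk [Vz nPz]; split; first exact: sV.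
    exact: (saturatedC sP1 Kk nPz).
  - move=> f; apply: iV; have : finite_set ((V `\` P1) `|` P1) by rewrite finite_setU.
    by apply: sub_finite_set => z Vz; case: (pselect (P1 z)) => h; [right|left].
  - by move=> f; apply: iVc; apply: sub_finite_set f => z nV [].
  - move=> [z t] [/= nt [Vz nPz] nV2]; split=> //= Vt; apply: nV2; split=> // Pt.
    apply: nPz; have := closed (act t z) t^-1 (nucV Gself Gcontr nt) Pt.
    by rewrite (actK actP); apply.
  - by split=> //=; [exact: sub|move=> Vs; apply: nPs; apply: closed].
  - by move=> [_ /= [_]].
have [y [s [ns Py nPs]]] := exit.
have Vs : V (act s y) by apply: contrapT => nV; apply: nPs; apply: closed.
apply: (smaller (V `|` P1) (act s y, s^-1)).
- by move=> z k Kk [Vz|Pz]; [left; apply: sV|right; apply: sP1].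
- by move=> f; apply: iV; apply: sub_finite_set f => z; left.
- move=> f; apply: iVc; have : finite_set (~` (V `|` P1) `|` P1) by rewrite finite_setU.
  apply: sub_finite_set => z nV; case: (pselect (P1 z)) => h; first by right.
  by left => -[].
- move=> [z t] [/= nt [Vz|Pz] nV2].
    by split=> //= Vt; apply: nV2; left.
  have nV2' := nV2; case: nV2; right; apply: closed => // Vt; apply: nV2'; by left.
- split=> //=; first exact: (nucV Gself Gcontr).
  by rewrite (actK actP); apply: sub.
- move=> [_ _ /=]; apply; right; by rewrite (actK actP).
Qed.

Lemma level_tile_cut : exists (a : seq X * T -> Prop) (U : seq (seq X)) (t0 t1 : seq X * T),
  [/\ (size U <= size lA)%N,
      forall t s, size t.1 = n -> nuc s -> a t -> ~ a (tact s t) -> t.1 \in U,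
      escapes Gself n a t0 & escapes Gself n (fun t => ~ a t) t1].
Proof.
have [V [sV iV iVc bU minV]] := minimal_cut.
(* Basing the tiles at an edge leaving [V] gives both colors a tile with nuclear group
   coordinate. *)
have [y0 [s0 [ns0 Vy0 nVs0]]] : exists y s, [/\ nuc s, V y & ~ V (act s y)].
  apply: contrapT => h; have [z nVz] := infinite_setN0 iVc; apply: nVz.
  apply: nuc_invariant z; last by have [y Vy] := infinite_setN0 iV; exists y.
  by move=> y s ns Vy; apply: contrapT => nV; apply: h; exists y, s.
pose t0 : seq X * T := (vert y0, 1).
(* The stabilizer of the base tile lies in [K y0], so a saturated set defines a coloring of tiles
   through the orbit map. *)
have fiber g g' : tact g t0 = tact g' t0 -> exists2 k, K y0 k & g' = g * k.
  move=> e; exists (g^-1 * g'); last by rewrite mulVKg.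
  have e3 : sec g (vert y0) = sec g' (vert y0).
    by apply: (mulIg 1); exact: (congr1 snd e).
  have e4 : g (vert y0) = g' (vert y0) := congr1 fst e.
  move=> w; rewrite group_of_actM (act_cat Gself) -e4 -e3.
  by rewrite -(act_cat Gself) group_of_actK.
have Vfiber (W : set Y) g g' : saturated W -> tact g t0 = tact g' t0 ->
    W (act g y0) -> W (act g' y0).
  move=> sW /fiber[k Kk ->] Wg.
  have -> : act (g * k) y0 = act (g * k * g^-1) (act g y0).
    by rewrite -!(actM actP) mulgVK.
  by apply: sW Wg; apply: K_conj.
have lift t : size t.1 = n -> exists g, t = tact g t0.
  case: t => u h su; have [g eg] := tile_transitive Gself Grepl 1 h
    (etrans (size_vert y0) (esym su)).
  by exists g.
pose a t := exists2 g, t = tact g t0 & V (act g y0).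
have aP g : a (tact g t0) <-> V (act g y0).
  by split=> [[g' e]|]; [apply: Vfiber|exists g].
have cone_tact g k : K (act g y0) k -> tact k (tact g t0) = tact g t0.
  rewrite /K vert_act => Kk; rewrite /tact /= (cone_fixer_fix Kk); congr pair.
  have -> : sec k (g (vert y0)) = 1 by apply: secP => w; rewrite Kk (cone_fixer_fix Kk).
  by rewrite mul1g.
have fin_tiles : finite_set [set t : seq X * T | size t.1 = n /\ pw 2 t.2].
  have [l [_ lP]] := words_enum X n.
  apply: sub_finite_set (finite_setX (finite_seq l) (pw_fin Gself Gcontr 2)).
  by move=> [u h] [/lP ? ?]; split.
have /choice[rep repP] : forall t, exists g, size t.1 = n -> t = tact g t0.
  move=> t; case: (pselect (size t.1 = n)) => [/lift[g e]|h]; first by exists g.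
  by exists 1.
(* A component staying in [pw 2] would involve finitely many tiles, and each corresponds to a finite
   [K]-orbit; its preimage [P1] would be a finite component of the minimal cut. *)
have esc (W : set Y) (Wt : seq X * T -> Prop) g1 : saturated W ->
    (forall g, Wt (tact g t0) <-> W (act g y0)) -> W (act g1 y0) ->
    (forall P1 : set Y, finite_set P1 -> P1 !=set0 -> saturated P1 -> P1 `<=` W ->
      (forall y s, nuc s -> P1 y -> W (act s y) -> P1 (act s y)) -> False) ->
    forall Z : seq X * T -> Prop, Z (tact g1 t0) ->
     (forall t s, Z t -> nuc s -> Wt (tact s t) -> Z (tact s t)) ->
     exists t, Z t /\ ~ pw 2 t.2.
  move=> sW WtP Wg1 minW Z Zg1 hZ; apply: contrapT => nesc.
  pose P1 := [set y | exists g, [/\ y = act g y0, Z (tact g t0) & W y]].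
  apply: (minW P1).
  - have f2 : finite_set [set y | exists2 t : seq X * T, size t.1 = n /\ pw 2 t.2 &
        [set act (rep t) z | z in orb act (K y0) y0] y].
      by apply: finite_set_bigcup => // t _; apply: finite_image.
    apply: sub_finite_set f2 => _ [g [-> Zg _]]; exists (tact g t0).
      split; first by rewrite /= size_act size_vert.
      by apply: contrapT => np; apply: nesc; exists (tact g t0).
    have [|k Kk e] := fiber (rep (tact g t0)) g.
      by rewrite -repP //= size_act size_vert.
    by exists (act k y0); [exists k|rewrite -(actM actP) -e].
  - by exists (act g1 y0), g1.
  - move=> y k Kk [g [e Zg Wg]]; rewrite e in Kk Wg *.
    exists (k * g); split; first by rewrite (actM actP).
      by rewrite tactM cone_tact.
    exact: sW.
  - by move=> y [g []].
  - move=> _ s ns [g [-> Zg Wg]] Ws; exists (s * g); split=> //.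
      by rewrite (actM actP).
    by rewrite tactM; apply: hZ => //; rewrite -tactM WtP (actM actP).
have e1 : tact 1 t0 = t0 by exact: tact1.
exists a, U, t0, (tact s0 t0); split.
- by rewrite size_map.
- move=> t s st ns; have [g ->] := lift t st; rewrite -tactM !aP (actM actP) => Vg nV.
  have := bU (act g y0, s); rewrite vert_act; apply.
  by split.
- split=> //; first exact: size_vert.
  + exact: (nuc1 Gself Gcontr x0).
  + by rewrite -e1 aP (act1 actP).
  + rewrite -e1; apply: (esc V a 1) => //; first by rewrite (act1 actP).
    by move=> P1 f1 n1 sat1; case: (minV P1 f1 n1 sat1).
- split.
  + by rewrite /= size_act size_vert.
  + have -> : (tact s0 t0).2 = sec s0 (vert y0) by exact: mulg1.
    exact: (nuc_sec Gself Gcontr).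
  + by rewrite aP.
  + apply: (esc (~` V) (fun t => ~ a t) s0) => //.
    * exact: saturatedC.
    * by move=> g; rewrite aP.
    * by move=> P1 f1 n1 sat1; case: (minV P1 f1 n1 sat1).
Qed.

End Level.

Lemma tile_cuts_of_commensurated : exists c, tile_cuts Gself c.
Proof. by exists (size lA) => n; apply: level_tile_cut. Qed.

End CommensuratedTileCuts.

Section MainTheorem.
Variables (X : finType) (G : groupClosed (tree_aut X)).
Local Notation T := (group_of G).

Lemma just_infinite_FW_or_cut_point : finitely_generated T -> self_similar G ->
  contracting G -> self_replicating G -> branch G -> just_infinite T ->
  ~ property_FW T -> exists z : limit_space G, local_cut_point z.
Proof.
move=> Gfg Gself Gcontr Grepl Gbranch JI nFW.
have [Y [act [A [actP trans hA iA iAc]]]] := not_FW_transitive Gfg nFW.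
(* A letter is available: over the empty alphabet the group is trivial, so a transitive set is a
   single point and has no infinite subset. *)
case: (pselect (exists x : X, True)) => [[x0 _]|nX].
  have [c hc] := tile_cuts_of_commensurated Gself Gcontr Gbranch Gfg Grepl JI x0 actP trans hA iA iAc.
  exact: (local_cut_point_of_tile_cuts Gcontr x0 Grepl Gfg hc).
have [y _] := infinite_setN0 iA.
case: iA; apply: sub_finite_set (finite_set1 y) => z _; have [g <-] := trans y z.
suff -> : g = 1 by rewrite (act1 actP).
apply: group_of_ext => -[|x v]; last by case: nX; exists x.
by apply: size0nil; rewrite size_act.
Qed.

End MainTheorem.

Theorem corollary3 (X : finType) (G : groupClosed (tree_aut X))
    (Gfg : finitely_generated (group_of G))
    (Gself : self_similar G)
    (Gcontr : contracting G)
    (Grepl : self_replicating G)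
    (Gbranch : branch G) :
  property_FW (group_of G) <->
  just_infinite (group_of G) /\
  ~ (exists z : limit_space G, local_cut_point z).
Proof.
split=> [FW|[JI nocut]]; first split.
- exact: (FW_just_infinite Gbranch Gfg FW).
- by move=> [z cz]; exact: (local_cut_point_not_FW Gself Gcontr Grepl Gfg cz FW).
- by apply: contrapT => nFW; apply: nocut; apply: just_infinite_FW_or_cut_point.
Qed.
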